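(* Let $W\in\mathbb{R}^{n\times n}$ be nonnegative, primitive and column-stochastic, with equilibrium vector $\pi$, $\beta_\pi=\|W-\pi\mathbb 1_n^\top\|_\pi$ and $\kappa_\pi=\max_i\pi_i/\min_i\pi_i$. Let $L,\Delta\ge0$ and $\sigma\ge0$. Suppose each $f_i:\mathbb{R}^d\to\mathbb{R}$ has $L$-Lipschitz gradient, $f=\frac1n\sum_{i=1}^n f_i$ satisfies $f(x^{(0)})-\inf_xf(x)\le\Delta$, and the stochastic gradients are unbiased with variance at most $\sigma^2$. Set $$R=\left\lceil\frac{(1+\sqrt{7\ln(\kappa_\pi)})^2+(1+\sqrt{2\ln(n)})^2}{1-\beta_\pi}\right\rceil,\qquad T=(K+1)R,$$ and run MG-Push-DIGing with step-size $\gamma=\big(\sum_{i=1}^6\gamma_i^{-1}\big)^{-1}$, where, with $\hat\beta=\beta_\pi^R$ and $\hat\sigma^2=\sigma^2/R$, $$\gamma_1=\Big(\tfrac{2n\Delta}{(K+1)L\hat\sigma^2}\Big)^{1/2},\quad \gamma_2=\Big(\tfrac{\Delta(1-\hat\beta)^3}{2(K+1)L^2\kappa_\pi^6\hat\beta^4\hat\sigma^2}\Big)^{1/3},\quad \gamma_3=\Big(\tfrac{n^2\Delta(1-\hat\beta)^4}{1200(K+1)L^4\kappa_\pi^8\hat\beta^4\hat\sigma^2}\Big)^{1/5},$$ $$\gamma_4=\Big(\tfrac{(1-\hat\beta)^2\Delta}{4L^2\kappa_\pi^4\hat\beta^2\,\mathbb{E}[\|\mathbf y^{(0)}\|_F^2]}\Big)^{1/3},\quad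 \gamma_5=\tfrac{(1-\hat\beta)^2}{40L\kappa_\pi^7\hat\beta},\quad \gamma_6=\tfrac1{2L}$$ (with $\gamma_i^{-1}=0$ when the denominator in $\gamma_i$ vanishes). Then $$\frac1{K+1}\sum_{k=0}^{K}\mathbb{E}\big[\|\nabla f(\bar x^{(k)})\|_2^2\big]=\widetilde{\mathcal O}\left(\frac{\sigma\sqrt{L\Delta}}{\sqrt{nT}}+\frac{(1+\ln(\kappa_\pi))L\Delta}{(1-\beta_\pi)T}\right),$$ where $\widetilde{\mathcal O}(\cdot)$ absorbs logarithmic factors independent of $\kappa_\pi$, $\beta_\pi$, and $T$.
   Context: Mixing matrix: $W$ is column-stochastic if $\mathbb 1_n^\top W=\mathbb 1_n^\top$ ($\mathbb 1_n$ the all-ones vector). The equilibrium vector $\pi$ is the unique vector with positive entries, $W\pi=\pi$, $\mathbb 1_n^\top\pi=1$. $\|A\|_\pi:=\|\mathrm{diag}(\sqrt\pi)^{-1}A\,\mathrm{diag}(\sqrt\pi)\|_2$ for $A\in\mathbb{R}^{n\times n}$ (spectral norm, square root entrywise); one has $\beta_\pi\in[0,1)$. $\|\cdot\|_F$ is the Frobenius norm. Stochastic gradients: $f_i(x)=\mathbb{E}_{\xi_i\sim\mathcal D_i}[F(x;\xi_i)]$, and node $i$ has an oracle $\nabla F(x;\xi_i)$ with $\mathbb{E}[\nabla F(x;\xi_i)]=\nabla f_i(x)$ and $\mathbb{E}[\|\nabla F(x;\xi_i)-\nabla f_i(x)\|^2]\le\sigma^2$ for all $x\in\mathbb{R}^d$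 and all $1\le i\le n$. Below, $\xi_i^{(k,r)}$ is the $r$-th sample in the batch drawn by node $i$ from $\mathcal D_i$ at iteration $k$. MG-Push-DIGing (Push-DIGing with $R$ rounds of gossip and batches of $R$ stochastic gradients): let $\mathbf g^{(k)}\in\mathbb{R}^{n\times d}$ have $i$-th row $\big(\frac1R\sum_{r=1}^R\nabla F(w_i^{(k)};\xi_i^{(k,r)})\big)^\top$, where $(w_i^{(k)})^\top$ is the $i$-th row of $\mathbf w^{(k)}\in\mathbb{R}^{n\times d}$. Initialize $\mathbf w^{(0)}=\mathbf x^{(0)}$ (all rows equal to $(x^{(0)})^\top$), $\mathbf y^{(0)}=\mathbf g^{(0)}$, $v^{(0)}=\mathbb 1_n$, and for $k\ge0$ $$\mathbf x^{(k+1)}=W^R(\mathbf x^{(k)}-\gamma\mathbf y^{(k)}),\quad v^{(k+1)}=W^Rv^{(k)},\quad \mathbf w^{(k+1)}=\mathrm{diag}(v^{(k+1)})^{-1}\mathbf x^{(k+1)},\quad \mathbf y^{(k+1)}=W^R\big(\mathbf y^{(k)}+\mathbf g^{(k+1)}-\mathbf g^{(k)}\big).$$ $\bar x^{(k)}=\frac1n\sum_i x_i^{(k)}$, where $(x_i^{(k)})^\top$ is the $i$-th row of $\mathbf x^{(k)}$.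
   Formalization: The factor hidden in the O-tilde may depend on the ratio of the average of the squared norms of the gradients of f_i at x^(0) to L·Delta, besides powers of 1+ln n (with absolute constants the claim fails, since gamma_4 can be arbitrarily small); beta_pi<1 is assumed explicitly. *)

(* Defs.v *)
From HB Require Import structures.
From mathcomp Require Import all_boot all_order all_algebra.
From mathcomp Require Import all_classical all_reals all_analysis.
Set Implicit Arguments.
Unset Strict Implicit.
Unset Printing Implicit Defensive.
Import Order.TTheory GRing.Theory Num.Theory.
Import numFieldNormedType.Exports.
Local Open Scope classical_set_scope.
Local Open Scope ring_scope.

(* On row and column vectors this is the Euclidean norm (the library norm on
   matrices is the maximum norm, which is not the one needed here). *)
Definition normF {R : realType} {m n : nat} (A : 'M[R]_(m, n)) : R :=
  Num.sqrt (\sum_i \sum_j A i j ^+ 2).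

Definition spectral_norm {R : realType} {m n : nat} (A : 'M[R]_(m, n)) : R :=
  sup [set normF (A *m x) | x in [set x : 'cV[R]_n | normF x <= 1]].

Definition gradient {R : realType} {d : nat} (f : 'rV[R]_d -> R)
    (x : 'rV[R]_d) : 'rV[R]_d :=
  \row_j 'D_(delta_mx 0 j) f x.

Definition lipschitz_gradient {R : realType} {d : nat} (L : R)
    (f : 'rV[R]_d -> R) : Prop :=
  (forall x, differentiable f x) /\
  (forall x y, normF (gradient f x - gradient f y) <= L * normF (x - y)).

Definition nonnegative_mx {R : realType} {n : nat} (W : 'M[R]_n) : Prop :=
  forall i j, 0 <= W i j.

Definition primitive_mx {R : realType} {n : nat} (W : 'M[R]_n) : Prop :=
  exists m : nat, (0 < m)%N /\ forall i j, 0 < (W ^+ m) i j.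

Definition column_stochastic {R : realType} {n : nat} (W : 'M[R]_n) : Prop :=
  (const_mx 1 : 'rV[R]_n) *m W = const_mx 1.

Definition equilibrium {R : realType} {n : nat} (W : 'M[R]_n)
    (p : 'cV[R]_n) : Prop :=
  [/\ forall i, 0 < p i 0, W *m p = p & \sum_i p i 0 = 1].

Definition pi_norm {R : realType} {n : nat} (p : 'cV[R]_n)
    (A : 'M[R]_n) : R :=
  let D := diag_mx (map_mx Num.sqrt p^T) in
  spectral_norm (invmx D *m A *m D).

Definition beta_pi {R : realType} {n : nat} (W : 'M[R]_n)
    (p : 'cV[R]_n) : R :=
  pi_norm p (W - p *m const_mx 1).

(* The entries of an equilibrium vector lie in ]0, 1], so the neutral elements
   0 and 1 do not affect the maximum and the minimum. *)
Definition kappa_pi {R : realType} {n : nat} (p : 'cV[R]_n) : R :=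
  (\big[Num.max/0]_i p i 0) / (\big[Num.min/1]_i p i 0).

Definition gossip_rounds {R : realType} (n : nat) (beta kappa : R) : nat :=
  `|Num.ceil (((1 + Num.sqrt (7 * ln kappa)) ^+ 2
               + (1 + Num.sqrt (2 * ln n%:R)) ^+ 2) / (1 - beta))|%N.

(* The inverse of (num / den) to the power e, as an extended real: 0 when den
   vanishes, and +oo when den does not vanish but num does. *)
Definition inv_gamma {R : realType} (num den e : R) : \bar R :=
  if den == 0 then 0%E else (((num / den) `^ e)%:E^-1)%E.

(* s2 is the variance proxy of the batched gradients (sigma^2 divided by the
   number of rounds), b the contraction factor of the iterated gossip, and Y0
   the second moment of the initial tracker. If some gamma_i is 0, the sum of
   the inverses is +oo and the step-size is 0. All the inverses vanish exactly
   when L = 0; the step-size formula has then no finite value, every gradient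
   is constant, and the value returned (0) is irrelevant. *)
Definition step_size {R : realType} (n K : nat)
    (L Delta s2 kappa b Y0 : R) : R :=
  let K1 : R := K.+1%:R in
  let N : R := n%:R in
  let i1 := inv_gamma (2 * N * Delta) (K1 * L * s2) 2^-1 in
  let i2 := inv_gamma (Delta * (1 - b) ^+ 3)
              (2 * K1 * L ^+ 2 * kappa ^+ 6 * b ^+ 4 * s2) 3^-1 in
  let i3 := inv_gamma (N ^+ 2 * Delta * (1 - b) ^+ 4)
              (1200 * K1 * L ^+ 4 * kappa ^+ 8 * b ^+ 4 * s2) 5^-1 in
  let i4 := inv_gamma ((1 - b) ^+ 2 * Delta)
              (4 * L ^+ 2 * kappa ^+ 4 * b ^+ 2 * Y0) 3^-1 in
  let i5 := inv_gamma ((1 - b) ^+ 2) (40 * L * kappa ^+ 7 * b) 1 in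
  let i6 := inv_gamma 1 (2 * L) 1 in
  fine ((i1 + i2 + i3 + i4 + i5 + i6)^-1)%E.

Record push_diging_state (R : realType) (n d : nat) := PushDigingState {
  pd_x : 'M[R]_(n, d);
  pd_v : 'cV[R]_n;
  pd_w : 'M[R]_(n, d);
  pd_y : 'M[R]_(n, d) }.

(* M is the mixing matrix of one iteration (a power of W), and G k w is the
   matrix of the stochastic gradients drawn at iteration k, evaluated at the
   rows of w. *)
Fixpoint push_diging {R : realType} {n d : nat} (M : 'M[R]_n) (gamma : R)
    (x0 : 'rV[R]_d) (G : nat -> 'M[R]_(n, d) -> 'M[R]_(n, d)) (k : nat) :
    push_diging_state R n d :=
  match k with
  | 0%N =>
      let x := \matrix_(i < n) x0 in PushDigingState x (const_mx 1) x (G 0%N x)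
  | k'.+1 =>
      let s := push_diging M gamma x0 G k' in
      let x := M *m (pd_x s - gamma *: pd_y s) in
      let v := M *m pd_v s in
      let w := invmx (diag_mx v^T) *m x in
      let y := M *m (pd_y s + G k'.+1 w - G k' (pd_w s)) in
      PushDigingState x v w y
  end.

Definition row_mean {R : realType} {n d : nat} (x : 'M[R]_(n, d)) : 'rV[R]_d :=
  n%:R^-1 *: \sum_i row i x.

Definition batch_gradient {R : realType} {n d : nat} {Xi : Type} (B : nat)
    (gF : 'rV[R]_d -> Xi -> 'rV[R]_d) (z : 'I_n -> 'I_B -> Xi)
    (w : 'M[R]_(n, d)) : 'M[R]_(n, d) :=
  \matrix_(i < n) (B%:R^-1 *: \sum_r gF (row i w) (z i r)).

Definition mutually_independent {R : realType} {dO dX : measure_display}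
    {Omega : measurableType dO} {Xi : measurableType dX}
    (P : probability Omega R) {I : choiceType} (X : I -> Omega -> Xi) : Prop :=
  forall (s : seq I) (A : I -> set Xi),
    uniq s -> (forall i, measurable (A i)) ->
    P (\bigcap_(i in [set` s]) (X i @^-1` A i)) =
    (\prod_(i <- s) P (X i @^-1` A i))%E.

Definition local_cost {R : realType} {dX : measure_display}
    {Xi : measurableType dX} {d : nat} (D : probability Xi R)
    (F : 'rV[R]_d -> Xi -> R) (x : 'rV[R]_d) : R :=
  fine ('E_D[F x])%E.

Definition mean_cost {R : realType} {n d : nat} (f : 'I_n -> 'rV[R]_d -> R)
    (x : 'rV[R]_d) : R :=
  n%:R^-1 * \sum_i f i x.

(* No regularity of F in x is required; where F^~ z has no partial derivative
   the value is the library's default, constrained only by the hypotheses of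
   unbiasedness and bounded variance. *)
Definition oracle {R : realType} {Xi : Type} {d : nat}
    (F : 'rV[R]_d -> Xi -> R) (x : 'rV[R]_d) (z : Xi) : 'rV[R]_d :=
  gradient (F^~ z) x.

(* Joint measurability in (x, z) is stated with the product sigma-algebra on
   R^d, which the library puts on d-tuples. *)
Definition measurable_oracle {R : realType} {dX : measure_display}
    {Xi : measurableType dX} {d : nat}
    (gF : 'rV[R]_d -> Xi -> 'rV[R]_d) : Prop :=
  forall j : 'I_d,
    measurable_fun setT
      (fun p : d.-tuple R * Xi => gF (\row_l tnth p.1 l) p.2 0 j).

Definition unbiased {R : realType} {dX : measure_display}
    {Xi : measurableType dX} {d : nat} (D : probability Xi R)
    (gF : 'rV[R]_d -> Xi -> 'rV[R]_d) (f : 'rV[R]_d -> R) : Prop :=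
  forall x (j : 'I_d), ('E_D[fun z => (gF x z 0 j)%R] = (gradient f x 0%R j)%:E)%E.

Definition variance_le {R : realType} {dX : measure_display}
    {Xi : measurableType dX} {d : nat} (D : probability Xi R)
    (gF : 'rV[R]_d -> Xi -> 'rV[R]_d) (f : 'rV[R]_d -> R) (s2 : R) : Prop :=
  forall x, ('E_D[fun z => (normF (gF x z - gradient f x) ^+ 2)%R] <= s2%:E)%E.

(* Dimensionless size of the local gradients at the starting point. It enters
   the rate through gamma_4 and is controlled by no other parameter of the
   problem: heterogeneous local costs can make it arbitrarily large while
   n, L, Delta and sigma are fixed. *)
Definition initial_ratio {R : realType} {n d : nat} (L Delta : R)
    (f : 'I_n -> 'rV[R]_d -> R) (x0 : 'rV[R]_d) : R :=
  (n%:R^-1 * \sum_i normF (gradient (f i) x0) ^+ 2) / (L * Delta).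

(* Main.v *)
Require Import Defs.
From HB Require Import structures.
From mathcomp Require Import all_boot all_order all_algebra.
From mathcomp Require Import all_classical all_reals all_analysis.
From mathcomp Require Import measurable_realfun ring lra.
Set Implicit Arguments.
Unset Strict Implicit.
Unset Printing Implicit Defensive.
Import Order.TTheory GRing.Theory Num.Theory.
Import numFieldNormedType.Exports.
Local Open Scope classical_set_scope.
Local Open Scope ring_scope.

(* Write A = W^R, b = beta^R. The choice of R gives b <= exp(-R(1 - beta)), hence
   b kappa^7 n^2 <= 1/4, and this lets every consensus term be estimated crudely.
   The deviations x - v xbar and y - v ybar have zero column sums, so A contracts
   them by b in the pi-weighted norm; together with v >= (3/4) n pi from the first
   step on, this bounds w - 1 xbar by the successive differences of the gradients,
   and the loop is closed by gamma L b kappa^7 <= 1/40. With the descent lemma this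
   yields a deterministic inequality for each sample path, linear in the squared
   norms of the sampling noise and in its inner product with the gradient of f.
   Expectations are only taken in that inequality: by Fubini on the product of
   (Omega, sigma-algebra of all samples but one) with the law of the remaining
   sample, the inner product has mean 0 and the noises of distinct samples are
   orthogonal. This gives a mean of the sum of squared gradients of order
   Delta / gamma, and Delta / gamma is the sum of the six terms Delta / gamma_i,
   each one bounded by the two terms of the rate through a weighted product. *)

(** * Independence and leave-one-out sigma-algebras *)

(** All samples of one iteration are evaluated at the same state, so a filtration indexed by the
    iterations does not separate two of them. The sigma-algebra of all samples but one does: the
    current state and the other noises of the same iteration are measurable for it, and the later
    samples that it also contains do no harm. Averaging over the remaining sample is then a plain
    integral against its law, and no conditional expectation occurs. The exponents in b kappa^7 n^2
    are the largest ones met: kappa^7 in gamma_5, and n^2 in the part of gamma_4 that comes from the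
    noise of the initial tracker. Once b swallows them, the terms other than gamma_1 and gamma_6
    change only the constant, up to the factor 1 + rho, where rho is the initial ratio; no number of
    gossip rounds controls rho. Two degenerate cases escape the descent argument. If L = 0, the mean
    cost is bounded below with a constant gradient, which must vanish. If the step-size is 0, then
    Delta = 0, so the starting point is a minimizer that the mean iterate never leaves. *)

Section independent_pair.
Context (R : realType) (d d1 d2 : measure_display) (T : measurableType d)
  (T1 : measurableType d1) (T2 : measurableType d2).
Variables (P : probability T R) (Q : probability T2 R).
Variables (U : T -> T1) (V : T -> T2).
Hypotheses (mU : measurable_fun setT U) (mV : measurable_fun setT V).
Hypothesis indep : forall A B, measurable A -> measurable B ->
  P (U @^-1` A `&` V @^-1` B) = (P (U @^-1` A) * Q B)%E.

HB.instance Definition _ := isMeasurableFun.Build _ _ _ _ U mU.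

Let UV (w : T) := (U w, V w).

Let mUV : measurable_fun setT UV.
Proof. exact: measurable_fun_pair. Qed.

HB.instance Definition _ := isMeasurableFun.Build _ _ _ _ UV mUV.

(** By [indep] the joint law of [U] and [V] agrees with the product measure on rectangles, and this
    determines it. *)
Let prod_lawE (A : set (T1 * T2)) : measurable A ->
  (distribution P U \x Q)%E A = distribution P UV A.
Proof.
apply: product_measure_unique => B C mB mC.
by rewrite /distribution /pushforward /= -indep.
Qed.

Variable f : T1 * T2 -> R.
Hypothesis mf : measurable_fun setT f.

Lemma independent_pair_ge0_integral : (forall z, 0 <= f z) ->
  (\int[P]_w (f (U w, V w))%:E = \int[P]_w \int[Q]_z (f (U w, z))%:E)%E.
Proof.
move=> f0.
have mEf : measurable_fun setT (fun z : T1 * T2 => (f z)%:E) by exact/measurable_EFinP.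
have Ef0 (z : T1 * T2) : (0 <= (f z)%:E)%E by rewrite lee_fin.
have := @fubini_tonelli1 _ _ _ _ _ (distribution P U) Q _ mEf Ef0.
rewrite [in RHS]ge0_integral_pushforward//=; last 2 first.
- exact: measurable_fun_fubini_tonelli_F.
- by move=> x _; apply: integral_ge0 => z _; rewrite lee_fin.
rewrite preimage_setT /fubini_F /= => <-.
rewrite (eq_measure_integral (distribution P UV)); last first.
  by move=> A mA _; exact: prod_lawE.
by rewrite ge0_integral_pushforward.
Qed.

(** Integrability is assumed along the pair itself, where it can be checked; the joint law carries
    it over to the product measure, where Fubini needs it. *)
Lemma independent_pair_integral :
  P.-integrable setT (fun w => (f (U w, V w))%:E) ->
  (\int[P]_w (f (U w, V w))%:E = \int[P]_w \int[Q]_z (f (U w, z))%:E)%E.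
Proof.
move=> iw.
have mEf : measurable_fun setT (fun z : T1 * T2 => (f z)%:E) by exact/measurable_EFinP.
have i2 : (distribution P U \x Q)%E.-integrable setT (fun z : T1 * T2 => (f z)%:E).
  apply/integrableP; split => //.
  rewrite (eq_measure_integral (distribution P UV)); last first.
    by move=> A mA _; exact: prod_lawE.
  have /integrableP[//] : (distribution P UV).-integrable setT (EFin \o f).
  exact: integrable_pushforward.
have := integral12_prod_meas1 i2.
have := integrable_fubini_F i2; rewrite /fubini_F => iF.
have mF := measurable_int _ iF.
rewrite integral_pushforward//=; last first.
  apply/integrableP; split; first exact: measurableT_comp.
  have /integrableP[_] := iF.
  rewrite ge0_integral_pushforward//=; exact: measurableT_comp.
rewrite preimage_setT => ->.
rewrite (eq_measure_integral (distribution P UV)); last first.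
  by move=> A mA _; exact: prod_lawE.
by rewrite integral_pushforward.
Qed.

End independent_pair.

Section leave_one_out.
Context (R : realType) (dO dX : measure_display) (Omega : measurableType dO)
  (Xi : measurableType dX) (P : probability Omega R) (I : choiceType)
  (X : I -> Omega -> Xi).
Hypothesis mX : forall i, measurable_fun setT (X i).
Hypothesis indX : mutually_independent P X.

(** The generators are finite intersections and not single preimages, so that they form a
    pi-system. *)
Definition cylinders_but (i0 : I) : set (set Omega) :=
  [set C | exists (s : seq I) (A : I -> set Xi),
    [/\ uniq s, i0 \notin s, (forall i, measurable (A i)) &
        C = \bigcap_(i in [set` s]) (X i @^-1` A i)]].

(** The carrier is still [Omega]: one and the same function can be declared measurable for the full
    or for the smaller sigma-algebra by a type annotation. *)
Definition all_but (i0 : I) := g_sigma_algebraType (cylinders_but i0).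

Lemma measurable_all_but (i0 i : I) : i != i0 ->
  measurable_fun setT (X i : all_but i0 -> Xi).
Proof.
move=> ne _ B mB; rewrite setTI; apply: sub_sigma_algebra.
exists [:: i], (fun=> B); split => //.
  by rewrite inE eq_sym.
apply/seteqP; split => [w Bw j /=|w /(_ i)]; last by apply; rewrite /= inE.
by rewrite inE => /eqP ->.
Qed.

Let preimageX (i : I) (B : set Xi) : measurable B -> measurable (X i @^-1` B).
Proof. by move=> mB; rewrite -[_ @^-1` _]setTI; exact: mX. Qed.

Lemma cylinders_but_measurable (i0 : I) : cylinders_but i0 `<=` measurable.
Proof.
move=> _ [s [A [_ _ mA ->]]]; apply: fin_bigcap_measurable => // i _.
exact: preimageX.
Qed.

(** The identity towards the coarser sigma-algebra is the random element to be paired with the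
    sample [X i0] in [independent_pair_integral]. *)
Lemma measurable_id_all_but (i0 : I) :
  measurable_fun setT (id : Omega -> all_but i0).
Proof.
move=> _ B mB; rewrite setTI preimage_id.
exact: (smallest_sub (@sigma_algebra_measurable _ Omega)
  (@cylinders_but_measurable i0)) mB.
Qed.

Lemma setI_closed_cylinders_but (i0 : I) : setI_closed (cylinders_but i0).
Proof.
move=> _ _ [s [A [us si mA ->]]] [t [B [ut ti mB ->]]].
exists (undup (s ++ t)), (fun i => (if i \in s then A i else setT) `&`
   (if i \in t then B i else setT)); split.
- exact: undup_uniq.
- by rewrite mem_undup mem_cat negb_or si.
- by move=> i; apply: measurableI; case: ifP.
- apply/seteqP; split => w /=.
    move=> [Aw Bw] i _ /=; split; case: ifP => // ii; [exact: Aw|exact: Bw].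
  move=> h; split => i /= ii.
    have /h[] : i \in undup (s ++ t) by rewrite mem_undup mem_cat ii.
    by rewrite /= ii.
  have /h[] : i \in undup (s ++ t) by rewrite mem_undup mem_cat ii orbT.
  by rewrite /= ii.
Qed.

(** As functions of [A] both sides are finite measures: [P] restricted to an event, and [P] scaled
    by a number. Mutual independence makes them equal on the pi-system of cylinders, hence on the
    generated sigma-algebra. *)
Lemma all_but_independent (i0 : I) (A : set (all_but i0)) (B : set Xi) :
  measurable A -> measurable B ->
  P (A `&` X i0 @^-1` B) = (P A * P (X i0 @^-1` B))%E.
Proof.
move=> mA mB.
have mB' := preimageX i0 mB.
pose r := fine (P (X i0 @^-1` B)).
have r0 : 0 <= r by exact: fine_ge0.
have rE : P (X i0 @^-1` B) = r%:E by rewrite fineK// fin_num_measure.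
have := @g_sigma_algebra_measure_unique _ R Omega (cylinders_but i0)
  (@cylinders_but_measurable i0) (fun=> setT) _ _
  (mrestr P mB') (mscale (NngNum r0) P)
  (@setI_closed_cylinders_but i0) _ _ A mA.
rewrite /mscale /mrestr /= rE muleC; apply => //.
- move=> _; exists [::], (fun=> setT); split => //.
  by rewrite set_nil bigcap_set0.
- by rewrite bigcup_const.
- move=> C [s [D [us si mD ->]]].
  (* The cylinder over [s] is extended by the event [B] at [i0], so that mutual independence applies
     to [i0 :: s]. *)
  pose D' i := if i == i0 then B else D i.
  have mD' i : measurable (D' i) by rewrite /D'; case: ifP.
  have sD' i : i \in s -> D' i = D i.
    by rewrite /D'; case: eqP => // -> i0s; rewrite i0s in si.
  have D'0 : D' i0 = B by rewrite /D' eqxx.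
  have us' : uniq (i0 :: s) by rewrite /= si.
  have := indX us' mD'.
  rewrite big_cons [in RHS]D'0 rE (eq_big_seq (fun i => P (X i @^-1` D i))).
    rewrite -(indX us mD) /mrestr /mscale /= => <-; congr (P _); apply/seteqP; split => w /=.
      move=> [Dw Bw] i; rewrite /= inE => /orP[/eqP->|ii]; first by rewrite D'0.
      by rewrite sD'//; exact: Dw.
    move=> h; split; last by have := h i0; rewrite /= inE eqxx D'0; apply.
    by move=> i /= ii; rewrite -sD'//; apply: h; rewrite /= inE ii orbT.
  by move=> i /sD' ->.
- by move=> _; rewrite /mrestr setTI rE ltry.
Qed.
End leave_one_out.

(** * Square-integrable random variables *)

Section square_integrable.
Context (R : realType) (d : measure_display) (T : measurableType d)
  (P : probability T R).

Definition square_integrable (X : T -> R) : Prop :=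
  measurable_fun setT X /\ P.-integrable setT (fun w => (X w ^+ 2)%:E).

Lemma integrable_dominated (X Y : T -> R) : measurable_fun setT X ->
  (forall w, `|X w| <= Y w) -> P.-integrable setT (EFin \o Y) ->
  P.-integrable setT (EFin \o X).
Proof.
move=> mX XY iY; apply: le_integrable iY => //; first exact/measurable_EFinP.
move=> w _ /=; rewrite lee_fin; apply: le_trans (XY w) _; exact: ler_norm.
Qed.

Lemma square_integrable_dominated (X Y : T -> R) : measurable_fun setT X ->
  (forall w, X w ^+ 2 <= Y w) -> P.-integrable setT (EFin \o Y) ->
  square_integrable X.
Proof.
move=> mX XY iY; split => //; apply: integrable_dominated iY.
  by apply: measurable_funX.
by move=> w; rewrite ger0_norm ?sqr_ge0.
Qed.

Lemma integrable_cstR (c : R) : P.-integrable setT (fun=> c%:E).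
Proof. exact: finite_measure_integrable_cst. Qed.

Lemma square_integrable_cst (c : R) : square_integrable (fun=> c).
Proof. by split; [exact: measurable_cst|exact: integrable_cstR]. Qed.

Lemma square_integrableD (X Y : T -> R) :
  square_integrable X -> square_integrable Y ->
  square_integrable (fun w => X w + Y w).
Proof.
move=> [mX iX] [mY iY].
apply: (@square_integrable_dominated _ (fun w => 2 * X w ^+ 2 + 2 * Y w ^+ 2)).
- exact: measurable_funD.
- move=> w; have := sqr_ge0 (X w - Y w); lra.
- apply: (@eq_integrable _ _ _ _ _ measurableT
   ((fun w => 2%:E * (X w ^+ 2)%:E) \+ (fun w => 2%:E * (Y w ^+ 2)%:E))%E) => //.
  by apply: integrableD => //; apply: integrableZl.
Qed.

Lemma square_integrableZ (c : R) (X : T -> R) :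
  square_integrable X -> square_integrable (fun w => c * X w).
Proof.
move=> [mX iX]; split; first exact: measurable_funM.
apply: (@eq_integrable _ _ _ _ _ measurableT
  (fun w => (c ^+ 2)%:E * (X w ^+ 2)%:E)%E) => //.
  by move=> w _; rewrite -EFinM exprMn.
exact: integrableZl.
Qed.

Lemma square_integrable_sum (I : Type) (s : seq I) (X : I -> T -> R) :
  (forall i, square_integrable (X i)) ->
  square_integrable (fun w => \sum_(i <- s) X i w).
Proof.
move=> sX; elim: s => [|i s ih].
  by under eq_fun do rewrite big_nil; exact: square_integrable_cst.
by under eq_fun do rewrite big_cons; exact: square_integrableD.
Qed.

Lemma square_integrableM (X Y : T -> R) :
  square_integrable X -> square_integrable Y ->
  P.-integrable setT (fun w => (X w * Y w)%:E).
Proof.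
move=> [mX iX] [mY iY].
apply: (@integrable_dominated _ (fun w => X w ^+ 2 + Y w ^+ 2)).
- exact: measurable_funM.
- move=> w; rewrite ler_norml.
  have := sqr_ge0 (X w - Y w); have := sqr_ge0 (X w + Y w).
  have := sqr_ge0 (X w); have := sqr_ge0 (Y w).
  by move=> *; apply/andP; split; lra.
- apply: (@eq_integrable _ _ _ _ _ measurableT
   ((fun w => (X w ^+ 2)%:E) \+ (fun w => (Y w ^+ 2)%:E))%E) => //.
  exact: integrableD.
Qed.

Lemma integrable_sumR (I : Type) (s : seq I) (X : I -> T -> R) :
  (forall i, P.-integrable setT (fun w => (X i w)%:E)) ->
  P.-integrable setT (fun w => (\sum_(i <- s) X i w)%:E).
Proof.
move=> sX; elim: s => [|i s ih].
  by under eq_fun do rewrite big_nil; exact: integrable_cstR.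
by under eq_fun do rewrite big_cons EFinD; exact: integrableD.
Qed.

Lemma Rintegral_sumR (I : Type) (s : seq I) (X : I -> T -> R) :
  (forall i, P.-integrable setT (fun w => (X i w)%:E)) ->
  \int[P]_w (\sum_(i <- s) X i w) = \sum_(i <- s) \int[P]_w X i w.
Proof.
move=> sX; elim: s => [|i s ih].
  rewrite big_nil; under eq_Rintegral do rewrite big_nil.
  by rewrite Rintegral_cst// mul0r.
rewrite big_cons -ih; under eq_Rintegral do rewrite big_cons.
by rewrite RintegralD//; [exact: sX|exact: integrable_sumR].
Qed.

Lemma Rintegral_sqr_sum_orthogonal (I : finType) (X : I -> T -> R) :
  (forall i, square_integrable (X i)) ->
  (forall i j, i != j -> \int[P]_w (X i w * X j w) = 0) ->
  \int[P]_w ((\sum_i X i w) ^+ 2) = \sum_i \int[P]_w (X i w ^+ 2).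
Proof.
move=> sX oX.
have iX i j : P.-integrable setT (fun w => (X i w * X j w)%:E).
  exact: square_integrableM.
transitivity (\int[P]_w \sum_i \sum_j X i w * X j w).
  apply: eq_Rintegral => w _; rewrite expr2 mulr_suml.
  by apply: eq_bigr => i _; rewrite mulr_sumr.
rewrite Rintegral_sumR; last by move=> i; exact: integrable_sumR.
apply: eq_bigr => i _; rewrite Rintegral_sumR// (bigD1 i)//= big1 ?addr0//.
by move=> j ji; rewrite oX// eq_sym.
Qed.

End square_integrable.

(** The integral is the difference of those of the positive and negative parts, and each of them is
    measurable in the parameter by Tonelli. *)
Lemma measurable_fun_integral2 (R : realType) (d1 d2 : measure_display)
    (T1 : measurableType d1) (T2 : measurableType d2) (Q : probability T2 R)
    (f : T1 * T2 -> R) : measurable_fun setT f ->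
  measurable_fun setT (fun x => fine (\int[Q]_z (f (x, z))%:E)%E).
Proof.
move=> mf; apply: measurableT_comp; first exact: fine_measurable.
have mEf : measurable_fun setT (fun z : T1 * T2 => (f z)%:E).
  exact/measurable_EFinP.
rewrite (_ : (fun _ => _) = fubini_F Q (fun z : T1 * T2 => (f z)%:E)^\+ \-
   fubini_F Q (fun z : T1 * T2 => (f z)%:E)^\-)%E.
  apply: emeasurable_funB; apply: measurable_fun_fubini_tonelli_F => //.
    exact: measurable_funepos.
  exact: measurable_funeneg.
apply/funext => x; rewrite [LHS]integralE /fubini_F.
by congr (_ - _)%E; apply: eq_integral => z _; rewrite unlock.
Qed.

(** * Noise of a single sample *)

Lemma EFin_Rintegral (R : realType) (d : measure_display)
    (T : measurableType d) (P : probability T R) (X : T -> R) :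
  P.-integrable setT (fun w => (X w)%:E) ->
  (\int[P]_w X w)%:E = (\int[P]_w (X w)%:E)%E.
Proof. by move=> iX; rewrite /Rintegral fineK//; exact: integrable_fin_num. Qed.

Lemma normF_sqr (R : realType) (m n : nat) (A : 'M[R]_(m, n)) :
  normF A ^+ 2 = \sum_i \sum_j A i j ^+ 2.
Proof.
rewrite /normF sqr_sqrtr// sumr_ge0// => i _.
by rewrite sumr_ge0// => j _; exact: sqr_ge0.
Qed.

Lemma normF_row_sqr (R : realType) (n : nat) (A : 'rV[R]_n) :
  normF A ^+ 2 = \sum_j A 0 j ^+ 2.
Proof. by rewrite normF_sqr big_ord1. Qed.

Definition mx_measurable (R : realType) (d : measure_display)
    (T : measurableType d) (m n : nat) (w : T -> 'M[R]_(m, n)) : Prop :=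
  forall i j, measurable_fun setT (fun t => w t i j).

Section oracle_measurability.
Context (R : realType) (dX : measure_display) (Xi : measurableType dX) (d : nat)
  (gF : 'rV[R]_d -> Xi -> 'rV[R]_d).
Hypothesis mgF : measurable_oracle gF.

Lemma measurable_oracle_comp (d' : measure_display) (T : measurableType d')
    (w : T -> 'rV[R]_d) (Z : T -> Xi) :
  mx_measurable w -> measurable_fun setT Z ->
  mx_measurable (fun t => gF (w t) (Z t)).
Proof.
move=> mw mZ i j; rewrite ord1.
have wE t : w t = \row_l tnth [tuple w t 0 l | l < d] l.
  by apply/rowP => l; rewrite mxE tnth_mktuple.
under eq_fun do rewrite wE.
have mp : measurable_fun setT (fun t => ([tuple w t 0 l | l < d], Z t)).
  apply: measurable_fun_pair => //; apply/measurable_fun_tnthP => l.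
  rewrite (_ : _ \o _ = fun t => w t 0 l); first exact: mw.
  by apply/funext => t /=; rewrite tnth_mktuple.
exact: (measurableT_comp (mgF j) mp).
Qed.

(** Unbiasedness expresses the gradient as a parametrized integral of the jointly measurable
    oracle. *)
Lemma measurable_unbiased_gradient (Q : probability Xi R) (f : 'rV[R]_d -> R)
    (d' : measure_display) (T : measurableType d') (w : T -> 'rV[R]_d) :
  unbiased Q gF f -> mx_measurable w ->
  mx_measurable (fun t => gradient f (w t)).
Proof.
move=> ub mw i j; rewrite ord1.
have gE t : gradient f (w t) 0 j = fine (\int[Q]_z (gF (w t) z 0 j)%:E)%E.
  by have := ub (w t) j; rewrite unlock => ->.
under eq_fun do rewrite gE.
have h : measurable_fun setT (fun p : T * Xi => gF (w p.1) p.2 0 j).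
  apply: measurable_oracle_comp => //.
  by move=> a b; apply: (measurableT_comp (mw a b)).
exact: (measurable_fun_integral2 Q h).
Qed.

End oracle_measurability.

Section sample_noise.
Context (R : realType) (dO dX : measure_display) (Omega : measurableType dO)
  (Xi : measurableType dX) (P : probability Omega R) (I : choiceType)
  (X : I -> Omega -> Xi).
Hypothesis mX : forall i, measurable_fun setT (X i).
Hypothesis indX : mutually_independent P X.
Context (d : nat) (gF : 'rV[R]_d -> Xi -> 'rV[R]_d) (f : 'rV[R]_d -> R)
  (Q : probability Xi R) (s2 : R).
Hypothesis mgF : measurable_oracle gF.
Hypothesis ub : unbiased Q gF f.
Hypothesis vle : variance_le Q gF f s2.
Variable s : I.
Hypothesis lawX : forall A, measurable A -> P (X s @^-1` A) = Q A.
Variable w : Omega -> 'rV[R]_d.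
(** The type annotation is the point: the oracle is evaluated at a place that depends only on the
    samples other than [s]. *)
Hypothesis mw : mx_measurable (w : all_but X s -> 'rV[R]_d).

Let u (t : Omega) := gF (w t) (X s t) - gradient f (w t).

Let indep_s (A : set (all_but X s)) (B : set Xi) :
  measurable A -> measurable B ->
  P ((id : Omega -> all_but X s) @^-1` A `&` X s @^-1` B) =
  (P ((id : Omega -> all_but X s) @^-1` A) * Q B)%E.
Proof.
by move=> mA mB; rewrite preimage_id all_but_independent// lawX.
Qed.

Let mfst : mx_measurable (fun p : all_but X s * Xi => w p.1).
Proof. by move=> a b; apply: (measurableT_comp (mw a b)). Qed.

Let mh (j : 'I_d) : measurable_fun setT (fun p : all_but X s * Xi =>
  (gF (w p.1) p.2 - gradient f (w p.1)) 0 j).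
Proof.
under eq_fun do rewrite mxE [X in _ + X]mxE.
apply: measurable_funB; first exact: measurable_oracle_comp.
exact: (measurable_unbiased_gradient mgF ub mfst).
Qed.

Lemma noise_measurable : mx_measurable u.
Proof.
move=> i j; rewrite ord1.
exact: (measurableT_comp (mh j)
  (measurable_fun_pair (measurable_id_all_but mX (i0 := s)) (mX s))).
Qed.

(** By Tonelli the sample [s] is integrated first, at a frozen evaluation point, where the variance
    bound applies. The statement is in extended reals because square-integrability of the noise is
    deduced from it. *)
Lemma noise_second_moment : (\int[P]_t (normF (u t) ^+ 2)%:E <= s2%:E)%E.
Proof.
have mf : measurable_fun setT (fun p : all_but X s * Xi =>
    normF (gF (w p.1) p.2 - gradient f (w p.1)) ^+ 2).
  under eq_fun do rewrite normF_row_sqr.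
  by apply: measurable_sum => j; apply: measurable_funX.
have := independent_pair_ge0_integral (measurable_id_all_but mX (i0 := s)) (mX s)
  indep_s mf (fun=> sqr_ge0 _).
rewrite /= /u => ->.
have le2 t : (\int[Q]_z (normF (gF (w t) z - gradient f (w t)) ^+ 2)%:E <= s2%:E)%E.
  by have := vle (w t); rewrite unlock.
apply: (@le_trans _ _ (\int[P]_t s2%:E)%E).
  apply: ge0_le_integral => //.
  - by move=> t _; apply: integral_ge0 => z _; rewrite lee_fin sqr_ge0.
  - have mE : measurable_fun setT (fun p : all_but X s * Xi =>
      (normF (gF (w p.1) p.2 - gradient f (w p.1)) ^+ 2)%:E).
      exact/measurable_EFinP.
    have := measurable_fun_fubini_tonelli_F (m2 := Q) _ mE.
    move=> /(_ _)/measurableT_comp; apply; last exact: (measurable_id_all_but mX (i0 := s)).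
    by move=> p; rewrite lee_fin sqr_ge0.
by rewrite integral_cst//= probability_setT mule1.
Qed.

Lemma noise_square_integrable i j : square_integrable P (fun t => u t i j).
Proof.
have mu := noise_measurable.
apply: (@square_integrable_dominated _ _ _ _ _ (fun t => normF (u t) ^+ 2)) => //.
  move=> t; rewrite normF_row_sqr ord1 (bigD1 j)//= lerDl sumr_ge0// => k _.
  exact: sqr_ge0.
apply/integrableP; split.
  apply/measurable_EFinP; under eq_fun do rewrite normF_row_sqr.
  by apply: measurable_sum => k; apply: measurable_funX.
under eq_integral do rewrite gee0_abs ?lee_fin ?sqr_ge0//.
by apply: le_lt_trans noise_second_moment _; exact: ltry.
Qed.

Lemma noise_sum_second_moment :
  \sum_j \int[P]_t (u t 0 j ^+ 2) <= s2.
Proof.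
rewrite -Rintegral_sumR; last by move=> j; exact: (noise_square_integrable 0 j).2.
rewrite -lee_fin EFin_Rintegral//; last first.
  by apply: integrable_sumR => j; exact: (noise_square_integrable 0 j).2.
by under eq_integral do rewrite -normF_row_sqr; exact: noise_second_moment.
Qed.

(** Fubini freezes both [Z] and the evaluation point; what remains is the mean of a centred
    oracle. *)
Lemma noise_orthogonal (Z : Omega -> R) i j :
  measurable_fun setT (Z : all_but X s -> R) -> square_integrable P Z ->
  \int[P]_t (Z t * u t i j) = 0.
Proof.
move=> mZ sZ; rewrite ord1.
have mf : measurable_fun setT (fun p : all_but X s * Xi =>
    Z p.1 * (gF (w p.1) p.2 - gradient f (w p.1)) 0 j).
  by apply: measurable_funM => //; apply: (measurableT_comp mZ).
have iZ := square_integrableM sZ (noise_square_integrable 0 j).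
have := independent_pair_integral (measurable_id_all_but mX (i0 := s)) (mX s)
  indep_s mf iZ.
rewrite /Rintegral /= /u => ->.
rewrite integral0_eq// => t _.
have mg : measurable_fun setT (fun z => gF (w t) z 0 j).
  apply: (measurable_oracle_comp mgF (w := fun=> w t) (Z := id)) => //.
have mEg : measurable_fun setT (fun z => (gF (w t) z 0 j)%:E).
  exact/measurable_EFinP.
(* Unbiasedness gives integrability as well: a difference of extended reals is finite only if both
   terms are, so the positive and the negative part both have a finite integral. *)
have ig : Q.-integrable setT (fun z => (gF (w t) z 0 j)%:E).
  have : (\int[Q]_z (gF (w t) z 0 j)%:E)%E \is a fin_num.
    by have := ub (w t) j; rewrite unlock => ->.
  rewrite integralE fin_numB => /andP[ip iN]; apply/integrableP; split => //.
  rewrite -[X in integral _ _ X]/(abse \o _) fune_abse.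
  rewrite ge0_integralD//; last 2 first.
    exact: measurable_funepos.
    exact: measurable_funeneg.
  by rewrite lte_add_pinfty// ltey_eq ?ip ?iN.
under eq_integral do rewrite mxE [X in _ + X]mxE mulrBr EFinB !EFinM.
rewrite integralB//=; last 2 first.
  exact: integrableZl.
  exact: integrable_cstR.
rewrite integralZl// integral_cst//= probability_setT mule1.
by have := ub (w t) j; rewrite unlock => ->; rewrite subee.
Qed.

End sample_noise.

Lemma gradient_mean_cost (R : realType) (n d : nat) (f : 'I_n -> 'rV[R]_d -> R)
    (x : 'rV[R]_d) : (forall i y, differentiable (f i) y) ->
  gradient (mean_cost f) x = n%:R^-1 *: \sum_i gradient (f i) x.
Proof.
move=> df; apply/rowP => j; rewrite !mxE summxE.
have dv i : derivable (f i) x (delta_mx 0 j) by exact: diff_derivable.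
have -> : mean_cost f = n%:R^-1 \*: (\sum_i f i).
  by apply/funext => y; rewrite /mean_cost /= fct_sumE.
rewrite deriveZ; last exact: derivable_sum.
rewrite derive_sum//; congr (_ * _).
by apply: eq_bigr => i _; rewrite mxE.
Qed.

Lemma normFD_sqr (R : realType) (m n : nat) (A B : 'M[R]_(m, n)) :
  normF (A + B) ^+ 2 <= 2 * normF A ^+ 2 + 2 * normF B ^+ 2.
Proof.
rewrite !normF_sqr !mulr_sumr -big_split; apply: ler_sum => i _ /=.
rewrite !mulr_sumr -big_split; apply: ler_sum => j _ /=.
rewrite mxE; have := sqr_ge0 (A i j - B i j); lra.
Qed.

Lemma normF_ge0 (R : realType) (m n : nat) (A : 'M[R]_(m, n)) : 0 <= normF A.
Proof. exact: sqrtr_ge0. Qed.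

Definition true_gradients (R : realType) (n d : nat)
    (f : 'I_n -> 'rV[R]_d -> R) (w : 'M[R]_(n, d)) : 'M[R]_(n, d) :=
  \matrix_i gradient (f i) (row i w).

(** * Properties propagated by the linear part of the iteration *)

Section linear_closure.
Context (R : realType) (T : Type) (C : (T -> R) -> Prop).
Hypothesis C_cst : forall c, C (fun=> c).
Hypothesis C_add : forall X Y, C X -> C Y -> C (fun t => X t + Y t).
Hypothesis C_scale : forall c X, C X -> C (fun t => c * X t).

Let mxC (m n : nat) (w : T -> 'M[R]_(m, n)) : Prop :=
  forall i j, C (fun t => w t i j).

Let C_sum (I : Type) (s : seq I) (X : I -> T -> R) : (forall i, C (X i)) ->
  C (fun t => \sum_(i <- s) X i t).
Proof.
move=> CX; elim: s => [|i s ih].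
  by under eq_fun do rewrite big_nil; exact: C_cst.
by under eq_fun do rewrite big_cons; exact: C_add.
Qed.

Let mxC_mul (m n p : nat) (A : 'M[R]_(m, n)) (w : T -> 'M[R]_(n, p)) :
  mxC w -> mxC (fun t => A *m w t).
Proof.
move=> Cw i j; under eq_fun do rewrite mxE.
by apply: C_sum => k; exact: C_scale.
Qed.

Let mxCD (m n : nat) (w z : T -> 'M[R]_(m, n)) :
  mxC w -> mxC z -> mxC (fun t => w t + z t).
Proof. by move=> Cw Cz i j; under eq_fun do rewrite mxE; exact: C_add. Qed.

Let mxCZ (m n : nat) (c : R) (w : T -> 'M[R]_(m, n)) :
  mxC w -> mxC (fun t => c *: w t).
Proof. by move=> Cw i j; under eq_fun do rewrite mxE; exact: C_scale. Qed.

Let mxCB (m n : nat) (w z : T -> 'M[R]_(m, n)) :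
  mxC w -> mxC z -> mxC (fun t => w t - z t).
Proof.
move=> Cw Cz; under eq_fun do rewrite -scaleN1r.
by apply: mxCD => //; exact: mxCZ.
Qed.

Context (n d : nat) (M : 'M[R]_n) (gamma : R) (x0 : 'rV[R]_d)
  (G : T -> nat -> 'M[R]_(n, d) -> 'M[R]_(n, d)).
Let pd t k := push_diging M gamma x0 (G t) k.

Lemma push_diging_v_indep (t t' : T) k : pd_v (pd t k) = pd_v (pd t' k).
Proof. by elim: k => //= k ->. Qed.

(** Apart from the evaluations of the oracle, the iteration is linear in the state, with
    coefficients that do not depend on [t] because [v] does not. It is applied with [C] being
    measurability, measurability for [all_but], and square-integrability. The strict inequality for
    [y] reflects that the tracker of iteration k already involves the samples of iteration k, while
    [x] and [w] do not. *)
Lemma push_diging_closed (m : nat) :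
  (forall k, (k < m)%N -> mxC (fun t => pd_w (pd t k)) ->
     mxC (fun t => G t k (pd_w (pd t k)))) ->
  forall k, (k <= m)%N ->
    [/\ mxC (fun t => pd_x (pd t k)), mxC (fun t => pd_w (pd t k)) &
        (k < m)%N -> mxC (fun t => pd_y (pd t k))].
Proof.
move=> CG; elim=> [|k ih] km.
  have c0 : mxC (fun=> \matrix_(i < n) x0) by move=> i j; exact: C_cst.
  by split => // m0; exact: (CG 0%N).
have [Cx Cw /(_ km) Cy] := ih (ltnW km).
have Cx' : mxC (fun t => pd_x (pd t k.+1)).
  by apply: mxC_mul; apply: mxCB => //; exact: mxCZ.
have Cw' : mxC (fun t => pd_w (pd t k.+1)).
  (* A point of [T] is needed to name the common value of the weights [v]. *)
  case: (pselect (exists t : T, True)) => [[t0 _]|nT]; last first.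
    by move=> i j; rewrite (_ : (fun _ => _) = (fun=> 0)) //;
      apply/funext => t; exfalso; apply: nT; exists t.
  have -> : (fun t => pd_w (pd t k.+1)) =
    (fun t => invmx (diag_mx (M *m pd_v (pd t0 k))^T) *m pd_x (pd t k.+1)).
    by apply/funext => t; rewrite (push_diging_v_indep t0 t).
  exact: mxC_mul.
split=> // km'; apply: mxC_mul; apply: mxCB; last exact: CG.
by apply: mxCD => //; exact: CG.
Qed.

End linear_closure.

(** A Lipschitz gradient grows at most linearly: it is compared with its value at 0. *)
Lemma square_integrable_gradient (R : realType) (d' : measure_display)
    (T : measurableType d') (P : probability T R) (d : nat) (L : R)
    (f : 'rV[R]_d -> R) (w : T -> 'rV[R]_d) : 0 <= L ->
  (forall x y, normF (gradient f x - gradient f y) <= L * normF (x - y)) ->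
  (forall i j, square_integrable P (fun t => w t i j)) ->
  mx_measurable (fun t => gradient f (w t)) ->
  forall i j, square_integrable P (fun t => gradient f (w t) i j).
Proof.
move=> L0 lip sw mg i j; rewrite ord1.
apply: (@square_integrable_dominated _ _ _ _ _ (fun t =>
  2 * normF (gradient f 0) ^+ 2 + \sum_j (2 * L ^+ 2) * w t 0 j ^+ 2)) => //.
  move=> t; rewrite -mulr_sumr -normF_row_sqr.
  apply: (@le_trans _ _ (normF (gradient f (w t)) ^+ 2)).
    rewrite normF_row_sqr (bigD1 j)//= lerDl sumr_ge0// => k _.
    exact: sqr_ge0.
  rewrite -[X in normF X](addrNK (gradient f 0)).
  apply: le_trans (normFD_sqr _ _) _.
  have : normF (gradient f (w t) - gradient f 0) ^+ 2 <= (L * normF (w t)) ^+ 2.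
    have := lip (w t) 0; rewrite subr0 => h.
    by rewrite lerXn2r// nnegrE ?mulr_ge0 ?normF_ge0.
  by rewrite exprMn; lra.
apply: (@eq_integrable _ _ _ _ _ measurableT
   ((fun=> (2 * normF (gradient f 0) ^+ 2)%:E) \+
    (fun t => (\sum_j (2 * L ^+ 2) * w t 0 j ^+ 2)%:E))%E) => //.
apply: integrableD => //; first exact: integrable_cstR.
apply: integrable_sumR => k.
apply: (@eq_integrable _ _ _ _ _ measurableT
   (fun t => (2 * L ^+ 2)%:E * (w t 0 k ^+ 2)%:E)%E) => //.
by apply: integrableZl => //; exact: (sw 0 k).2.
Qed.

(** * Noise of the algorithm *)

Lemma measurable_lin (R : realType) (d : measure_display) (T : measurableType d) :
  [/\ forall c : R, measurable_fun (setT : set T) (fun=> c),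
      forall X Y : T -> R, measurable_fun setT X -> measurable_fun setT Y ->
        measurable_fun setT (fun t => X t + Y t) &
      forall (c : R) (X : T -> R), measurable_fun setT X ->
        measurable_fun setT (fun t => c * X t)].
Proof.
split=> [c|X Y|c X]; first exact: measurable_cst.
  exact: measurable_funD.
by move=> mX; exact: measurable_funM.
Qed.

Section process_noise.
Context (R : realType) (n d B : nat) (L s2 gamma : R) (M : 'M[R]_n)
  (x0 : 'rV[R]_d) (dX dO : measure_display) (Xi : measurableType dX)
  (Omega : measurableType dO) (D : 'I_n -> probability Xi R)
  (P : probability Omega R) (gF : 'rV[R]_d -> Xi -> 'rV[R]_d)
  (f : 'I_n -> 'rV[R]_d -> R) (xi : 'I_n -> nat -> 'I_B -> Omega -> Xi).
Hypotheses (L0 : 0 <= L) (n0 : (0 < n)%N) (B0 : (0 < B)%N).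
Hypothesis lip : forall i, lipschitz_gradient L (f i).
Hypothesis mgF : measurable_oracle gF.
Hypothesis ub : forall i, unbiased (D i) gF (f i).
Hypothesis vle : forall i, variance_le (D i) gF (f i) s2.
Hypothesis mxi : forall i k r, measurable_fun setT (xi i k r).
Hypothesis lxi : forall i k r A, measurable A -> P (xi i k r @^-1` A) = D i A.
Let X (s : 'I_n * nat * 'I_B) := xi s.1.1 s.1.2 s.2.
Hypothesis ixi : mutually_independent P X.

Let G (t : Omega) (k : nat) : 'M[R]_(n, d) -> 'M[R]_(n, d) :=
  batch_gradient gF (fun i r => xi i k r t).
Let pd t k := push_diging M gamma x0 (G t) k.

Let mX s : measurable_fun setT (X s). Proof. exact: mxi. Qed.

Let batch_measurable (d' : measure_display) (T : measurableType d')
    (k : nat) (w : T -> 'M[R]_(n, d)) (phi : T -> Omega) :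
  (forall i r, measurable_fun setT (xi i k r \o phi)) ->
  mx_measurable w -> mx_measurable (fun t => G (phi t) k (w t)).
Proof.
move=> mz mw i j; under eq_fun do rewrite !mxE summxE.
apply: measurable_funM => //; apply: measurable_sum => r.
apply: (measurable_oracle_comp mgF) => //; last exact: mz.
by move=> a b; under eq_fun do rewrite mxE; exact: mw.
Qed.

(** Up to iteration [m], [x] and [w] are built from samples of iterations before [m], and so never
    from the sample [(i0, m, r0)]. *)
Let pd_all_but (i0 : 'I_n) (m : nat) (r0 : 'I_B) k : (k <= m)%N ->
  mx_measurable (fun t : all_but X (i0, m, r0) => pd_x (pd t k)) /\
  mx_measurable (fun t : all_but X (i0, m, r0) => pd_w (pd t k)).
Proof.
move=> km; have [lc la ls] := @measurable_lin R _ (all_but X (i0, m, r0)).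
have [|Cx Cw _] := @push_diging_closed R _ _ lc la ls n d M gamma x0 G m _ k km; last by split.
move=> k' k'm mw; apply: batch_measurable => // i r.
apply: (@measurable_all_but _ _ _ _ _ X (i0, m, r0) (i, k', r)).
by apply/negP => /eqP[_ kE _]; rewrite kE ltnn in k'm.
Qed.

Let pd_measurable k : mx_measurable (fun t => pd_x (pd t k)) /\
  mx_measurable (fun t => pd_w (pd t k)).
Proof.
have [lc la ls] := @measurable_lin R _ Omega.
have [|Cx Cw _] := @push_diging_closed R _ _ lc la ls n d M gamma x0 G k _ k (leqnn k); last by split.
by move=> k' k'm mw; apply: (batch_measurable (phi := id)) => // i r; exact: mxi.
Qed.

Let u k i r t := gF (row i (pd_w (pd t k))) (xi i k r t)
  - gradient (f i) (row i (pd_w (pd t k))).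

Let w_all_but (i0 : 'I_n) (m : nat) (r0 : 'I_B) (i : 'I_n) :
  mx_measurable (fun t : all_but X (i0, m, r0) => row i (pd_w (pd t m))).
Proof.
by move=> a b; under eq_fun do rewrite mxE; exact: (pd_all_but i0 r0 (leqnn m)).2.
Qed.

Let u_sq k i r a b : square_integrable P (fun t => u k i r t a b).
Proof.
exact: (@noise_square_integrable _ _ _ _ _ P _ X mX ixi _ gF (f i) (D i) s2
  mgF (@ub i) (@vle i) (i, k, r) (@lxi i k r) _ (@w_all_but i k r i)).
Qed.

Let u_moment k i r : \sum_j \int[P]_t (u k i r t 0 j ^+ 2) <= s2.
Proof.
exact: (@noise_sum_second_moment _ _ _ _ _ P _ X mX ixi _ gF (f i) (D i) s2
  mgF (@ub i) (@vle i) (i, k, r) (@lxi i k r) _ (@w_all_but i k r i)).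
Qed.

Let u_orth k i r (Z : Omega -> R) a b :
  measurable_fun setT (Z : all_but X (i, k, r) -> R) -> square_integrable P Z ->
  \int[P]_t (Z t * u k i r t a b) = 0.
Proof.
exact: (@noise_orthogonal _ _ _ _ _ P _ X mX ixi _ gF (f i) (D i) s2
  mgF (@ub i) (@vle i) (i, k, r) (@lxi i k r) _ (@w_all_but i k r i)).
Qed.

(** The first noise plays the part of [Z]: its evaluation point and its sample are both measurable
    for the sigma-algebra that omits only [(i', k, r')]. *)
Let u_cross k i r i' r' a b : (i, r) != (i', r') ->
  \int[P]_t (u k i r t a b * u k i' r' t a b) = 0.
Proof.
move=> ne; apply: u_orth => //.
rewrite /u; under eq_fun do rewrite mxE [X in _ + X]mxE.
apply: measurable_funB.
  apply: (measurable_oracle_comp mgF (@w_all_but i' k r' i)).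
  apply: (@measurable_all_but _ _ _ _ _ X (i', k, r') (i, k, r)).
  by apply: contra ne => /eqP[-> ->].
exact: (measurable_unbiased_gradient mgF (@ub i) (@w_all_but i' k r' i)).
Qed.

Definition sampling_noise k t : 'M[R]_(n, d) :=
  G t k (pd_w (pd t k)) - true_gradients f (pd_w (pd t k)).

Let noiseE k t i j : sampling_noise k t i j = B%:R^-1 * \sum_r u k i r t 0 j.
Proof.
rewrite !mxE summxE /u.
under [in RHS]eq_bigr do rewrite mxE [X in _ + X]mxE.
rewrite sumrB mulrBr sumr_const card_ord [in RHS]mxE -[X in _ = _ - _ * X]mulr_natl mulKf// pnatr_eq0.
by rewrite -lt0n.
Qed.

Lemma sampling_noise_square_integrable k i j :
  square_integrable P (fun t => sampling_noise k t i j).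
Proof.
under eq_fun do rewrite noiseE.
by apply: square_integrableZ; exact: square_integrable_sum.
Qed.

Lemma integral_normF_sqr (m p : nat) (A : Omega -> 'M[R]_(m, p)) :
  (forall i j, square_integrable P (fun t => A t i j)) ->
  P.-integrable setT (fun t => (normF (A t) ^+ 2)%:E) /\
  \int[P]_t (normF (A t) ^+ 2) = \sum_i \sum_j \int[P]_t (A t i j ^+ 2).
Proof.
move=> sA.
have iA i j := (sA i j).2.
have isA i : P.-integrable setT (fun t => (\sum_j A t i j ^+ 2)%:E).
  exact: integrable_sumR.
split.
  by under eq_fun do rewrite normF_sqr; exact: integrable_sumR.
under eq_Rintegral do rewrite normF_sqr.
rewrite Rintegral_sumR//; apply: eq_bigr => i _.
by rewrite Rintegral_sumR.
Qed.

Lemma sampling_noise_moment k :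
  \int[P]_t (normF (sampling_noise k t) ^+ 2) <= n%:R * (s2 / B%:R).
Proof.
have sS := sampling_noise_square_integrable k.
rewrite (integral_normF_sqr sS).2.
rewrite -[n in n%:R]card_ord -sum1_card natr_sum mulr_suml.
apply: ler_sum => i _; rewrite mul1r.
have B0' : 0 < B%:R :> R by rewrite ltr0n.
apply: (@le_trans _ _ (\sum_j B%:R^-1 ^+ 2 * \sum_r \int[P]_t (u k i r t 0 j ^+ 2))).
  apply: ler_sum => j _.
  under eq_Rintegral do rewrite noiseE exprMn.
  rewrite RintegralZl//; last first.
    by have [_] := square_integrable_sum (index_enum 'I_B) (fun r => u_sq k i r 0 j).
  rewrite Rintegral_sqr_sum_orthogonal// => r r' rr'; apply: u_cross.
  by apply: contra rr' => /eqP[->].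
rewrite -mulr_sumr exchange_big/=.
apply: (@le_trans _ _ (B%:R^-1 ^+ 2 * \sum_(r < B) s2)).
  by rewrite ler_wpM2l ?sqr_ge0//; apply: ler_sum => r _; exact: u_moment.
rewrite sumr_const card_ord -[s2 *+ _]mulr_natr.
suff -> : B%:R^-1 ^+ 2 * (s2 * B%:R) = s2 / B%:R by [].
by field; rewrite gt_eqF.
Qed.

Let mean_noiseE k t j : row_mean (sampling_noise k t) 0 j =
  n%:R^-1 * B%:R^-1 * \sum_(p : 'I_n * 'I_B) u k p.1 p.2 t 0 j.
Proof.
rewrite mxE summxE -mulrA; congr (_ * _).
rewrite -(pair_bigA _ (fun i r => u k i r t 0 j))/= mulr_sumr.
by apply: eq_bigr => i _; rewrite mxE noiseE.
Qed.

Lemma mean_noise_square_integrable k i j :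
  square_integrable P (fun t => row_mean (sampling_noise k t) i j).
Proof.
rewrite ord1; under eq_fun do rewrite mean_noiseE.
by apply: square_integrableZ; exact: square_integrable_sum.
Qed.

(** The mean over the nodes averages n B orthogonal noises; the extra factor 1/n is the linear
    speed-up in the first term of the rate. *)
Lemma mean_noise_moment k :
  \int[P]_t (normF (row_mean (sampling_noise k t)) ^+ 2) <= s2 / B%:R / n%:R.
Proof.
rewrite (integral_normF_sqr (mean_noise_square_integrable k)).2 big_ord1.
have B0' : 0 < B%:R :> R by rewrite ltr0n.
have n0' : 0 < n%:R :> R by rewrite ltr0n.
apply: (@le_trans _ _ (\sum_j (n%:R^-1 * B%:R^-1) ^+ 2 *
   \sum_(p : 'I_n * 'I_B) \int[P]_t (u k p.1 p.2 t 0 j ^+ 2))).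
  apply: ler_sum => j _.
  under eq_Rintegral do rewrite mean_noiseE exprMn.
  rewrite RintegralZl//; last first.
    by have [_] := square_integrable_sum (index_enum ('I_n * 'I_B)%type)
      (fun p => u_sq k p.1 p.2 0 j).
  rewrite Rintegral_sqr_sum_orthogonal// => p p' pp'; apply: u_cross.
  by rewrite -!surjective_pairing.
rewrite -mulr_sumr exchange_big/=.
apply: (@le_trans _ _ ((n%:R^-1 * B%:R^-1) ^+ 2 * \sum_(p : 'I_n * 'I_B) s2)).
  by rewrite ler_wpM2l ?sqr_ge0//; apply: ler_sum => r _; exact: u_moment.
rewrite sumr_const card_prod !card_ord -[s2 *+ _]mulr_natr natrM.
suff -> : (n%:R^-1 * B%:R^-1) ^+ 2 * (s2 * (n%:R * B%:R)) = s2 / B%:R / n%:R by [].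
by field; rewrite !gt_eqF.
Qed.

Let mean_all_but (i0 : 'I_n) (m : nat) (r0 : 'I_B) :
  mx_measurable (fun t : all_but X (i0, m, r0) => row_mean (pd_x (pd t m))).
Proof.
move=> a b; under eq_fun do rewrite mxE summxE.
apply: measurable_funM => //; apply: measurable_sum => i.
by under eq_fun do rewrite mxE; exact: (pd_all_but i0 r0 (leqnn m)).1.
Qed.

Let pd_sq k : (forall i j, square_integrable P (fun t => pd_x (pd t k) i j)) /\
  (forall i j, square_integrable P (fun t => pd_w (pd t k) i j)).
Proof.
have [|Cx Cw _] := @push_diging_closed R _ _ (square_integrable_cst P)
  (@square_integrableD _ _ _ P) (@square_integrableZ _ _ _ P) n d M gamma x0 G k _ k (leqnn k); last by split.
move=> k' k'm sw i j.
(* The batch gradient is noise plus true gradient: the noise is square-integrable unconditionally,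
   and the true gradient inherits it from [w]. *)
have -> : (fun t => G t k' (pd_w (push_diging M gamma x0 (G t) k')) i j) =
   (fun t => sampling_noise k' t i j + gradient (f i) (row i (pd_w (pd t k'))) 0 j).
  by apply/funext => t; rewrite /sampling_noise [in RHS]mxE -[RHS]addrA !mxE addNr addr0.
apply: square_integrableD; first exact: sampling_noise_square_integrable.
apply: (square_integrable_gradient L0 (lip i).2).
  by move=> a b; under eq_fun do rewrite mxE; exact: sw.
apply: (measurable_unbiased_gradient mgF (@ub i)).
by move=> a b; under eq_fun do rewrite mxE; exact: (pd_measurable k').2.
Qed.

Let mean_sq k i j : square_integrable P (fun t => row_mean (pd_x (pd t k)) i j).
Proof.
under eq_fun do rewrite mxE summxE; apply: square_integrableZ.
by apply: square_integrable_sum => a; under eq_fun do rewrite mxE; exact: (pd_sq k).1.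
Qed.

Let gradE x := gradient_mean_cost x (fun i y => (lip i).1 y).

Lemma mean_gradient_square_integrable k i j :
  square_integrable P (fun t => gradient (mean_cost f) (row_mean (pd_x (pd t k))) i j).
Proof.
under eq_fun do rewrite gradE mxE summxE.
apply: square_integrableZ; apply: square_integrable_sum => a.
apply: (square_integrable_gradient L0 (lip a).2 (mean_sq k)).
apply: (measurable_unbiased_gradient mgF (@ub a)).
by move=> b c; exact: (mean_sq k b c).1.
Qed.

(** The mean iterate depends on earlier samples only, so its gradient is orthogonal to each
    individual noise of iteration [k]. *)
Lemma mean_gradient_noise_orthogonal k :
  P.-integrable setT (fun t => (\sum_j
    gradient (mean_cost f) (row_mean (pd_x (pd t k))) 0 j *
    row_mean (sampling_noise k t) 0 j)%:E) /\
  \int[P]_t (\sum_j gradient (mean_cost f) (row_mean (pd_x (pd t k))) 0 j *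
    row_mean (sampling_noise k t) 0 j) = 0.
Proof.
have iM j : P.-integrable setT (fun t =>
   (gradient (mean_cost f) (row_mean (pd_x (pd t k))) 0 j *
    row_mean (sampling_noise k t) 0 j)%:E).
  apply: square_integrableM; first exact: mean_gradient_square_integrable.
  exact: mean_noise_square_integrable.
split; first exact: integrable_sumR.
rewrite Rintegral_sumR// big1// => j _.
have sg := mean_gradient_square_integrable k 0 j.
under eq_Rintegral do rewrite mean_noiseE mulrCA mulr_sumr.
have iu (p : 'I_n * 'I_B) : P.-integrable setT (fun t =>
   (gradient (mean_cost f) (row_mean (pd_x (pd t k))) 0 j * u k p.1 p.2 t 0 j)%:E).
  by apply: square_integrableM.
rewrite RintegralZl//; last exact: integrable_sumR.
rewrite Rintegral_sumR// big1 ?mulr0// => -[i r] _ /=.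
apply: u_orth => //.
under eq_fun do rewrite gradE mxE summxE.
apply: measurable_funM => //; apply: measurable_sum => a.
exact: (measurable_unbiased_gradient mgF (@ub a) (@mean_all_but i k r)).
Qed.

End process_noise.

(** * Contraction in the weighted norm *)

Lemma normFZ (R : realType) (c : R) (k l : nat) (B : 'M[R]_(k, l)) :
  0 <= c -> normF (c *: B) = c * normF B.
Proof.
move=> c0; apply/eqP; rewrite -(@eqrXn2 _ 2)// ?mulr_ge0 ?normF_ge0//.
rewrite exprMn !normF_sqr mulr_sumr; apply/eqP/eq_bigr => i _.
by rewrite mulr_sumr; apply: eq_bigr => j _; rewrite mxE exprMn.
Qed.

Lemma ler_spectral_norm (R : realType) (m n : nat) (A : 'M[R]_(m, n))
    (x : 'cV[R]_n) : normF (A *m x) <= spectral_norm A * normF x.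
Proof.
pose E := [set normF (A *m x) | x in [set x : 'cV[R]_n | normF x <= 1]].
have ubE : has_ubound E.
  (* A crude bound by absolute row sums, enough for [sup] to be a genuine supremum. *)
  exists (Num.sqrt (\sum_i (\sum_j `|A i j|) ^+ 2)) => _ [z /= z1 <-].
  have zj j : `|z j 0| <= 1.
    rewrite -(@ler_pXn2r _ 2)// ?nnegrE// expr1n real_normK ?num_real//.
    apply: (@le_trans _ _ (normF z ^+ 2)); last by rewrite expr_le1 ?normF_ge0.
    rewrite normF_sqr (bigD1 j)//= big_ord1 lerDl sumr_ge0// => k _.
    by rewrite big_ord1 sqr_ge0.
  rewrite /normF ler_wsqrtr//; apply: ler_sum => i _; rewrite big_ord1 mxE.
  rewrite -real_normK ?num_real// lerXn2r ?nnegrE// ?sumr_ge0//.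
  apply: le_trans (ler_norm_sum _ _ _) _; apply: ler_sum => j _.
  by rewrite normrM ler_piMr.
have [x0|x0] := eqVneq (normF x) 0.
  have -> : x = 0.
    apply/matrixP => i j; apply/eqP; rewrite mxE -sqrf_eq0 eq_le sqr_ge0 andbT.
    have <- : normF x ^+ 2 = 0 by rewrite x0 expr0n.
    rewrite normF_sqr (bigD1 i)//= (bigD1 j)//= -addrA lerDl addr_ge0//.
      by rewrite sumr_ge0// => *; exact: sqr_ge0.
    by rewrite sumr_ge0// => *; rewrite sumr_ge0// => *; exact: sqr_ge0.
  rewrite mulmx0 (_ : normF (0 : 'cV[R]_m) = 0); last first.
    by rewrite -[0](scale0r 0) normFZ// mul0r.
  by rewrite (_ : normF (0 : 'cV[R]_n) = 0) ?mulr0// -[0](scale0r 0) normFZ// mul0r.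
have xp : 0 < normF x by rewrite lt_def x0 normF_ge0.
rewrite -ler_pdivrMr// mulrC -normFZ ?invr_ge0 ?normF_ge0// scalemxAr.
apply: ub_le_sup => //; exists ((normF x)^-1 *: x) => //=.
by rewrite normFZ ?invr_ge0 ?normF_ge0// mulVf.
Qed.

(** This is the squared Frobenius norm of diag(sqrt p)^-1 A. *)
Definition weighted_sqr (R : realType) (n d : nat) (p : 'cV[R]_n)
    (A : 'M[R]_(n, d)) : R :=
  \sum_i (\sum_j A i j ^+ 2) / p i 0.

Lemma equilibrium_size_gt0 (R : realType) (n : nat) (W : 'M[R]_n)
    (p : 'cV[R]_n) : equilibrium W p -> (0 < n)%N.
Proof.
case: n W p => [W p [_ _]|//]; rewrite big_ord0 => /eqP.
by rewrite eq_sym oner_eq0.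
Qed.

Section contraction.
Context (R : realType) (n : nat) (W : 'M[R]_n) (p : 'cV[R]_n).
Hypotheses (colW : column_stochastic W) (pW : equilibrium W p).

Let p_gt0 i : 0 < p i 0. Proof. by case: pW. Qed.

Let mass_power k (d : nat) (A : 'M[R]_(n, d)) :
  (const_mx 1 : 'rV[R]_n) *m (W ^+ k *m A) = const_mx 1 *m A.
Proof.
elim: k A => [|k ih] A; first by rewrite expr0 mul1mx.
by rewrite exprSr -mulmxE -mulmxA ih mulmxA colW.
Qed.

(** On a column of zero sum, W and W - p 1^T act alike. Conjugation by diag(sqrt p) turns the
    weighted norm into the Euclidean one and W - p 1^T into the matrix whose spectral norm is
    [beta_pi]. *)
Let contraction_col (c : 'cV[R]_n) : (const_mx 1 : 'rV[R]_n) *m c = 0 ->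
  weighted_sqr p (W *m c) <= beta_pi W p ^+ 2 * weighted_sqr p c.
Proof.
move=> c0.
pose D := diag_mx (map_mx Num.sqrt p^T).
pose E := diag_mx (map_mx (fun x => (Num.sqrt x)^-1) p^T).
have sp i : Num.sqrt (p i 0) != 0 by rewrite gt_eqF// sqrtr_gt0.
have DE : D *m E = 1%:M.
  apply/matrixP => i j; rewrite mul_diag_mx !mxE.
  by have [->|_] := eqVneq i j; rewrite ?mulr1n ?divff// !mulr0n mulr0.
have uD : D \in unitmx by case: (mulmx1_unit DE).
have iD : invmx D = E by rewrite -[LHS]mulmx1 -DE mulmxA mulVmx// mul1mx.
have NE (x : 'cV[R]_n) : normF (invmx D *m x) ^+ 2 = weighted_sqr p x.
  rewrite normF_sqr; apply: eq_bigr => i _; rewrite iD !big_ord1 mul_diag_mx !mxE.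
  by rewrite exprMn exprVn sqr_sqrtr ?ltW// mulrC.
have key : invmx D *m (W *m c) =
    (invmx D *m (W - p *m const_mx 1) *m D) *m (invmx D *m c).
  rewrite -!mulmxA; congr (_ *m _).
  by rewrite (mulmxA D) mulmxV// mul1mx mulmxBl -mulmxA c0 mulmx0 subr0.
rewrite -!NE key -exprMn lerXn2r ?nnegrE ?normF_ge0//; last exact: ler_spectral_norm.
by apply: le_trans (ler_spectral_norm _ _); exact: normF_ge0.
Qed.

(** The spectral norm acts on vectors, so the columns are treated separately; zero column sums
    survive multiplication by [W], and the contraction can be iterated. *)
Lemma weighted_sqr_contraction k (d : nat) (A : 'M[R]_(n, d)) :
  (const_mx 1 : 'rV[R]_n) *m A = 0 ->
  weighted_sqr p (W ^+ k *m A) <= (beta_pi W p ^+ k) ^+ 2 * weighted_sqr p A.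
Proof.
have wcol (B : 'M[R]_(n, d)) : weighted_sqr p B = \sum_j weighted_sqr p (col j B).
  rewrite /weighted_sqr exchange_big; apply: eq_bigr => i _ /=.
  by rewrite mulr_suml; apply: eq_bigr => j _; rewrite big_ord1 !mxE.
elim: k => [|k ih] in A * => A0; first by rewrite !expr0 mul1mx expr1n mul1r.
rewrite exprS -mulmxE -mulmxA.
apply: (@le_trans _ _ (beta_pi W p ^+ 2 * weighted_sqr p (W ^+ k *m A))).
  rewrite wcol [X in _ * X]wcol mulr_sumr; apply: ler_sum => j _.
  rewrite colE -mulmxA -colE; apply: contraction_col.
  by rewrite colE mulmxA mass_power A0 mul0mx.
rewrite [beta_pi W p ^+ k.+1]exprS exprMn -[leRHS]mulrA ler_wpM2l ?sqr_ge0//.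
exact: ih.
Qed.

Lemma beta_pi_ge0 : 0 <= beta_pi W p.
Proof.
have n0 := equilibrium_size_gt0 pW.
have one_gt0 : 0 < normF (const_mx 1 : 'cV[R]_n).
  rewrite lt_def normF_ge0 andbT -sqrf_eq0 normF_sqr.
  under eq_bigr do rewrite big_ord1 mxE expr1n.
  by rewrite sumr_const card_ord pnatr_eq0 -lt0n.
have := ler_spectral_norm (invmx (diag_mx (map_mx Num.sqrt p^T)) *m
  (W - p *m const_mx 1) *m diag_mx (map_mx Num.sqrt p^T)) (const_mx 1).
by move/(le_trans (normF_ge0 _)); rewrite pmulr_lge0.
Qed.

End contraction.

(** * Smoothness *)

Lemma derive_gradient (R : realType) (d : nat) (f : 'rV[R]_d -> R)
    (x v : 'rV[R]_d) : differentiable f x ->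
  'D_v f x = \sum_j gradient f x 0 j * v 0 j.
Proof.
move=> df; rewrite deriveE// {1}(row_sum_delta v) linear_sum.
apply: eq_bigr => j _; rewrite linearZ /= mxE deriveE//.
by rewrite mulrC.
Qed.

(** Cauchy-Schwarz, read off from the expansion of |a - c h|^2 >= 0; dividing by c requires c = 0 to
    be treated apart. *)
Lemma dot_le_of_normF_le (R : realType) (d : nat) (c : R) (a h : 'rV[R]_d) :
  0 <= c -> normF a <= c * normF h ->
  \sum_j a 0 j * h 0 j <= c * normF h ^+ 2.
Proof.
move=> c0 ac.
have ac2 : normF a ^+ 2 <= c ^+ 2 * normF h ^+ 2.
  by rewrite -exprMn lerXn2r// nnegrE ?mulr_ge0 ?normF_ge0.
have [c00|cp] := eqVneq c 0.
  rewrite c00 mul0r big1// => j _; suff -> : a 0 j = 0 by rewrite mul0r.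
  apply/eqP; rewrite -sqrf_eq0 eq_le sqr_ge0 andbT.
  move: ac2; rewrite c00 expr0n mul0r normF_row_sqr; apply: le_trans.
  by rewrite (bigD1 j)//= lerDl sumr_ge0// => k _; exact: sqr_ge0.
have {}cp : 0 < c by rewrite lt_def cp.
have : 0 <= \sum_j (a 0 j - c * h 0 j) ^+ 2.
  by apply: sumr_ge0 => j _; exact: sqr_ge0.
have -> : \sum_j (a 0 j - c * h 0 j) ^+ 2 =
    normF a ^+ 2 - 2 * c * \sum_j a 0 j * h 0 j + c ^+ 2 * normF h ^+ 2.
  rewrite !normF_row_sqr !mulr_sumr -sumrN -!big_split.
  by apply: eq_bigr => j _ /=; ring.
move=> h0; rewrite -(ler_pM2l cp); nra.
Qed.

Lemma descent_lemma (R : realType) (d : nat) (L : R) (f : 'rV[R]_d -> R)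
    (x y : 'rV[R]_d) : 0 <= L -> lipschitz_gradient L f ->
  f y <= f x + \sum_j gradient f x 0 j * (y - x) 0 j
         + L / 2 * normF (y - x) ^+ 2.
Proof.
move=> L0 [df lip]; set h := y - x; set a := \sum_j _; set N := normF h ^+ 2.
pose phi (t : R) := f (x + t *: h).
(* Along the segment the claim is psi(1) <= psi(0). The Lipschitz bound makes the derivative of
   [psi] nonpositive on the unit interval, so the mean value theorem replaces an integral of the
   gradient. *)
pose psi (t : R) := phi t - a * t - (L / 2 * N) * t ^+ 2.
pose dphi (t : R) := \sum_j gradient f (x + t *: h) 0 j * h 0 j.
have Dphi (t : R) : is_derive t 1 phi (dphi t).
  have -> : dphi t = 'D_h f (x + t *: h) by rewrite derive_gradient.
  have E : (fun s : R => s^-1 *: (phi (s *: 1 + t) - phi t)) =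
     (fun s : R => s^-1 *: (f (s *: h + (x + t *: h)) - f (x + t *: h))).
    apply/funext => s; rewrite /phi; do 3 f_equal.
    by rewrite [s *: 1]mulr1 scalerDl addrCA.
  split; last by rewrite /derive E.
  by rewrite /derivable E; exact: (diff_derivable (df _)).
have Dpsi (t : R) : is_derive t 1 psi (dphi t - a - L * N * t).
  rewrite /psi; apply: is_derive_eq.
  by rewrite /GRing.scale /= !mulr1; field.
have [|c c01] := MVT (@ltr01 R) (fun t _ => Dpsi t).
  apply: continuous_subspaceT => t; apply: differentiable_continuous.
  by apply/derivable1_diffP; case: (Dpsi t).
rewrite subr0 mulr1 => eqc.
have : psi 1 - psi 0 <= 0.
  rewrite eqc; move: c01; rewrite in_itv/= => /andP[c0 _].
  have -> : dphi c - a = \sum_j (gradient f (x + c *: h) - gradient f x) 0 j * h 0 j.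
    rewrite /dphi /a -sumrB; apply: eq_bigr => j _.
    by rewrite [X in _ = X * _]mxE [X in _ = (_ + X) * _]mxE mulrBl.
  rewrite subr_le0 (_ : L * N * c = (L * c) * N); last by ring.
  apply: dot_le_of_normF_le; first by rewrite mulr_ge0// ltW.
  apply: le_trans (lip _ _) _; rewrite addrAC subrr add0r.
  by rewrite normFZ ?(ltW c0)// mulrA lexx.
rewrite /psi /phi scale1r scale0r addr0 (_ : x + h = y); last by rewrite /h addrC subrK.
rewrite expr1n expr0n !mulr1 !mulr0; lra.
Qed.

Lemma sqr_sum_le (R : realType) (n : nat) (a : 'I_n -> R) :
  (\sum_i a i) ^+ 2 <= n%:R * \sum_i a i ^+ 2.
Proof.
have : 0 <= \sum_i \sum_j (a i - a j) ^+ 2.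
  by apply: sumr_ge0 => i _; apply: sumr_ge0 => j _; exact: sqr_ge0.
have -> : \sum_i \sum_j (a i - a j) ^+ 2 =
    2 * (n%:R * \sum_i a i ^+ 2) - 2 * (\sum_i a i) ^+ 2.
  transitivity (\sum_i (n%:R * a i ^+ 2 - 2 * a i * (\sum_j a j) + \sum_j a j ^+ 2)).
    apply: eq_bigr => i _.
    rewrite -[n in n%:R]card_ord -sum1_card natr_sum mulr_suml mulr_sumr.
    by rewrite -sumrN -!big_split; apply: eq_bigr => j _ /=; ring.
  rewrite !big_split/= sumrN sumr_const card_ord -mulr_suml -!mulr_sumr.
  by rewrite -[X in _ + X = _]mulr_natl; ring.
lra.
Qed.

Lemma normF_row_mean (R : realType) (n d : nat) (A : 'M[R]_(n, d)) : (0 < n)%N ->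
  n%:R * normF (row_mean A) ^+ 2 <= normF A ^+ 2.
Proof.
move=> n0; have n0' : 0 < n%:R :> R by rewrite ltr0n.
rewrite normF_row_sqr normF_sqr exchange_big mulr_sumr; apply: ler_sum => j _ /=.
rewrite mxE summxE exprMn exprVn.
have -> : \sum_k row k A 0 j = \sum_k A k j by apply: eq_bigr => k _; rewrite mxE.
rewrite -(ler_pM2l n0'); apply: le_trans (sqr_sum_le _).
by rewrite [leLHS](_ : _ = (\sum_k A k j) ^+ 2)//; field; rewrite gt_eqF.
Qed.

Lemma lipschitz_mean_cost (R : realType) (n d : nat) (L : R)
    (f : 'I_n -> 'rV[R]_d -> R) : (0 < n)%N -> 0 <= L ->
  (forall i, lipschitz_gradient L (f i)) -> lipschitz_gradient L (mean_cost f).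
Proof.
move=> n0 L0 lip; have n0' : 0 < n%:R :> R by rewrite ltr0n.
have df i y : differentiable (f i) y by exact: (lip i).1.
split=> [x|x y].
  have -> : mean_cost f = n%:R^-1 *: (\sum_i f i).
    by apply/funext => z; rewrite /mean_cost /= /GRing.scale/= fct_sumE.
  by apply: differentiableZ; apply: differentiable_sum.
pose A := \matrix_(i < n) (gradient (f i) x - gradient (f i) y).
have -> : gradient (mean_cost f) x - gradient (mean_cost f) y = row_mean A.
  rewrite !gradient_mean_cost// -scalerBr -sumrB; congr (_ *: _).
  by apply: eq_bigr => i _; rewrite rowK.
rewrite -(@ler_pXn2r _ 2)// ?nnegrE ?mulr_ge0 ?normF_ge0//.
rewrite -(ler_pM2l n0'); apply: le_trans (normF_row_mean _ n0) _.
have -> : normF A ^+ 2 = \sum_i normF (gradient (f i) x - gradient (f i) y) ^+ 2.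
  rewrite normF_sqr; apply: eq_bigr => i _; rewrite normF_row_sqr.
  by apply: eq_bigr => j _; rewrite !mxE.
rewrite -[n in n%:R]card_ord -sum1_card natr_sum mulr_suml.
apply: ler_sum => i _; rewrite mul1r lerXn2r ?nnegrE ?mulr_ge0 ?normF_ge0//.
exact: (lip i).2.
Qed.

(** One gradient step of length [t] cannot go below the lower bound [m]. The length is left free: a
    short step shows that gradients vanish at minimizers, an arbitrarily long one that they vanish
    everywhere when L = 0. *)
Lemma gradient_gap (R : realType) (d : nat) (L t : R) (f : 'rV[R]_d -> R)
    (x : 'rV[R]_d) (m : R) : 0 <= L -> lipschitz_gradient L f ->
  (forall y, m <= f y) -> 0 <= t ->
  t * (1 - L * t / 2) * normF (gradient f x) ^+ 2 <= f x - m.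
Proof.
move=> L0 lf mf t0; have := descent_lemma x (x - t *: gradient f x) L0 lf.
rewrite (_ : x - _ - x = - (t *: gradient f x)); last by rewrite addrAC subrr add0r.
rewrite (_ : normF _ ^+ 2 = t ^+ 2 * normF (gradient f x) ^+ 2); last first.
  by rewrite !normF_row_sqr mulr_sumr; apply: eq_bigr => j _; rewrite !mxE; ring.
rewrite (_ : \sum_j _ = - t * normF (gradient f x) ^+ 2); last first.
  by rewrite normF_row_sqr mulr_sumr; apply: eq_bigr => j _; rewrite !mxE; ring.
by have := mf (x - t *: gradient f x); lra.
Qed.

(** * Consensus and tracking errors *)

Section row_mean_theory.
Context (R : realType) (n d : nat).
Implicit Types A B : 'M[R]_(n, d).

Lemma row_meanE A : row_mean A = n%:R^-1 *: ((const_mx 1 : 'rV_n) *m A).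
Proof.
apply/rowP => j; rewrite !mxE summxE; congr (_ * _).
by apply: eq_bigr => i _; rewrite !mxE mul1r.
Qed.

Lemma row_meanD A B : row_mean (A + B) = row_mean A + row_mean B.
Proof. by rewrite !row_meanE mulmxDr scalerDr. Qed.

Lemma row_meanB A B : row_mean (A - B) = row_mean A - row_mean B.
Proof. by rewrite !row_meanE mulmxBr scalerBr. Qed.

Lemma row_meanZ c A : row_mean (c *: A) = c *: row_mean A.
Proof. by rewrite !row_meanE -scalemxAr !scalerA mulrC. Qed.

Lemma row_mean_stochastic (M : 'M[R]_n) A : column_stochastic M ->
  row_mean (M *m A) = row_mean A.
Proof. by move=> cM; rewrite !row_meanE mulmxA cM. Qed.

Lemma row_mean_const (r : 'rV[R]_d) : (0 < n)%N ->
  row_mean (\matrix_(i < n) r) = r.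
Proof.
move=> n0; rewrite /row_mean; under eq_bigr do rewrite rowK.
by rewrite sumr_const card_ord -[r *+ n]scaler_nat scalerK// pnatr_eq0 -lt0n.
Qed.

(** The mean is spread along the current weights [v] and not along the equilibrium: [v] is
    transported by the same matrix as the iterates, so the error recursions are exact, and dividing
    the rows of the deviation of [x] by [v] gives the consensus error of [w]. *)
Definition deviation (v : 'cV[R]_n) A : 'M[R]_(n, d) := A - v *m row_mean A.

Lemma deviation_mass v A : (0 < n)%N ->
  (const_mx 1 : 'rV[R]_n) *m v = n%:R%:M ->
  (const_mx 1 : 'rV[R]_n) *m deviation v A = 0.
Proof.
move=> n0 v1; rewrite /deviation mulmxBr mulmxA v1 mul_scalar_mx row_meanE.
by rewrite scalerA divff ?scale1r ?subrr// pnatr_eq0 -lt0n.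
Qed.

Lemma deviationD v A B : deviation v (A + B) = deviation v A + deviation v B.
Proof. by rewrite /deviation row_meanD mulmxDr opprD addrACA. Qed.

Lemma deviationB v A B : deviation v (A - B) = deviation v A - deviation v B.
Proof. by rewrite /deviation row_meanB mulmxBr !opprB
  [v *m row_mean B - _]addrC addrACA [- B + _]addrC. Qed.

Lemma deviationZ v c A : deviation v (c *: A) = c *: deviation v A.
Proof. by rewrite /deviation row_meanZ -scalemxAr scalerBr. Qed.

Lemma deviation_stochastic (M : 'M[R]_n) v A : column_stochastic M ->
  deviation (M *m v) (M *m A) = M *m deviation v A.
Proof.
by move=> cM; rewrite /deviation row_mean_stochastic// mulmxBr mulmxA.
Qed.

End row_mean_theory.

Section weighted_sqr_theory.
Context (R : realType) (n d : nat) (p : 'cV[R]_n).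
Hypothesis p0 : forall i, 0 < p i 0.
Implicit Types A B : 'M[R]_(n, d).

Lemma weighted_sqr_ge0 k (A : 'M[R]_(n, k)) : 0 <= weighted_sqr p A.
Proof.
apply: sumr_ge0 => i _; apply: divr_ge0; last exact: ltW.
by apply: sumr_ge0 => j _; exact: sqr_ge0.
Qed.

Lemma weighted_sqrD A B :
  weighted_sqr p (A + B) <= 2 * weighted_sqr p A + 2 * weighted_sqr p B.
Proof.
rewrite /weighted_sqr !mulr_sumr -big_split; apply: ler_sum => i _ /=.
rewrite !mulrA -mulrDl ler_wpM2r ?invr_ge0 ?(ltW (p0 i))//.
rewrite !mulr_sumr -big_split; apply: ler_sum => j _ /=.
rewrite mxE; have := sqr_ge0 (A i j - B i j); lra.
Qed.

Lemma weighted_sqrZ c A : weighted_sqr p (c *: A) = c ^+ 2 * weighted_sqr p A.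
Proof.
rewrite /weighted_sqr mulr_sumr; apply: eq_bigr => i _.
rewrite mulrA mulr_sumr; congr (_ / _).
by apply: eq_bigr => j _; rewrite mxE exprMn.
Qed.

Lemma weighted_sqr_le q A : (forall i, (p i 0)^-1 <= q) ->
  weighted_sqr p A <= q * normF A ^+ 2.
Proof.
move=> pq; rewrite /weighted_sqr normF_sqr mulr_sumr; apply: ler_sum => i _.
by rewrite mulrC ler_wpM2r// sumr_ge0// => j _; exact: sqr_ge0.
Qed.

Lemma weighted_sqr_outer (v : 'cV[R]_n) (r : 'rV[R]_d) :
  weighted_sqr p (v *m r) = weighted_sqr p v * normF r ^+ 2.
Proof.
rewrite /weighted_sqr mulr_suml normF_row_sqr; apply: eq_bigr => i _.
rewrite mulrAC; congr (_ / _); rewrite big_ord1 mulr_sumr.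
by apply: eq_bigr => j _; rewrite mxE big_ord1 exprMn.
Qed.

Lemma weighted_sqr_deviation q c (v : 'cV[R]_n) A : (0 < n)%N ->
  (forall i, (p i 0)^-1 <= q) -> weighted_sqr p v <= c ->
  weighted_sqr p (deviation v A) <= (2 * q + 2 * c / n%:R) * normF A ^+ 2.
Proof.
move=> n0 pq vc; rewrite /deviation -mulNmx.
apply: le_trans (weighted_sqrD _ _) _.
rewrite [leRHS]mulrDl lerD//.
  by rewrite -[leRHS]mulrA ler_pM2l//; exact: weighted_sqr_le.
rewrite mulNmx -scaleN1r weighted_sqrZ sqrrN expr1n mul1r weighted_sqr_outer.
rewrite -(mulrA 2) -[leRHS]mulrA ler_pM2l// -mulrA.
apply: ler_pM => //; rewrite ?sqr_ge0 ?weighted_sqr_ge0//.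
by rewrite ler_pdivlMl ?ltr0n//; exact: normF_row_mean.
Qed.

End weighted_sqr_theory.

Lemma sum_shift_le (R : realType) (K : nat) (a : nat -> R) :
  (forall k, 0 <= a k) ->
  \sum_(k < K) a k <= \sum_(k < K.+1) a k /\
  \sum_(k < K) a k.+1 <= \sum_(k < K.+1) a k.
Proof.
move=> a0; split; first by rewrite big_ord_recr/= lerDl.
by rewrite big_ord_recl lerDr.
Qed.

(* A small-gain argument: E, H, eps and D are the sums over the iterations of
   the errors of consensus, tracking, de-biased iterates and successive
   gradients; the step-size bound [kappa^2 (gamma L b)^2 <= 1/40^2] closes the loop. *)
Lemma small_gain (R : realType) (nn kappa L gamma b E H eps D N s g0 : R) :
  0 < nn -> 1 <= kappa -> 0 <= b -> b <= 4^-1 ->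
  0 <= E -> 0 <= H -> 0 <= D -> 0 <= eps -> 0 <= N -> 0 <= s -> 0 <= g0 ->
  kappa ^+ 2 * (gamma * L * b) ^+ 2 <= 40^-1 ^+ 2 ->
  E <= 2 * b ^+ 2 * (E + gamma ^+ 2 * H) ->
  H <= 10 * nn * kappa * g0 + 2 * b ^+ 2 * (H + 10 * nn * kappa * D) ->
  eps <= 2 * (kappa / nn) * E ->
  D <= 27 * L ^+ 2 * eps + 9 * nn * N + 21 / 2 * s ->
  L ^+ 2 / nn * eps <= 10^-1 * N +
    144 * kappa ^+ 2 * (gamma * L * b) ^+ 2 * (g0 / nn) +
    1800 * kappa ^+ 2 * (gamma * L * b) ^+ 2 * b ^+ 2 * (s / nn).
Proof.
move=> n0 k1 b0 b4 E0 H0 D0 eps0 N0 s0 g00 q1 hE hH heps hD.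
have b2 : b ^+ 2 <= 16^-1 by nra.
have b20 : 0 <= b ^+ 2 by exact: sqr_ge0.
have k0 : 0 <= kappa by lra.
have nk0 : 0 <= nn * kappa by rewrite mulr_ge0// ltW.
set B := b ^+ 2 in b2 b20 hE hH *.
(* Since B <= 1/16, the term 2 B E is at most E / 8 and is absorbed, at the price of a factor 8/7
   rounded up; likewise for [H] below. *)
have hE' : E <= 3 * B * (gamma ^+ 2 * H).
  have : B * E <= 16^-1 * E by rewrite ler_wpM2r.
  have : 0 <= B * (gamma ^+ 2 * H) by rewrite mulr_ge0// mulr_ge0 ?sqr_ge0.
  lra.
have hH' : H <= 20 * (nn * kappa) * g0 + 24 * (nn * kappa) * B * D.
  have : B * H <= 16^-1 * H by rewrite ler_wpM2r.
  have : 0 <= (nn * kappa) * g0 by rewrite mulr_ge0.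
  have : 0 <= (nn * kappa) * B * D by rewrite mulr_ge0// mulr_ge0.
  lra.
have heps' : eps <= 120 * (kappa ^+ 2 * B * gamma ^+ 2) * g0 +
    144 * (kappa ^+ 2 * B * gamma ^+ 2) * B * D.
  apply: le_trans heps _.
  have h : 2 * (kappa / nn) * E <= 2 * (kappa / nn) * (3 * B * (gamma ^+ 2 *
      (20 * (nn * kappa) * g0 + 24 * (nn * kappa) * B * D))).
    apply: ler_wpM2l; first by rewrite mulr_ge0// divr_ge0// ltW.
    apply: le_trans hE' _; apply: ler_wpM2l; first by rewrite mulr_ge0.
    by apply: ler_wpM2l; first exact: sqr_ge0.
  apply: le_trans h _; rewrite le_eqVlt; apply/orP; left; apply/eqP.
  by field; rewrite gt_eqF.
set Q := kappa ^+ 2 * (gamma * L * b) ^+ 2 in q1 *.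
have Q0 : 0 <= Q by rewrite /Q mulr_ge0 ?sqr_ge0.
pose X := L ^+ 2 * eps.
have X0 : 0 <= X by rewrite /X mulr_ge0 ?sqr_ge0.
have hX : X <= 120 * Q * g0 + 144 * Q * B * (27 * X + 9 * nn * N + 21 / 2 * s).
  apply: (@le_trans _ _ (L ^+ 2 * (120 * (kappa ^+ 2 * B * gamma ^+ 2) * g0 +
    144 * (kappa ^+ 2 * B * gamma ^+ 2) * B * D))).
    by rewrite ler_wpM2l ?sqr_ge0.
  have -> : L ^+ 2 * (120 * (kappa ^+ 2 * B * gamma ^+ 2) * g0 +
    144 * (kappa ^+ 2 * B * gamma ^+ 2) * B * D) =
    120 * Q * g0 + 144 * Q * B * D by rewrite /Q /B; ring.
  rewrite lerD2l; apply: ler_wpM2l; first by rewrite mulr_ge0// mulr_ge0.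
  by rewrite /X [27 * (_ * _)]mulrA.
pose r : R := 40^-1 ^+ 2 * 16^-1.
have QB : Q * B <= r by rewrite /r ler_pM.
have QB0 : 0 <= Q * B by rewrite mulr_ge0.
have nN : 0 <= nn * N by rewrite mulr_ge0// ltW.
have h1 : Q * B * X <= r * X by rewrite ler_wpM2r.
have h2 : Q * B * (nn * N) <= r * (nn * N) by rewrite ler_wpM2r.
have h3 : 0 <= Q * B * s by rewrite mulr_ge0.
have h4 : 0 <= Q * g0 by rewrite mulr_ge0.
have hX' : X <= 10^-1 * (nn * N) + 144 * (Q * g0) + 1800 * (Q * B * s) by rewrite /r in h1 h2; lra.
rewrite -(ler_pM2l n0).
have -> : nn * (L ^+ 2 / nn * eps) = X by rewrite /X; field; rewrite gt_eqF.
apply: le_trans hX' _; rewrite le_eqVlt; apply/orP; left; apply/eqP.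
by rewrite /Q /B; field; rewrite gt_eqF.
Qed.

(** * Push-sum weights and de-biasing *)

Section push_sum_weights.
Context (R : realType) (n : nat) (M : 'M[R]_n) (p : 'cV[R]_n) (b kappa : R).
Hypotheses (n0 : (0 < n)%N) (colM : column_stochastic M)
  (p0 : forall i, 0 < p i 0) (Mp : M *m p = p) (sump : \sum_i p i 0 = 1).
Hypothesis contr : forall d (A : 'M[R]_(n, d)),
  (const_mx 1 : 'rV[R]_n) *m A = 0 ->
  weighted_sqr p (M *m A) <= b ^+ 2 * weighted_sqr p A.
Hypotheses (k1 : 1 <= kappa) (pk : forall i, (p i 0)^-1 <= n%:R * kappa).
Hypotheses (b0 : 0 <= b) (bk : b * kappa ^+ 7 * n%:R ^+ 2 <= 4^-1).

Let v k : 'cV[R]_n := iter k (mulmx M) (const_mx 1).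
Let k0 : 0 <= kappa. Proof. exact: le_trans ler01 k1. Qed.
Let n0' : 0 < n%:R :> R. Proof. by rewrite ltr0n. Qed.
Let n1 : 1 <= n%:R :> R. Proof. by rewrite ler1n. Qed.

Lemma tracking_gain_small : b <= 4^-1 /\ b ^+ 2 * kappa ^+ 2 * n%:R <= 16^-1.
Proof.
have n2 : n%:R <= n%:R ^+ 2 :> R by rewrite expr2 ler_peMl// ltW.
have k7 : kappa <= kappa ^+ 7 by rewrite ler_eXnr.
have k70 : 0 <= kappa ^+ 7 by rewrite exprn_ge0.
have h : b * kappa * n%:R <= 4^-1.
  apply: le_trans bk; apply: ler_pM => //; last exact: ler_wpM2l.
  by rewrite mulr_ge0.
have bb : b <= b * kappa * n%:R.
  by rewrite -mulrA ler_peMr// mulr_ege1.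
split; first exact: le_trans h.
have h0 : 0 <= b * kappa * n%:R by exact: le_trans bb.
have : (b * kappa * n%:R) ^+ 2 <= 4^-1 ^+ 2 by rewrite lerXn2r ?nnegrE// invr_ge0.
rewrite (_ : 4^-1 ^+ 2 = 16^-1 :> R); last by field.
apply: le_trans; rewrite -exprMn [leRHS]exprMn ler_wpM2l// sqr_ge0//.
Qed.

Lemma push_sum_mass k : (const_mx 1 : 'rV[R]_n) *m v k = n%:R%:M.
Proof.
elim: k => [|k ih]; last by rewrite /v iterS mulmxA colM.
apply/matrixP => i j; rewrite !ord1 !mxE eqxx mulr1n.
under eq_bigr do rewrite !mxE mulr1.
by rewrite sumr_const card_ord.
Qed.

(** The weights converge to n times the equilibrium vector; [u] is the error, and it has zero
    sum. *)
Let u k := v k - n%:R *: p.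

Let u_mass k : (const_mx 1 : 'rV[R]_n) *m u k = 0.
Proof.
rewrite mulmxBr push_sum_mass -scalemxAr; apply/matrixP => i j.
rewrite !ord1 !mxE eqxx; under eq_bigr do rewrite !mxE mul1r.
by rewrite sump mulr1 mulr1n subrr.
Qed.

Let uS k : u k.+1 = M *m u k.
Proof. by rewrite /u mulmxBr -scalemxAr Mp. Qed.

Let u0 : weighted_sqr p (u 0%N) <= n%:R ^+ 2 * kappa.
Proof.
have -> : weighted_sqr p (u 0%N) = \sum_i (p i 0)^-1 - n%:R ^+ 2.
  transitivity (\sum_i ((p i 0)^-1 - 2 * n%:R + n%:R ^+ 2 * p i 0)).
    apply: eq_bigr => i _; rewrite big_ord1 !mxE.
    by field; rewrite gt_eqF.
  rewrite !big_split/= -mulr_sumr sump sumr_const card_ord.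
  by rewrite -[_ *+ n]mulr_natl; ring.
apply: (@le_trans _ _ (\sum_(i < n) n%:R * kappa)).
  rewrite lerBlDr; apply: (@le_trans _ _ (\sum_(i < n) n%:R * kappa)).
    by apply: ler_sum => i _.
  by rewrite lerDl sqr_ge0.
by rewrite sumr_const card_ord -[_ *+ n]mulr_natl expr2 mulrA.
Qed.

(** Two bounds are carried because the initial weights have not been contracted yet: the factor b^2
    is available only from the first step on. *)
Let u_le k : weighted_sqr p (u k) <= n%:R ^+ 2 * kappa /\
  weighted_sqr p (u k.+1) <= b ^+ 2 * (n%:R ^+ 2 * kappa).
Proof.
have b21 : b ^+ 2 <= 1.
  by have [b4 _] := tracking_gain_small; rewrite expr_le1//; lra.
elim: k => [|k [_ ih]].
  split=> //; rewrite uS; apply: le_trans (contr (u_mass _)) _.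
  by rewrite ler_wpM2l ?sqr_ge0.
have ih' : weighted_sqr p (u k.+1) <= n%:R ^+ 2 * kappa.
  apply: le_trans ih _; by rewrite ler_piMl// mulr_ge0 ?sqr_ge0.
split=> //; rewrite uS; apply: le_trans (contr (u_mass _)) _.
by rewrite ler_wpM2l ?sqr_ge0.
Qed.

Lemma push_sum_weighted k : weighted_sqr p (v k) <= 4 * n%:R ^+ 2 * kappa.
Proof.
have -> : v k = n%:R *: p + u k by rewrite addrC subrK.
apply: le_trans (weighted_sqrD p0 _ _) _.
rewrite weighted_sqrZ (_ : weighted_sqr p p = 1); last first.
  rewrite -sump; apply: eq_bigr => i _; rewrite big_ord1.
  by field; rewrite gt_eqF.
have [h _] := u_le k.
have : n%:R ^+ 2 <= n%:R ^+ 2 * kappa by rewrite ler_peMr// sqr_ge0.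
lra.
Qed.

(** One coordinate of the weighted norm gives u_i^2 <= p_i b^2 n^2 kappa, and 1/p_i <= n kappa turns
    b^2 kappa^2 n <= 1/16 into b^2 kappa <= p_i / 16; hence |u_i| <= n p_i / 4. *)
Lemma push_sum_lower k i : 3 / 4 * (n%:R * p i 0) <= v k.+1 i 0.
Proof.
have [_ h] := u_le k.
have [_ bkn] := tracking_gain_small.
have np : 0 < n%:R * p i 0 by rewrite mulr_gt0.
have hu : (u k.+1 i 0) ^+ 2 <= (4^-1 * (n%:R * p i 0)) ^+ 2.
  have h1 : (u k.+1 i 0) ^+ 2 / p i 0 <= b ^+ 2 * (n%:R ^+ 2 * kappa).
    apply: le_trans h; rewrite /weighted_sqr (bigD1 i)//= big_ord1 lerDl.
    by apply: sumr_ge0 => j _; rewrite big_ord1 divr_ge0 ?sqr_ge0 ?ltW.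
  rewrite ler_pdivrMr// in h1; apply: le_trans h1 _.
  have : b ^+ 2 * kappa <= 16^-1 * p i 0.
    rewrite -ler_pdivrMr//; apply: le_trans bkn.
    rewrite -[leRHS](_ : b ^+ 2 * kappa * (n%:R * kappa) = _); last by ring.
    by rewrite ler_wpM2l// mulr_ge0 ?sqr_ge0.
  have : 0 <= n%:R ^+ 2 * p i 0 by rewrite mulr_ge0 ?sqr_ge0// ltW.
  nra.
have : `|u k.+1 i 0| <= 4^-1 * (n%:R * p i 0).
  rewrite -(@ler_pXn2r _ 2)// ?nnegrE ?real_normK ?num_real//.
  by rewrite mulr_ge0// ltW.
have -> : u k.+1 i 0 = v k.+1 i 0 - n%:R * p i 0 by rewrite !mxE.
rewrite ler_norml => /andP[]; lra.
Qed.

(** The lower bound on the weights gives 1/v_i^2 <= (16/9) / (n p_i)^2, rounded to 2. One factor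
    1/p_i is that of the weighted norm, the other is at most n kappa. *)
Lemma debiased_error (d : nat) (e : 'M[R]_(n, d)) k :
  \sum_i \sum_j (e i j / v k.+1 i 0) ^+ 2 <=
  2 * (kappa / n%:R) * weighted_sqr p e.
Proof.
rewrite /weighted_sqr mulr_sumr; apply: ler_sum => i _.
under eq_bigr do rewrite exprMn.
rewrite -mulr_suml [leRHS]mulrCA ler_wpM2l//.
  by apply: sumr_ge0 => j _; exact: sqr_ge0.
have np : 0 < n%:R * p i 0 by rewrite mulr_gt0.
have vp := push_sum_lower k i.
have v0 : 0 < v k.+1 i 0 by lra.
rewrite exprVn.
apply: (@le_trans _ _ (2 / (n%:R * p i 0) ^+ 2)).
  rewrite -(@ler_pM2l _ (v k.+1 i 0 ^+ 2)) ?exprn_gt0// divff ?gt_eqF ?exprn_gt0//.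
  rewrite mulrA ler_pdivlMr ?exprn_gt0// mul1r; nra.
rewrite -!mulrA ler_pM2l// (_ : ((n%:R * p i 0) ^+ 2)^-1 = (n%:R^-2 * (p i 0)^-1) * (p i 0)^-1); last first.
  by field; rewrite !gt_eqF.
rewrite [leRHS]mulrA ler_pM2r ?invr_gt0//.
have -> : kappa / n%:R = n%:R^-2 * (n%:R * kappa) by field; rewrite gt_eqF.
by rewrite ler_wpM2l ?invr_ge0 ?sqr_ge0.
Qed.

End push_sum_weights.

(** * The inequality on each sample path *)

Lemma normFN (R : realType) (m n : nat) (A : 'M[R]_(m, n)) : normF (- A) = normF A.
Proof.
rewrite /normF; congr Num.sqrt; apply: eq_bigr => i _.
by apply: eq_bigr => j _; rewrite mxE sqrrN.
Qed.

Lemma normFD3_sqr (R : realType) (m n : nat) (A B C : 'M[R]_(m, n)) :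
  normF (A + B + C) ^+ 2 <= 3 * (normF A ^+ 2 + normF B ^+ 2 + normF C ^+ 2).
Proof.
rewrite !normF_sqr -!big_split mulr_sumr; apply: ler_sum => i _ /=.
rewrite -!big_split mulr_sumr; apply: ler_sum => j _ /=; rewrite !mxE.
have := sqr_ge0 (A i j - B i j); have := sqr_ge0 (A i j - C i j).
have := sqr_ge0 (B i j - C i j); lra.
Qed.

Lemma normF_sqrZ (R : realType) (m n : nat) (c : R) (A : 'M[R]_(m, n)) :
  normF (c *: A) ^+ 2 = c ^+ 2 * normF A ^+ 2.
Proof.
rewrite !normF_sqr mulr_sumr; apply: eq_bigr => i _.
by rewrite mulr_sumr; apply: eq_bigr => j _; rewrite mxE exprMn.
Qed.

Lemma normF_const_rows (R : realType) (n d : nat) (r : 'rV[R]_d) :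
  normF (\matrix_(i < n) r) ^+ 2 = n%:R * normF r ^+ 2.
Proof.
rewrite normF_sqr normF_row_sqr.
under eq_bigr do under eq_bigr do rewrite mxE.
by rewrite sumr_const card_ord mulr_natl.
Qed.

Lemma true_gradients_lipschitz (R : realType) (n d : nat) (L : R)
    (f : 'I_n -> 'rV[R]_d -> R) (w z : 'M[R]_(n, d)) : 0 <= L ->
  (forall i, lipschitz_gradient L (f i)) ->
  normF (true_gradients f w - true_gradients f z) ^+ 2 <=
  L ^+ 2 * normF (w - z) ^+ 2.
Proof.
move=> L0 lip; rewrite !normF_sqr mulr_sumr; apply: ler_sum => i _.
have E1 : \sum_j (true_gradients f w - true_gradients f z) i j ^+ 2 =
    normF (gradient (f i) (row i w) - gradient (f i) (row i z)) ^+ 2.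
  by rewrite normF_row_sqr; apply: eq_bigr => j _; rewrite !mxE.
have -> : \sum_j (w - z) i j ^+ 2 = normF (row i w - row i z) ^+ 2.
  by rewrite normF_row_sqr; apply: eq_bigr => j _; rewrite !mxE.
rewrite E1 -exprMn lerXn2r ?nnegrE ?mulr_ge0 ?normF_ge0//.
exact: (lip i).2.
Qed.

Lemma invmx_diag_mul (R : realType) (n d : nat) (c : 'cV[R]_n)
    (A : 'M[R]_(n, d)) i j : (forall l, c l 0 != 0) ->
  (invmx (diag_mx c^T) *m A) i j = (c i 0)^-1 * A i j.
Proof.
move=> c0; pose E := diag_mx (map_mx (fun r : R => r^-1) c^T).
have DE : diag_mx c^T *m E = 1%:M.
  apply/matrixP => k l; rewrite mul_diag_mx !mxE.
  have [->|_] := eqVneq k l; last by rewrite !mulr0n mulr0.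
  by rewrite mulr1n divff.
have uD : diag_mx c^T \in unitmx by case: (mulmx1_unit DE).
have -> : invmx (diag_mx c^T) = E by rewrite -[LHS]mulmx1 -DE mulmxA mulVmx// mul1mx.
by rewrite mul_diag_mx !mxE.
Qed.

Lemma step_arith (R : realType) (nn L2 N A Ag Bs g e S : R) : 0 < nn ->
  g <= 2 * A + 2 * Bs -> A <= 2 * Ag + 2 * N -> nn * Ag <= L2 * e ->
  nn * Bs <= S -> nn * g <= 4 * nn * N + 4 * L2 * e + 2 * S.
Proof.
move=> n0 hg hA hAg hB.
apply: (@le_trans _ _ (nn * (2 * (2 * Ag + 2 * N) + 2 * Bs))); last by lra.
by rewrite ler_pM2l//; lra.
Qed.

(** The displacement [Z] of the mean is multiplied by L^2, and (gamma L)^2 <= 1/4 makes its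
    contribution 9 (nn N + L^2 e + S / 2). *)
Lemma gradient_change_arith (R : realType) (L gamma nn N e e' S S' W Z D : R) :
  0 <= nn -> 0 <= N -> 0 <= e -> 0 <= S -> 0 <= gamma * L -> gamma * L <= 2^-1 ->
  D <= 3 * (L ^+ 2 * W + S' + S) -> W <= 3 * (e' + e + Z) ->
  Z <= gamma ^+ 2 * (4 * nn * N + 4 * L ^+ 2 * e + 2 * S) ->
  D <= 9 * L ^+ 2 * e' + 18 * L ^+ 2 * e + 9 * nn * N + 3 * S' + 15 / 2 * S.
Proof.
move=> n0 N0 e0 S0 gL0 gL hD hW hZ.
have gL2 : L ^+ 2 * gamma ^+ 2 <= 4^-1.
  rewrite -exprMn mulrC (_ : 4^-1 = 2^-1 ^+ 2); last by field.
  by rewrite lerXn2r ?nnegrE// invr_ge0.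
have L20 : 0 <= L ^+ 2 by exact: sqr_ge0.
have nN : 0 <= nn * N by exact: mulr_ge0.
have Le : 0 <= L ^+ 2 * e by exact: mulr_ge0.
set Q := 4 * nn * N + 4 * L ^+ 2 * e + 2 * S in hZ.
have Q0 : 0 <= Q by rewrite /Q; lra.
have h1 : L ^+ 2 * gamma ^+ 2 * Q <= 4^-1 * Q by rewrite ler_wpM2r.
have h2 : L ^+ 2 * W <= L ^+ 2 * (3 * (e' + e + gamma ^+ 2 * Q)).
  by rewrite ler_wpM2l//; lra.
rewrite /Q in h1 h2; lra.
Qed.

(** The squared step costs L gamma^2 A, which gamma L <= 1/2 lets the descent term - gamma A / 2
    absorb; the rest is multiplied by 2 / gamma. *)
Lemma descent_arith (R : realType) (L gamma f1 f2 N A Ag Bs T Z dot : R) :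
  0 <= L -> 0 < gamma -> gamma * L <= 2^-1 -> 0 <= A ->
  T <= 2 * A + 2 * Bs -> Ag <= Z ->
  f2 <= f1 + (- gamma * (2^-1 * (N + A - Ag)) - gamma * dot)
        + L / 2 * (gamma ^+ 2 * T) ->
  N <= 2 / gamma * (f1 - f2) + Z + 2 * L * gamma * Bs - 2 * dot.
Proof.
move=> L0 g0 gL A0 hT hA hf.
have h1 : L / 2 * gamma ^+ 2 * T <= L / 2 * gamma ^+ 2 * (2 * A + 2 * Bs).
  by rewrite ler_wpM2l// mulr_ge0 ?sqr_ge0// divr_ge0.
have h2 : gamma * (gamma * L * A) <= gamma * (2^-1 * A).
  by rewrite ler_pM2l// ler_wpM2r.
have h3 : gamma * Ag <= gamma * Z by rewrite ler_pM2l.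
rewrite -(ler_pM2l g0).
have -> : gamma * (2 / gamma * (f1 - f2) + Z + 2 * L * gamma * Bs - 2 * dot) =
  2 * (f1 - f2) + gamma * Z + 2 * L * gamma ^+ 2 * Bs - 2 * gamma * dot.
  by field; rewrite gt_eqF.
lra.
Qed.

(** Polarization: the inner product of u and r becomes squares, and only the one with the noise t
    keeps its sign. *)
Lemma dot_step (R : realType) (d : nat) (c : R) (u r t : 'rV[R]_d) :
  \sum_j u 0 j * (- (c *: (r + t))) 0 j =
  - c * (2^-1 * (normF u ^+ 2 + normF r ^+ 2 - normF (r - u) ^+ 2))
  - c * \sum_j u 0 j * t 0 j.
Proof.
rewrite !normF_row_sqr -big_split -sumrB /= !mulr_sumr -sumrB /=.
by apply: eq_bigr => j _; rewrite !mxE; field.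
Qed.

Lemma sum_recurrence (R : realType) (K : nat) (c : R) (a u : nat -> R) :
  (forall k, a k.+1 <= c * u k) ->
  \sum_(k < K.+1) a k <= a 0%N + c * \sum_(k < K) u k.
Proof.
by move=> au; rewrite big_ord_recl lerD2l mulr_sumr; apply: ler_sum => k _; exact: au.
Qed.

Lemma tracking_sums (R : realType) (nn kappa L gamma b g0 : R)
    (E H eps D N S : nat -> R) (K : nat) :
  0 < nn -> 1 <= kappa -> 0 <= b -> b <= 4^-1 -> 0 <= g0 ->
  (forall k, 0 <= E k) -> (forall k, 0 <= H k) -> (forall k, 0 <= D k) ->
  (forall k, 0 <= eps k) -> (forall k, 0 <= N k) -> (forall k, 0 <= S k) ->
  kappa ^+ 2 * (gamma * L * b) ^+ 2 <= 40^-1 ^+ 2 ->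
  E 0%N = 0 -> H 0%N <= 10 * nn * kappa * g0 ->
  (forall k, E k.+1 <= 2 * b ^+ 2 * (E k + gamma ^+ 2 * H k)) ->
  (forall k, H k.+1 <= 2 * b ^+ 2 * (H k + 10 * nn * kappa * D k)) ->
  (forall k, eps k <= 2 * (kappa / nn) * E k) ->
  (forall k, D k <= 9 * L ^+ 2 * eps k.+1 + 18 * L ^+ 2 * eps k + 9 * nn * N k
    + 3 * S k.+1 + 15 / 2 * S k) ->
  L ^+ 2 / nn * (\sum_(k < K.+1) eps k) <= 10^-1 * (\sum_(k < K.+1) N k) +
    144 * kappa ^+ 2 * (gamma * L * b) ^+ 2 * (g0 / nn) +
    1800 * kappa ^+ 2 * (gamma * L * b) ^+ 2 * b ^+ 2 *
    ((\sum_(k < K.+1) S k) / nn).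
Proof.
move=> n0 k1 b0 b4 g00 E0 H0 D0 eps0 N0 S0 hq E00 H00 hE hH heps hD.
have b20 : 0 <= 2 * b ^+ 2 by rewrite mulr_ge0// sqr_ge0.
have [E1 _] := sum_shift_le K E0.
have [H1 _] := sum_shift_le K H0.
apply: (small_gain (E := \sum_(k < K.+1) E k) (H := \sum_(k < K.+1) H k)
  (D := \sum_(k < K) D k)); rewrite ?sumr_ge0//.
- apply: le_trans (sum_recurrence K hE) _; rewrite E00 add0r ler_wpM2l//.
  by rewrite big_split/= -mulr_sumr lerD// ler_wpM2l// sqr_ge0.
- apply: le_trans (sum_recurrence K hH) _; rewrite lerD// ler_wpM2l//.
  by rewrite big_split/= -mulr_sumr lerD.
- by rewrite mulr_sumr; apply: ler_sum => k _; exact: heps.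
(* [D] is summed over one index less, because it looks one iteration ahead; shifted and unshifted
   sums are then both below the full one, and 9 + 18 = 27, 3 + 15/2 = 21/2. *)
- apply: le_trans (ler_sum _ (fun (k : 'I_K) _ => hD k)) _.
  rewrite !big_split/= -!mulr_sumr.
  have [eps1 eps2] := sum_shift_le K eps0.
  have [N1 _] := sum_shift_le K N0.
  have [S1 S2] := sum_shift_le K S0.
  have h1 := ler_wpM2l (sqr_ge0 L) eps1.
  have h2 := ler_wpM2l (sqr_ge0 L) eps2.
  have h3 := ler_wpM2l (ltW n0) N1.
  lra.
Qed.

Lemma telescoped_descent (R : realType) (c z l : R) (F N e Bs dot : nat -> R)
    (K : nat) :
  (forall k, N k <= c * (F k - F k.+1) + z * e k + l * Bs k - 2 * dot k) ->
  \sum_(k < K.+1) N k <= c * (F 0%N - F K.+1) + z * (\sum_(k < K.+1) e k)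
    + l * (\sum_(k < K.+1) Bs k) - 2 * \sum_(k < K.+1) dot k.
Proof.
move=> h; have -> : F 0%N - F K.+1 = \sum_(k < K.+1) (F k - F k.+1).
  elim: K => [|K ih]; first by rewrite big_ord1.
  by rewrite big_ord_recr /= -ih addrA subrK.
rewrite !mulr_sumr -!big_split -sumrB /=.
by apply: ler_sum => k _; exact: h.
Qed.

Section pathwise.
Context (R : realType) (n d : nat) (M : 'M[R]_n) (p : 'cV[R]_n)
  (b kappa L gamma Delta : R) (x0 : 'rV[R]_d)
  (G : nat -> 'M[R]_(n, d) -> 'M[R]_(n, d)) (f : 'I_n -> 'rV[R]_d -> R).
Hypotheses (n0 : (0 < n)%N) (colM : column_stochastic M)
  (p0 : forall i, 0 < p i 0) (Mp : M *m p = p) (sump : \sum_i p i 0 = 1).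
Hypothesis contr : forall d' (A : 'M[R]_(n, d')),
  (const_mx 1 : 'rV[R]_n) *m A = 0 ->
  weighted_sqr p (M *m A) <= b ^+ 2 * weighted_sqr p A.
Hypotheses (k1 : 1 <= kappa) (pk : forall i, (p i 0)^-1 <= n%:R * kappa).
Hypotheses (b0 : 0 <= b) (bk : b * kappa ^+ 7 * n%:R ^+ 2 <= 4^-1).
Hypotheses (L0 : 0 <= L) (lip : forall i, lipschitz_gradient L (f i)).
Hypothesis gap : forall z, mean_cost f x0 - mean_cost f z <= Delta.
Hypotheses (g0 : 0 < gamma) (gL : gamma * L <= 2^-1)
  (gLb : gamma * L * b * kappa ^+ 7 <= 40^-1).

Let pd k := push_diging M gamma x0 G k.
Let x k := pd_x (pd k).
Let y k := pd_y (pd k).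
Let w k := pd_w (pd k).
Let v k := pd_v (pd k).
Let g k := G k (w k).
Let s k := g k - true_gradients f (w k).
Let xb k := row_mean (x k).
Let a k := row_mean (true_gradients f (w k)).
Let grad k := gradient (mean_cost f) (xb k).
Let n0' : 0 < n%:R :> R. Proof. by rewrite ltr0n. Qed.
Let k0 : 0 <= kappa. Proof. exact: le_trans ler01 k1. Qed.

Let vE k : v k = iter k (mulmx M) (const_mx 1).
Proof. by rewrite /v; elim: k => //= k ->. Qed.

Let v_mass k : (const_mx 1 : 'rV[R]_n) *m v k = n%:R%:M.
Proof. by rewrite vE; exact: push_sum_mass. Qed.

Let mean_y k : row_mean (y k) = row_mean (g k).
Proof.
elim: k => [//|k ih]; rewrite /y /= row_mean_stochastic// row_meanB row_meanD.
by rewrite -/(y k) ih -/(w k) -/(g k) addrAC subrr add0r.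
Qed.

Let mean_x k : xb k.+1 = xb k - gamma *: row_mean (g k).
Proof. by rewrite /xb /= row_mean_stochastic// row_meanB row_meanZ mean_y. Qed.

Let e k := deviation (v k) (x k).
Let h k := deviation (v k) (y k).

Let e0 : e 0%N = 0.
Proof.
rewrite /e /deviation /x /= row_mean_const//; apply/matrixP => i j.
by rewrite !mxE big_ord1 !mxE mul1r subrr.
Qed.

Let eS k : e k.+1 = M *m (e k - gamma *: h k).
Proof.
by rewrite /e /= deviation_stochastic// deviationB deviationZ.
Qed.

Let hS k : h k.+1 = M *m (h k + deviation (v k) (g k.+1 - g k)).
Proof.
by rewrite /h /= deviation_stochastic// -deviationD addrA.
Qed.

Let dev_mass k (A : 'M[R]_(n, d)) :
  (const_mx 1 : 'rV[R]_n) *m deviation (v k) A = 0.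
Proof. exact: deviation_mass. Qed.

Let E k := weighted_sqr p (e k).
Let H k := weighted_sqr p (h k).
Let D k := normF (g k.+1 - g k) ^+ 2.
Let eps k := normF (w k - \matrix_(i < n) xb k) ^+ 2.
Let N k := normF (grad k) ^+ 2.
Let S k := normF (s k) ^+ 2.

Let dev_le k (A : 'M[R]_(n, d)) :
  weighted_sqr p (deviation (v k) A) <= 10 * n%:R * kappa * normF A ^+ 2.
Proof.
have vk : weighted_sqr p (v k) <= 4 * n%:R ^+ 2 * kappa.
  by rewrite vE; exact: (push_sum_weighted n0 colM p0 Mp sump contr k1 pk b0 bk).
(* The factor is 2 n kappa + 2 (4 n^2 kappa) / n, that is 10 n kappa. *)
have := weighted_sqr_deviation p0 A n0 pk vk.
rewrite [X in _ <= X * _ -> _](_ : _ = 10 * n%:R * kappa)//.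
by field; rewrite gt_eqF.
Qed.

Let E_rec k : E k.+1 <= 2 * b ^+ 2 * (E k + gamma ^+ 2 * H k).
Proof.
rewrite {1}/E eS; apply: le_trans (contr _) _.
  by rewrite mulmxBr -scalemxAr !dev_mass scaler0 subr0.
rewrite [leRHS](_ : _ = b ^+ 2 * (2 * E k + 2 * (gamma ^+ 2 * H k))); last by ring.
apply: ler_wpM2l; first exact: sqr_ge0.
apply: le_trans (weighted_sqrD p0 _ _) _.
by rewrite -scaleNr weighted_sqrZ sqrrN.
Qed.

Let H_rec k : H k.+1 <= 2 * b ^+ 2 * (H k + 10 * n%:R * kappa * D k).
Proof.
rewrite {1}/H hS; apply: le_trans (contr _) _.
  by rewrite mulmxDr !dev_mass addr0.
rewrite [leRHS](_ : _ = b ^+ 2 * (2 * H k + 2 * (10 * n%:R * kappa * D k)));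
  last by ring.
apply: ler_wpM2l; first exact: sqr_ge0.
apply: le_trans (weighted_sqrD p0 _ _) _.
by rewrite lerD2l ler_pM2l//; exact: dev_le.
Qed.

Let H_0 : H 0%N <= 10 * n%:R * kappa * normF (g 0%N) ^+ 2.
Proof. exact: dev_le. Qed.

Let eps_le k : eps k <= 2 * (kappa / n%:R) * E k.
Proof.
case: k => [|k].
  (* The lower bound on the weights starts at the first step, but initially all rows agree and the
     error is 0. *)
  rewrite /eps /xb /w /x /= row_mean_const// subrr normF_sqr big1; last first.
    by move=> i _; rewrite big1// => j _; rewrite mxE expr0n.
  apply: mulr_ge0; last exact: weighted_sqr_ge0.
  by rewrite mulr_ge0// divr_ge0// ltW.
have := debiased_error n0 colM p0 Mp sump contr k1 pk b0 bk (e k.+1) k.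
rewrite -vE; apply: le_trans; rewrite /eps normF_sqr.
apply: ler_sum => i _; apply: ler_sum => j _.
suff -> : (w k.+1 - \matrix_(i < n) xb k.+1) i j = e k.+1 i j / v k.+1 i 0 by [].
have v0 l : v k.+1 l 0 != 0.
  have := push_sum_lower n0 colM p0 Mp sump contr k1 pk b0 bk k l.
  rewrite -vE => vl; rewrite gt_eqF//; apply: lt_le_trans vl.
  by rewrite mulr_gt0 ?divr_gt0// mulr_gt0.
have wE : w k.+1 i j = (v k.+1 i 0)^-1 * x k.+1 i j.
  by rewrite -invmx_diag_mul.
rewrite mxE wE [e _ _ _]mxE [(- (v _ *m _)) _ _]mxE [(v _ *m _) _ _]mxE.
rewrite big_ord1 -/(xb k.+1) [X in _ + X]mxE [X in _ - X]mxE.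
by field; exact: v0.
Qed.

Let grad_gap k : n%:R * normF (a k - grad k) ^+ 2 <= L ^+ 2 * eps k.
Proof.
have -> : a k - grad k = row_mean (true_gradients f (w k) -
    true_gradients f (\matrix_(i < n) xb k)).
  rewrite row_meanB; congr (_ - _).
  rewrite /grad gradient_mean_cost; last by move=> i z; exact: (lip i).1.
  by congr (_ *: _); apply: eq_bigr => i _; rewrite !rowK.
apply: le_trans (normF_row_mean _ n0) _.
exact: true_gradients_lipschitz.
Qed.

Let mean_g k : row_mean (g k) = a k + row_mean (s k).
Proof. by rewrite /a /s row_meanB addrC subrK. Qed.

Let step_le k : n%:R * normF (xb k.+1 - xb k) ^+ 2 <=
  gamma ^+ 2 * (4 * n%:R * N k + 4 * L ^+ 2 * eps k + 2 * S k).
Proof.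
rewrite mean_x addrAC subrr add0r normFN normF_sqrZ mulrCA.
apply: ler_wpM2l; first exact: sqr_ge0.
have h3 : normF (a k) ^+ 2 <= 2 * normF (a k - grad k) ^+ 2 + 2 * N k.
  by rewrite -{1}(subrK (grad k) (a k)); exact: normFD_sqr.
have h4 : normF (row_mean (g k)) ^+ 2 <=
    2 * normF (a k) ^+ 2 + 2 * normF (row_mean (s k)) ^+ 2.
  by rewrite mean_g; exact: normFD_sqr.
exact: step_arith n0' h4 h3 (grad_gap k) (normF_row_mean (s k) n0).
Qed.

Let D_le k : D k <= 9 * L ^+ 2 * eps k.+1 + 18 * L ^+ 2 * eps k + 9 * n%:R * N k
  + 3 * S k.+1 + 15 / 2 * S k.
Proof.
have h1 : D k <= 3 * (L ^+ 2 * normF (w k.+1 - w k) ^+ 2 + S k.+1 + S k).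
  have -> : D k = normF ((true_gradients f (w k.+1) - true_gradients f (w k))
      + s k.+1 + - s k) ^+ 2.
    rewrite /D /s; do 2 f_equal; apply/matrixP => i j; rewrite !mxE; ring.
  apply: le_trans (normFD3_sqr _ _ _) _; rewrite normFN ler_pM2l//.
  by rewrite !lerD2r; exact: true_gradients_lipschitz.
have h2 : normF (w k.+1 - w k) ^+ 2 <=
   3 * (eps k.+1 + eps k + n%:R * normF (xb k.+1 - xb k) ^+ 2).
  have -> : w k.+1 - w k = (w k.+1 - \matrix_(i < n) xb k.+1)
    + - (w k - \matrix_(i < n) xb k) + \matrix_(i < n) (xb k.+1 - xb k).
    by apply/matrixP => i j; rewrite !mxE; ring.
  apply: le_trans (normFD3_sqr _ _ _) _; rewrite normFN ler_pM2l//.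
  by rewrite normF_const_rows.
apply: gradient_change_arith gL h1 h2 (step_le k);
  by rewrite ?sqr_ge0// ?mulr_ge0// ltW.
Qed.

Let descent k : N k <= 2 / gamma * (mean_cost f (xb k) - mean_cost f (xb k.+1))
  + L ^+ 2 / n%:R * eps k + 2 * L * gamma * normF (row_mean (s k)) ^+ 2
  - 2 * \sum_j grad k 0 j * row_mean (s k) 0 j.
Proof.
have := descent_lemma (xb k) (xb k.+1) L0 (lipschitz_mean_cost n0 L0 lip).
rewrite -/(grad k) (_ : xb k.+1 - xb k = - (gamma *: (a k + row_mean (s k)))); last first.
  by rewrite mean_x mean_g addrAC subrr add0r.
rewrite normFN normF_sqrZ.
rewrite dot_step.
have h3 : normF (a k - grad k) ^+ 2 <= L ^+ 2 / n%:R * eps k.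
  have nK z : n%:R * (L ^+ 2 / n%:R * z) = L ^+ 2 * z.
    by field; rewrite gt_eqF.
  by rewrite -(ler_pM2l n0') nK; exact: grad_gap.
exact: descent_arith L0 g0 gL (sqr_ge0 _) (normFD_sqr _ _) h3.
Qed.

Lemma pathwise_bound K :
  3 / 4 * \sum_(k < K.+1) N k <= 2 * Delta / gamma
  + 144 * kappa ^+ 2 * (gamma * L * b) ^+ 2 * (normF (g 0%N) ^+ 2 / n%:R)
  + 1800 * kappa ^+ 2 * (gamma * L * b) ^+ 2 * b ^+ 2 *
    ((\sum_(k < K.+1) S k) / n%:R)
  + 2 * L * gamma * \sum_(k < K.+1) normF (row_mean (s k)) ^+ 2
  - 2 * \sum_(k < K.+1) \sum_j grad k 0 j * row_mean (s k) 0 j.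
Proof.
have [b4 _] := tracking_gain_small n0 k1 b0 bk.
have hq : kappa ^+ 2 * (gamma * L * b) ^+ 2 <= 40^-1 ^+ 2.
  rewrite -exprMn lerXn2r ?nnegrE ?mulr_ge0// ?(ltW g0)//.
  rewrite mulrC; apply: le_trans gLb.
  by rewrite ler_wpM2l ?mulr_ge0 ?(ltW g0)// ler_eXnr.
have E00 : E 0%N = 0.
  rewrite /E e0 /weighted_sqr big1// => i _.
  by rewrite big1 ?mul0r// => j _; rewrite mxE expr0n.
have := tracking_sums K n0' k1 b0 b4 (sqr_ge0 _)
  (fun k => weighted_sqr_ge0 p0 (e k)) (fun k => weighted_sqr_ge0 p0 (h k))
  (fun k => sqr_ge0 _) (fun k => sqr_ge0 _) (fun k => sqr_ge0 _)
  (fun k => sqr_ge0 _) hq E00 H_0 E_rec H_rec eps_le D_le.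
have := telescoped_descent K descent.
have hgap : 2 / gamma * (mean_cost f (xb 0%N) - mean_cost f (xb K.+1)) <= 2 * Delta / gamma.
  rewrite mulrAC ler_pM2r ?invr_gt0// ler_pM2l//.
  have -> : xb 0%N = x0 by exact: row_mean_const.
  exact: gap.
(* The consensus term costs one tenth of the sum of the squared gradients; the nine tenths that
   remain are rounded down to 3/4. *)
have : 0 <= \sum_(k < K.+1) N k by apply: sumr_ge0 => k _; exact: sqr_ge0.
move: hgap; move: (2 / gamma * _) (L ^+ 2 / _ * _) => t1 t2.
move: (\sum_(k < _) N _) (\sum_(k < _) (normF (row_mean _) ^+ 2)) => t3 t4.
move: (\sum_(k < _) \sum_(j < _) _) => t5; lra.
Qed.

End pathwise.

(** * Step-size *)

(** This trades the real power for a polynomial identity, which also covers den = 0 with r = 0. The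
    case num = 0 with den nonzero is excluded, since the inverse is then infinite. *)
Lemma inv_gamma_finite (R : realType) (num den r : R) (m : nat) : (0 < m)%N ->
  0 <= num -> 0 <= den -> inv_gamma num den m%:R^-1 = r%:E ->
  0 <= r /\ r ^+ m * num = den.
Proof.
move=> m0 num0 den0; rewrite /inv_gamma; case: eqVneq => [->|dn].
  by move=> [<-]; rewrite expr0n gtn_eqF// mul0r.
have nd : 0 <= num / den by rewrite divr_ge0.
rewrite inver; case: eqVneq => // pn [<-].
have pm : ((num / den) `^ m%:R^-1) ^+ m = num / den.
  rewrite -powR_mulrn ?powR_ge0// -powRrM mulVf ?powRr1//.
  by rewrite pnatr_eq0 -lt0n.
split; first by rewrite invr_ge0 powR_ge0.
have n0 : num != 0.
  apply: contra_neq pn => ->; rewrite mul0r powR0//.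
  by rewrite invr_eq0 pnatr_eq0 -lt0n.
by rewrite exprVn pm; field; rewrite n0 dn.
Qed.

Lemma inv_gamma_ge0 (R : realType) (num den e : R) : (0 <= inv_gamma num den e)%E.
Proof.
rewrite /inv_gamma; case: eqP => // _.
by rewrite inver; case: eqP => // _; rewrite lee_fin invr_ge0 powR_ge0.
Qed.

Lemma inv_gamma_fin_num (R : realType) (num den e : R) : 0 < num -> 0 <= den ->
  inv_gamma num den e \is a fin_num.
Proof.
move=> num0 den0; rewrite /inv_gamma; case: eqVneq => // dn.
have d0 : 0 < den by rewrite lt_def dn.
by rewrite inver gt_eqF// powR_gt0// divr_gt0.
Qed.

Lemma root_le (R : realType) (m : nat) (num den r Y Z : R) : (0 < m)%N ->
  0 < num -> 0 <= r -> 0 <= Y -> 0 <= Z -> r ^+ m * num = den ->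
  Z ^+ m * den <= Y ^+ m * num -> Z * r <= Y.
Proof.
move=> m0 num0 r0 Y0 Z0 <-; rewrite mulrA -exprMn ler_pM2r// => h.
by rewrite -(ler_pXn2r m0)// nnegrE// mulr_ge0.
Qed.

(** The identity of [inv_gamma_finite] serves twice: through [root_le] it bounds the inverse r by
    the rate, and here it turns g <= 1/r into an inequality on g. *)
Lemma step_power_le (R : realType) (m : nat) (num den r g : R) :
  0 <= num -> 0 <= r -> 0 <= g -> r ^+ m * num = den -> g * r <= 1 ->
  g ^+ m * den <= num.
Proof.
move=> num0 r0 g0 <- gr; rewrite mulrA -exprMn ler_piMl// exprn_ile1//.
exact: mulr_ge0.
Qed.

(** * Contribution of each of the six terms to the rate *)

Section step_size_rate.
Context (R : realType) (nn K1 L Delta s2 kappa b Y0 rho A B : R).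
Hypotheses (n1 : 1 <= nn) (K11 : 1 <= K1) (L0 : 0 < L) (D0 : 0 < Delta).
Hypotheses (s20 : 0 <= s2) (k1 : 1 <= kappa) (b0 : 0 <= b) (rho0 : 0 <= rho).
Hypothesis bk : b * kappa ^+ 7 * nn ^+ 2 <= 4^-1.
(** With s2 = sigma^2 / R and T = K1 R, [A] is exactly the first term of the rate; [B] is the
    noiseless term, still counted in iterations. *)
Hypotheses (A0 : 0 <= A) (A2 : A ^+ 2 = s2 * L * Delta / (nn * K1)).
Hypothesis BE : B = L * Delta / K1.
Hypothesis Y0le : Y0 <= 2 * nn * s2 + 2 * nn * (rho * (L * Delta)).

Let n0 : 0 < nn. Proof. exact: lt_le_trans ltr01 n1. Qed.
Let K10 : 0 < K1. Proof. exact: lt_le_trans ltr01 K11. Qed.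
Let k0 : 0 < kappa. Proof. exact: lt_le_trans ltr01 k1. Qed.
Let nn_ge0 := ltW n0.
Let k_ge0 := ltW k0.
Let L_ge0 := ltW L0.
Let B0 : 0 <= B. Proof. by rewrite BE divr_ge0 ?mulr_ge0 ?ltW. Qed.
Let Z0 : 0 <= Delta / K1. Proof. by rewrite divr_ge0 ?ltW. Qed.

(** As kappa and nn are at least 1, one factor b pays for every monomial below kappa^7 nn^2. *)
Let bk2 (i j : nat) : (i <= 7)%N -> (j <= 2)%N -> b * kappa ^+ i * nn ^+ j <= 4^-1.
Proof.
move=> i7 j2; apply: le_trans bk; apply: ler_pM.
- by rewrite mulr_ge0// exprn_ge0// ltW.
- by rewrite exprn_ge0// ltW.
- by rewrite ler_wpM2l// ler_weXn2l.
- by rewrite ler_weXn2l.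
Qed.

Let b4 : b <= 4^-1.
Proof. by have := @bk2 0 0 isT isT; rewrite !expr0 !mulr1. Qed.

Let c34 (j : nat) : (3 / 4) ^+ j <= (1 - b) ^+ j.
Proof. by have b4' := b4; rewrite lerXn2r ?nnegrE//; lra. Qed.

Let nonneg (i j : nat) : 0 <= b * kappa ^+ i * nn ^+ j.
Proof. by rewrite !mulr_ge0// exprn_ge0. Qed.

Let rate1 r : 0 <= r -> r ^+ 2 * (2 * nn * Delta) = K1 * L * s2 ->
  Delta / K1 * r <= A.
Proof.
move=> r0 rE; apply: root_le r0 _ _ rE _ => //; first by rewrite !mulr_gt0.
have -> : (Delta / K1) ^+ 2 * (K1 * L * s2) = nn * Delta * A ^+ 2.
  by rewrite A2; field; rewrite !gt_eqF.
have : 0 <= nn * Delta * A ^+ 2.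
  by rewrite mulr_ge0 ?sqr_ge0// mulr_ge0// ltW.
lra.
Qed.

(** Up to factors absorbed by b, the cube of the left-hand side is A^2 B, and A^2 B <= (A + B)^3. *)
Let rate2 r : 0 <= r -> r ^+ 3 * (Delta * (1 - b) ^+ 3) =
    2 * K1 * L ^+ 2 * kappa ^+ 6 * b ^+ 4 * s2 ->
  Delta / K1 * r <= A + B.
Proof.
move=> r0 rE; have b4' := b4; have c0 : 0 < 1 - b by lra.
apply: root_le r0 _ _ rE _ => //; first by rewrite mulr_gt0// exprn_gt0.
  exact: addr_ge0.
have -> : (Delta / K1) ^+ 3 * (2 * K1 * L ^+ 2 * kappa ^+ 6 * b ^+ 4 * s2) =
   Delta * (2 * (b * kappa ^+ 6 * nn ^+ 1 * b ^+ 3) * (A ^+ 2 * B)).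
  by rewrite A2 BE; field; rewrite !gt_eqF.
rewrite [leRHS]mulrCA ler_pM2l//.
have AB : 0 <= A ^+ 2 * B by rewrite mulr_ge0 ?sqr_ge0.
have h1 : b * kappa ^+ 6 * nn ^+ 1 * b ^+ 3 <= 4^-1 * 4^-1 ^+ 3.
  by rewrite ler_pM ?exprn_ge0 ?bk2 ?nonneg// lerXn2r ?nnegrE// invr_ge0.
have h2 := c34 3.
have h3 : A ^+ 2 * B <= (A + B) ^+ 3.
  have : 0 <= A ^+ 3 + 2 * (A ^+ 2 * B) + 3 * (A * B ^+ 2) + B ^+ 3.
    by rewrite !addr_ge0 ?mulr_ge0 ?exprn_ge0.
  by rewrite (_ : (A + B) ^+ 3 = A ^+ 2 * B + (A ^+ 3 + 2 * (A ^+ 2 * B) +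
    3 * (A * B ^+ 2) + B ^+ 3)) ?lerDl//; ring.
rewrite [leRHS]mulrC; apply: ler_pM => //.
  by rewrite mulr_ge0// mulr_ge0 ?nonneg// exprn_ge0.
by lra.
Qed.

(** Here the product is A^2 B^3. The factor 2 pays for the 1200, as 1200 / 4^4 <= 2^5 (3/4)^4. *)
Let rate3 r : 0 <= r -> r ^+ 5 * (nn ^+ 2 * Delta * (1 - b) ^+ 4) =
    1200 * K1 * L ^+ 4 * kappa ^+ 8 * b ^+ 4 * s2 ->
  Delta / K1 * r <= 2 * (A + B).
Proof.
move=> r0 rE; have b4' := b4; have c0 : 0 < 1 - b by lra.
apply: root_le r0 _ _ rE _ => //.
- by rewrite !mulr_gt0// ?exprn_gt0.
- by rewrite mulr_ge0// addr_ge0.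
have -> : (Delta / K1) ^+ 5 * (1200 * K1 * L ^+ 4 * kappa ^+ 8 * b ^+ 4 * s2) =
   nn * Delta * ((1200 * (b * kappa ^+ 2 * nn ^+ 0) ^+ 4) * (A ^+ 2 * B ^+ 3)).
  by rewrite A2 BE; field; rewrite !gt_eqF.
have -> : (2 * (A + B)) ^+ 5 * (nn ^+ 2 * Delta * (1 - b) ^+ 4) =
   nn * Delta * ((32 * nn * (1 - b) ^+ 4) * (A + B) ^+ 5) by ring.
rewrite ler_pM2l ?mulr_gt0//.
have h1 : (b * kappa ^+ 2 * nn ^+ 0) ^+ 4 <= 4^-1 ^+ 4.
  by rewrite lerXn2r ?nnegrE ?bk2 ?nonneg// invr_ge0.
have h2 : (3 / 4) ^+ 4 <= nn * (1 - b) ^+ 4.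
  apply: le_trans (c34 4) _; rewrite ler_peMl// exprn_ge0//.
  exact: ltW.
have h3 : A ^+ 2 * B ^+ 3 <= (A + B) ^+ 5.
  have -> : (A + B) ^+ 5 = (A + B) ^+ 2 * (A + B) ^+ 3 by ring.
  by rewrite ler_pM ?exprn_ge0// lerXn2r ?nnegrE ?addr_ge0 ?lerDl ?lerDr.
apply: ler_pM; last exact: h3.
- by apply: mulr_ge0; [exact: ler0n|rewrite exprn_ge0// nonneg].
- by apply: mulr_ge0; rewrite exprn_ge0.
by lra.
Qed.

(** The noise in [Y0] gives A^2 B / K1 with a factor nn^2, the initial gradients give B^3 rho. Of
    the two factors b, one absorbs kappa^4 nn^2 and the other is at most 1/4, whence 8/16 <=
    (3/4)^2. Under the cube root, rho costs at most 1 + rho. *)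
Let rate4 r : 0 <= r -> r ^+ 3 * ((1 - b) ^+ 2 * Delta) =
    4 * L ^+ 2 * kappa ^+ 4 * b ^+ 2 * Y0 ->
  Delta / K1 * r <= (A + B) * (1 + rho).
Proof.
move=> r0 rE; have b4' := b4; have c0 : 0 < 1 - b by lra.
have AB : 0 <= A + B by rewrite addr_ge0.
apply: root_le r0 _ _ rE _ => //; first by rewrite mulr_gt0// exprn_gt0.
  by rewrite mulr_ge0// addr_ge0.
apply: (@le_trans _ _ ((Delta / K1) ^+ 3 * (4 * L ^+ 2 * kappa ^+ 4 * b ^+ 2 *
    (2 * nn * s2 + 2 * nn * (rho * (L * Delta)))))).
  rewrite ler_wpM2l ?exprn_ge0// ler_wpM2l//.
  by rewrite !mulr_ge0// exprn_ge0.
have -> : (Delta / K1) ^+ 3 * (4 * L ^+ 2 * kappa ^+ 4 * b ^+ 2 *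
    (2 * nn * s2 + 2 * nn * (rho * (L * Delta)))) =
  Delta * (8 * ((b * kappa ^+ 4 * nn ^+ 2) * (b * kappa ^+ 0 * nn ^+ 0)) *
     (A ^+ 2 * B / K1) +
   8 * ((b * kappa ^+ 4 * nn ^+ 1) * (b * kappa ^+ 0 * nn ^+ 0)) *
     (B ^+ 3 * rho)).
  by rewrite A2 BE; field; rewrite !gt_eqF.
rewrite [leRHS]mulrA [leRHS]mulrC ler_pM2l//.
have A2B : 0 <= A ^+ 2 * B by rewrite mulr_ge0 ?sqr_ge0.
have B3r : 0 <= B ^+ 3 * rho by rewrite mulr_ge0 ?exprn_ge0.
have h1 (j : nat) : (j <= 2)%N ->
  (b * kappa ^+ 4 * nn ^+ j) * (b * kappa ^+ 0 * nn ^+ 0) <= 4^-1 * 4^-1.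
  by move=> j2; rewrite ler_pM ?nonneg ?bk2.
have h2 : A ^+ 2 * B / K1 <= A ^+ 2 * B by rewrite ler_pdivrMr// ler_peMr.
have h2' : 0 <= A ^+ 2 * B / K1 by rewrite divr_ge0// ltW.
have h3 : 9 / 16 <= (1 - b) ^+ 2.
  rewrite (_ : 9 / 16 = (3 / 4) ^+ 2); last by field.
  exact: c34.
have h4 : A ^+ 2 * B + B ^+ 3 * rho <= ((A + B) * (1 + rho)) ^+ 3.
  have AB3 : A ^+ 2 * B + B ^+ 3 <= (A + B) ^+ 3.
    have : 0 <= A ^+ 3 + 2 * (A ^+ 2 * B) + 3 * (A * B ^+ 2).
      by rewrite !addr_ge0 ?mulr_ge0 ?exprn_ge0.
    by rewrite (_ : (A + B) ^+ 3 = A ^+ 2 * B + B ^+ 3 + (A ^+ 3 +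
      2 * (A ^+ 2 * B) + 3 * (A * B ^+ 2))) ?lerDl//; ring.
  have B30 : 0 <= B ^+ 3 by rewrite exprn_ge0.
  have r3 : 1 + rho <= (1 + rho) ^+ 3 by rewrite ler_eXnr// lerDl.
  rewrite exprMn; apply: (@le_trans _ _ ((A ^+ 2 * B + B ^+ 3) * (1 + rho))).
    have : 0 <= A ^+ 2 * B * rho by rewrite mulr_ge0.
    by rewrite mulrDl !mulrDr !mulr1; lra.
  by rewrite ler_pM// addr_ge0.
have h5 : 8 * ((b * kappa ^+ 4 * nn ^+ 2) * (b * kappa ^+ 0 * nn ^+ 0)) *
     (A ^+ 2 * B / K1) <= 2^-1 * (A ^+ 2 * B).
  apply: ler_pM => //; first by rewrite mulr_ge0// mulr_ge0 ?nonneg.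
  by have := h1 2 isT; lra.
have h6 : 8 * ((b * kappa ^+ 4 * nn ^+ 1) * (b * kappa ^+ 0 * nn ^+ 0)) *
     (B ^+ 3 * rho) <= 2^-1 * (B ^+ 3 * rho).
  by apply: ler_wpM2r => //; have := h1 1 isT; lra.
apply: (@le_trans _ _ (9 / 16 * ((A + B) * (1 + rho)) ^+ 3)); first by lra.
rewrite [leRHS]mulrC ler_wpM2r// exprn_ge0// mulr_ge0// addr_ge0//.
Qed.

Let rate5 r : 0 <= r -> r ^+ 1 * (1 - b) ^+ 2 = 40 * L * kappa ^+ 7 * b ->
  Delta / K1 * r <= 18 * B.
Proof.
move=> r0 rE; have b4' := b4; have c0 : 0 < 1 - b by lra.
apply: root_le r0 _ _ rE _ => //; rewrite ?exprn_gt0 ?mulr_ge0//.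
have -> : (Delta / K1) ^+ 1 * (40 * L * kappa ^+ 7 * b) =
   (40 * (b * kappa ^+ 7 * nn ^+ 0)) * B.
  by rewrite BE; field; rewrite gt_eqF.
have h3 : 9 / 16 <= (1 - b) ^+ 2.
  rewrite (_ : 9 / 16 = (3 / 4) ^+ 2); last by field.
  exact: c34.
rewrite expr1 [leRHS]mulrAC ler_wpM2r//.
(* The constant 18 comes from 40 / 4 <= 18 (3/4)^2. *)
by have := @bk2 7 0 isT isT; lra.
Qed.

Lemma inverse_steps_rate (r1 r2 r3 r4 r5 r6 : R) :
  0 <= r1 /\ r1 ^+ 2 * (2 * nn * Delta) = K1 * L * s2 ->
  0 <= r2 /\ r2 ^+ 3 * (Delta * (1 - b) ^+ 3) =
    2 * K1 * L ^+ 2 * kappa ^+ 6 * b ^+ 4 * s2 ->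
  0 <= r3 /\ r3 ^+ 5 * (nn ^+ 2 * Delta * (1 - b) ^+ 4) =
    1200 * K1 * L ^+ 4 * kappa ^+ 8 * b ^+ 4 * s2 ->
  0 <= r4 /\ r4 ^+ 3 * ((1 - b) ^+ 2 * Delta) =
    4 * L ^+ 2 * kappa ^+ 4 * b ^+ 2 * Y0 ->
  0 <= r5 /\ r5 ^+ 1 * (1 - b) ^+ 2 = 40 * L * kappa ^+ 7 * b ->
  0 <= r6 /\ r6 ^+ 1 * 1 = 2 * L ->
  Delta / K1 * (r1 + r2 + r3 + r4 + r5 + r6) <= 25 * ((A + B) * (1 + rho)).
Proof.
move=> [h1 /(rate1 h1) e1] [h2 /(rate2 h2) e2] [h3 /(rate3 h3) e3].
move=> [h4 /(rate4 h4) e4] [h5 /(rate5 h5) e5] [_ e6].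
have {}e6 : Delta / K1 * r6 = 2 * B.
  by rewrite expr1 mulr1 in e6; rewrite e6 BE; ring.
have A0' := A0; have B0' := B0.
have : 0 <= (A + B) * rho by rewrite mulr_ge0// addr_ge0.
rewrite !(mulrDr (Delta / K1)) e6 (mulrDr (A + B)) mulr1.
rewrite (mulrDr (A + B)) mulr1 in e4.
(* The six bounds add up to 5 A + 24 B and one (A + B) rho. *)
lra.
Qed.

End step_size_rate.

(** * Bounds on the equilibrium vector and on the number of gossip rounds *)

Lemma kappa_pi_bounds (R : realType) (n : nat) (W : 'M[R]_n) (p : 'cV[R]_n) :
  equilibrium W p ->
  1 <= kappa_pi p /\ forall i, (p i 0)^-1 <= n%:R * kappa_pi p.
Proof.
move=> eqp; have n0 := equilibrium_size_gt0 eqp; have [p0 _ sp] := eqp.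
rewrite /kappa_pi; set mx := \big[_/0]_i _; set mn := \big[_/1]_i _.
have mxP i : p i 0 <= mx by exact: (le_bigmax _ (fun i => p i 0)).
have mnP i : mn <= p i 0 by exact: (bigmin_le _ i (fun i => p i 0)).
have mn0 : 0 < mn by apply/bigmin_gtP; split.
(* The entries sum to 1, so n times the largest is at least 1; dividing by the smallest gives the
   bound by n kappa. *)
have nmx : 1 <= n%:R * mx.
  rewrite -[leLHS]sp -[n in n%:R]card_ord -sum1_card natr_sum mulr_suml.
  by apply: ler_sum => i _; rewrite mul1r.
split.
  by rewrite ler_pdivlMr// mul1r; exact: le_trans (mnP (Ordinal n0)) (mxP _).
move=> i; apply: (@le_trans _ _ mn^-1); first by rewrite lef_pV2 ?posrE.
by rewrite mulrA ler_peMl// invr_ge0 ltW.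
Qed.

(** Since 1 + s^2 <= (1 + s)^2 <= 2 + 2 s^2 for s >= 0, the numerator lies between 2 + 7 ln kappa +
    2 ln n and 4 + 14 ln kappa + 4 ln n. The leading 2 of the lower bound leaves exp(-2) <= 1/4, for
    which e >= 2 suffices; in the upper bound the ceiling costs at most 1 more. *)
Lemma gossip_rounds_bounds (R : realType) (n : nat) (beta kappa : R) :
  (0 < n)%N -> 0 <= beta -> beta < 1 -> 1 <= kappa ->
  let r := gossip_rounds n beta kappa in
  [/\ (0 < r)%N, beta ^+ r * kappa ^+ 7 * n%:R ^+ 2 <= 4^-1 &
      r%:R <= 14 * ((1 + ln kappa) * (1 + ln n%:R)) / (1 - beta)].
Proof.
move=> n0 b0 b1 k1 r.
have n1 : 1 <= n%:R :> R by rewrite ler1n.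
have lk : 0 <= ln kappa by exact: ln_ge0.
have ln0 : 0 <= ln (n%:R : R) by exact: ln_ge0.
have kp : 0 < kappa by exact: lt_le_trans ltr01 k1.
have c0 : 0 < 1 - beta by lra.
set q := (1 + Num.sqrt (7 * ln kappa)) ^+ 2 + (1 + Num.sqrt (2 * ln n%:R)) ^+ 2.
have s1 : Num.sqrt (7 * ln kappa) ^+ 2 = 7 * ln kappa.
  by rewrite sqr_sqrtr// mulr_ge0.
have s2 : Num.sqrt (2 * ln (n%:R : R)) ^+ 2 = 2 * ln n%:R.
  by rewrite sqr_sqrtr// mulr_ge0.
have p1 := sqrtr_ge0 (7 * ln kappa).
have p2 := sqrtr_ge0 (2 * ln (n%:R : R)).
have qlow : 2 + 7 * ln kappa + 2 * ln n%:R <= q by rewrite /q; lra.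
have qup : q <= 4 + 14 * ln kappa + 4 * ln n%:R.
  rewrite /q; have := sqr_ge0 (1 - Num.sqrt (7 * ln kappa)).
  have := sqr_ge0 (1 - Num.sqrt (2 * ln (n%:R : R))); lra.
have q0 : 0 < q by lra.
have x0 : 0 < q / (1 - beta) by rewrite divr_gt0.
have rE : r%:R = (Num.ceil (q / (1 - beta)))%:~R :> R.
  rewrite [LHS]pmulrn /r /gossip_rounds gez0_abs// ceil_ge0.
  by apply: lt_trans x0; rewrite ltrN10.
have rlow : q / (1 - beta) <= r%:R by rewrite rE; exact: ceil_ge.
have rup : r%:R <= q / (1 - beta) + 1.
  by rewrite rE -lerBlDr; have := gt_pred_ceil (q / (1 - beta)); rewrite intrD => /ltW.
clearbody r; split.
- by rewrite -(ltr0n R); exact: lt_le_trans rlow.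
- have e1 : beta ^+ r <= expR (- q).
    apply: (@le_trans _ _ (expR (- (1 - beta)) ^+ r)).
      by rewrite lerXn2r ?nnegrE ?expR_ge0//; have := expR_ge1Dx (- (1 - beta)); lra.
    rewrite -expRM_natl ler_expR mulrN lerN2.
    by rewrite -ler_pdivrMr.
  have e2 : expR (- q) <= expR (- 2) * (kappa ^+ 7 * n%:R ^+ 2)^-1.
    have -> : kappa ^+ 7 * n%:R ^+ 2 = expR (7 * ln kappa + 2 * ln n%:R).
      by rewrite expRD !expRM_natl !lnK// posrE ltr0n.
    by rewrite -expRN -expRD ler_expR; lra.
  have kn : 0 < kappa ^+ 7 * n%:R ^+ 2.
    by rewrite mulr_gt0// exprn_gt0 ?ltr0n.
  rewrite -mulrA; apply: (@le_trans _ _ (expR (- 2))).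
    rewrite -ler_pdivlMr//; exact: le_trans e1 e2.
  have e3 : 2 <= expR (1 : R) by have := expR_ge1Dx (1 : R); lra.
  rewrite expRN lef_pV2 ?posrE ?expR_gt0//.
  rewrite (_ : 2 = 1 + 1 :> R); last by ring.
  rewrite expRD (_ : 4 = 2 * 2 :> R); last by ring.
  exact: ler_pM.
- apply: le_trans rup _; rewrite ler_pdivlMr// mulrDl divfK ?gt_eqF//.
  have : 0 <= ln kappa * ln (n%:R : R) by exact: mulr_ge0.
  lra.
Qed.

(** * Taking expectations *)

Section has_mean.
Context (R : realType) (d : measure_display) (T : measurableType d)
  (P : probability T R).

(** Integrability travels with the value, because the real-valued integral is additive and monotone
    only under it; the pathwise inequality can then be integrated term by term. *)
Definition has_mean (X : T -> R) (v : R) : Prop :=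
  P.-integrable setT (fun t => (X t)%:E) /\ \int[P]_t X t = v.

Lemma has_mean_cst c : has_mean (fun=> c) c.
Proof.
split; first exact: integrable_cstR.
by rewrite Rintegral_cst//= probability_setT mulr1.
Qed.

Lemma has_meanD X Y v w : has_mean X v -> has_mean Y w ->
  has_mean (fun t => X t + Y t) (v + w).
Proof.
move=> [iX <-] [iY <-]; split; last by rewrite RintegralD.
by under eq_fun do rewrite EFinD; exact: integrableD.
Qed.

Lemma has_meanZ c X v : has_mean X v -> has_mean (fun t => c * X t) (c * v).
Proof.
move=> [iX <-]; split; last by rewrite RintegralZl.
by under eq_fun do rewrite EFinM; exact: integrableZl.
Qed.

Lemma has_meanZr c X v : has_mean X v -> has_mean (fun t => X t * c) (v * c).
Proof.
move=> hX; have := has_meanZ c hX; rewrite mulrC.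
by under eq_fun do rewrite mulrC.
Qed.

Lemma has_meanB X Y v w : has_mean X v -> has_mean Y w ->
  has_mean (fun t => X t - Y t) (v - w).
Proof.
move=> hX hY; have := has_meanD hX (has_meanZ (- 1) hY); rewrite mulN1r.
by under eq_fun do rewrite mulN1r.
Qed.

Lemma has_mean_sum (I : Type) (s : seq I) (X : I -> T -> R) (v : I -> R) :
  (forall i, has_mean (X i) (v i)) ->
  has_mean (fun t => \sum_(i <- s) X i t) (\sum_(i <- s) v i).
Proof.
move=> hX; split; first by apply: integrable_sumR => i; exact: (hX i).1.
rewrite Rintegral_sumR; last by move=> i; exact: (hX i).1.
by apply: eq_bigr => i _; exact: (hX i).2.
Qed.

Lemma has_mean_le X Y v w : has_mean X v -> has_mean Y w ->
  (forall t, X t <= Y t) -> v <= w.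
Proof. by move=> [iX <-] [iY <-] XY; apply: le_Rintegral. Qed.

End has_mean.

Section expected_bound.
Context (R : realType) (n d B : nat) (L s2 gamma Delta b kappa : R)
  (M : 'M[R]_n) (p : 'cV[R]_n)
  (x0 : 'rV[R]_d) (dX dO : measure_display) (Xi : measurableType dX)
  (Omega : measurableType dO) (D : 'I_n -> probability Xi R)
  (P : probability Omega R) (gF : 'rV[R]_d -> Xi -> 'rV[R]_d)
  (f : 'I_n -> 'rV[R]_d -> R) (xi : 'I_n -> nat -> 'I_B -> Omega -> Xi).
Hypotheses (L0 : 0 <= L) (n0 : (0 < n)%N) (B0 : (0 < B)%N).
Hypothesis lip : forall i, lipschitz_gradient L (f i).
Hypothesis mgF : measurable_oracle gF.
Hypothesis ub : forall i, unbiased (D i) gF (f i).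
Hypothesis vle : forall i, variance_le (D i) gF (f i) s2.
Hypothesis mxi : forall i k r, measurable_fun setT (xi i k r).
Hypothesis lxi : forall i k r A, measurable A -> P (xi i k r @^-1` A) = D i A.
Hypothesis ixi : mutually_independent P
  (fun s : 'I_n * nat * 'I_B => xi s.1.1 s.1.2 s.2).

Let G (t : Omega) (k : nat) : 'M[R]_(n, d) -> 'M[R]_(n, d) :=
  batch_gradient gF (fun i r => xi i k r t).
Let pd t k := push_diging M gamma x0 (G t) k.
Let N k t := normF (gradient (mean_cost f) (row_mean (pd_x (pd t k)))) ^+ 2.
Let g0 t := G t 0%N (\matrix_(i < n) x0).
Let noise k t := sampling_noise gamma M x0 gF f xi k t.
Let n0' : 0 < n%:R :> R. Proof. by rewrite ltr0n. Qed.
Let B0' : 0 < B%:R :> R. Proof. by rewrite ltr0n. Qed.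

Lemma mean_gradient_integrable k : P.-integrable setT (fun t => (N k t)%:E).
Proof.
exact: (integral_normF_sqr (mean_gradient_square_integrable gamma M x0 L0
  B0 lip mgF ub vle mxi lxi ixi k)).1.
Qed.

Let noise_sq k i j : square_integrable P (fun t => noise k t i j).
Proof.
exact: (sampling_noise_square_integrable gamma M x0 B0 mgF ub vle mxi lxi ixi).
Qed.

Let g0E t : g0 t = noise 0%N t + true_gradients f (\matrix_(i < n) x0).
Proof. by rewrite /noise /sampling_noise /= subrK. Qed.

Lemma initial_gradient_moment :
  P.-integrable setT (fun t => (normF (g0 t) ^+ 2)%:E) /\
  \int[P]_t (normF (g0 t) ^+ 2) <=
  2 * (n%:R * (s2 / B%:R)) + 2 * \sum_i normF (gradient (f i) x0) ^+ 2.
Proof.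
have sg i j : square_integrable P (fun t => g0 t i j).
  under eq_fun do rewrite g0E mxE.
  by apply: square_integrableD; [exact: noise_sq|exact: square_integrable_cst].
have [ig _] := integral_normF_sqr sg; split => //.
have [iN _] := integral_normF_sqr (noise_sq 0%N).
set c := \sum_i _.
have cE : normF (true_gradients f (\matrix_(i < n) x0)) ^+ 2 = c.
  rewrite normF_sqr; apply: eq_bigr => i _; rewrite normF_row_sqr.
  by apply: eq_bigr => j _; rewrite !mxE rowK.
have i2 : P.-integrable setT (fun t => (2 * normF (noise 0%N t) ^+ 2)%:E).
  exact: (integrableZl measurableT (2 : R) iN).
apply: (@le_trans _ _ (\int[P]_t (2 * normF (noise 0%N t) ^+ 2 + 2 * c))).
  apply: le_Rintegral => //.
    apply: (@eq_integrable _ _ _ _ _ measurableT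
      ((fun t => (2 * normF (noise 0%N t) ^+ 2)%:E) \+ (fun=> (2 * c)%:E))%E) => //.
    by apply: integrableD => //; exact: integrable_cstR.
  by move=> t _; rewrite g0E -cE; exact: normFD_sqr.
rewrite RintegralD//; last exact: integrable_cstR.
rewrite RintegralZl// Rintegral_cst//= probability_setT mulr1 lerD2r ler_pM2l//.
exact: (sampling_noise_moment gamma M x0 B0 mgF ub vle mxi lxi ixi).
Qed.

Hypotheses (colM : column_stochastic M) (p0 : forall i, 0 < p i 0)
  (Mp : M *m p = p) (sump : \sum_i p i 0 = 1).
Hypothesis contr : forall d' (A : 'M[R]_(n, d')),
  (const_mx 1 : 'rV[R]_n) *m A = 0 ->
  weighted_sqr p (M *m A) <= b ^+ 2 * weighted_sqr p A.
Hypotheses (k1 : 1 <= kappa) (pk : forall i, (p i 0)^-1 <= n%:R * kappa).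
Hypotheses (b0 : 0 <= b) (bk : b * kappa ^+ 7 * n%:R ^+ 2 <= 4^-1).
Hypothesis gap : forall z, mean_cost f x0 - mean_cost f z <= Delta.
Hypotheses (gam0 : 0 < gamma) (gL : gamma * L <= 2^-1)
  (gLb : gamma * L * b * kappa ^+ 7 <= 40^-1).

Lemma expected_bound K :
  3 / 4 * \sum_(k < K.+1) \int[P]_t N k t <= 2 * Delta / gamma
  + 144 * kappa ^+ 2 * (gamma * L * b) ^+ 2 *
      ((\int[P]_t (normF (g0 t) ^+ 2)) / n%:R)
  + 1800 * kappa ^+ 2 * (gamma * L * b) ^+ 2 * b ^+ 2 *
    (K.+1%:R * (s2 / B%:R))
  + 2 * L * gamma * (K.+1%:R * (s2 / B%:R / n%:R)).
Proof.
have [ig _] := initial_gradient_moment.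
have iN := mean_gradient_integrable.
have iS k : P.-integrable setT (fun t => (normF (noise k t) ^+ 2)%:E).
  exact: (integral_normF_sqr (noise_sq k)).1.
have iB k : P.-integrable setT (fun t => (normF (row_mean (noise k t)) ^+ 2)%:E).
  exact: (integral_normF_sqr (mean_noise_square_integrable gamma M x0 B0
    mgF ub vle mxi lxi ixi k)).1.
pose dot k t := \sum_j gradient (mean_cost f) (row_mean (pd_x (pd t k))) 0 j *
  row_mean (noise k t) 0 j.
have idot k : P.-integrable setT (fun t => (dot k t)%:E) /\ \int[P]_t dot k t = 0.
  exact: (mean_gradient_noise_orthogonal gamma M x0 L0 B0 lip
    mgF ub vle mxi lxi ixi).
have hN k : has_mean P (N k) (\int[P]_t N k t) by split.
have hS k : has_mean P (fun t => normF (noise k t) ^+ 2)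
  (\int[P]_t (normF (noise k t) ^+ 2)) by split.
have hB k : has_mean P (fun t => normF (row_mean (noise k t)) ^+ 2)
  (\int[P]_t (normF (row_mean (noise k t)) ^+ 2)) by split.
have hg : has_mean P (fun t => normF (g0 t) ^+ 2)
  (\int[P]_t (normF (g0 t) ^+ 2)) by split.
have hd k : has_mean P (dot k) 0 by exact: idot.
have hl := has_meanZ (3 / 4) (has_mean_sum (index_enum 'I_K.+1) (fun k => hN (val k))).
have hr := has_meanB (has_meanD (has_meanD (has_meanD
    (has_mean_cst P (2 * Delta / gamma))
    (has_meanZ (144 * kappa ^+ 2 * (gamma * L * b) ^+ 2)
      (has_meanZr n%:R^-1 hg)))
    (has_meanZ (1800 * kappa ^+ 2 * (gamma * L * b) ^+ 2 * b ^+ 2)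
      (has_meanZr n%:R^-1 (has_mean_sum (index_enum 'I_K.+1) (fun k => hS (val k))))))
    (has_meanZ (2 * L * gamma)
      (has_mean_sum (index_enum 'I_K.+1) (fun k => hB (val k)))))
    (has_meanZ 2 (has_mean_sum (index_enum 'I_K.+1) (fun k => hd (val k)))).
have {hl hr} := has_mean_le hl hr (fun t => pathwise_bound (G t) n0 colM p0 Mp
  sump contr k1 pk b0 bk L0 lip gap gam0 gL gLb K).
(* The inner products with the noise, the only terms without a sign, have mean 0. *)
rewrite sumr_const mul0rn mulr0 subr0 => h; apply: le_trans h _.
have sum_le (a : nat -> R) c : (forall k, a k <= c) ->
    \sum_(k < K.+1) a k <= K.+1%:R * c.
  move=> ac; apply: (@le_trans _ _ (\sum_(k < K.+1) c)).
    by apply: ler_sum => k _; exact: ac.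
  by rewrite sumr_const card_ord mulr_natl.
apply: lerD; first apply: lerD => //.
- apply: ler_wpM2l.
    apply: mulr_ge0; last exact: sqr_ge0.
    apply: mulr_ge0; last exact: sqr_ge0.
    by apply: mulr_ge0; [exact: ler0n|exact: sqr_ge0].
  rewrite ler_pdivrMr// -mulrA [s2 / _ * _]mulrC.
  apply: (sum_le (fun k => \int[P]_t (normF (noise k t) ^+ 2))) => k.
  exact: (sampling_noise_moment gamma M x0 B0 mgF ub vle mxi lxi ixi).
- apply: ler_wpM2l.
    by apply: mulr_ge0; [apply: mulr_ge0 => //; exact: ler0n|exact: ltW].
  apply: (sum_le (fun k => \int[P]_t (normF (row_mean (noise k t)) ^+ 2))) => k.
  exact: (mean_noise_moment gamma M x0 n0 B0 mgF ub vle mxi lxi ixi).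
Qed.

End expected_bound.

(** * Choice of the step-size and degenerate cases *)

Lemma optimized_bound (R : realType) (nn K1 L gamma Delta s2 kappa b Y0 S : R) :
  1 <= nn -> 0 <= K1 -> 0 <= L -> 0 < gamma -> 0 <= s2 -> 1 <= kappa ->
  0 <= b -> b < 1 -> 0 <= Y0 -> 0 <= Delta ->
  gamma ^+ 2 * (K1 * L * s2) <= 2 * nn * Delta ->
  gamma ^+ 3 * (2 * K1 * L ^+ 2 * kappa ^+ 6 * b ^+ 4 * s2) <=
    Delta * (1 - b) ^+ 3 ->
  gamma ^+ 3 * (4 * L ^+ 2 * kappa ^+ 4 * b ^+ 2 * Y0) <=
    (1 - b) ^+ 2 * Delta ->
  3 / 4 * S <= 2 * Delta / gamma
    + 144 * kappa ^+ 2 * (gamma * L * b) ^+ 2 * (Y0 / nn)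
    + 1800 * kappa ^+ 2 * (gamma * L * b) ^+ 2 * b ^+ 2 * (K1 * s2)
    + 2 * L * gamma * (K1 * (s2 / nn)) ->
  S <= 1256 * (Delta / gamma).
Proof.
move=> n1 K10 L0 g0 s20 k1 b0 b1 Y00 D0 h1 h2 h4 hS.
have n0 : 0 < nn by exact: lt_le_trans ltr01 n1.
have k0 : 0 <= kappa by exact: le_trans ler01 k1.
have c0 : 0 <= 1 - b by rewrite subr_ge0 ltW.
have c1 (m : nat) : (1 - b) ^+ m <= 1.
  by rewrite exprn_ile1// gerBl.
have k2 (m : nat) : 1 <= kappa ^+ m by exact: exprn_ege1.
(* Every error term is compared with X: gamma <= gamma_4 controls the initial tracker, gamma <=
   gamma_2 the noise that passes through the consensus error, gamma <= gamma_1 the averaged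
   noise. *)
pose X := Delta / gamma.
have XE : Delta = gamma * X by rewrite /X; field; rewrite gt_eqF.
have e2 : kappa ^+ 2 * (gamma * L * b) ^+ 2 * (Y0 / nn) <= 4^-1 * X.
  apply: (@le_trans _ _ (kappa ^+ 2 * (gamma * L * b) ^+ 2 * (kappa ^+ 2 * Y0))).
    apply: ler_wpM2l; first by rewrite mulr_ge0 ?sqr_ge0.
    by rewrite ler_pdivrMr// mulrAC ler_peMl// mulr_ege1.
  rewrite -(ler_pM2l g0).
  have : gamma ^+ 3 * (4 * L ^+ 2 * kappa ^+ 4 * b ^+ 2 * Y0) <= gamma * X.
    by rewrite -XE; apply: le_trans h4 _; rewrite ler_piMl.
  clear; lra.
have e3 : kappa ^+ 2 * (gamma * L * b) ^+ 2 * b ^+ 2 * (K1 * s2) <= 2^-1 * X.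
  apply: (@le_trans _ _ (kappa ^+ 4 * (kappa ^+ 2 * (gamma * L * b) ^+ 2 * b ^+ 2 *
      (K1 * s2)))).
    rewrite ler_peMl//; apply: mulr_ge0; last exact: mulr_ge0.
    by rewrite !mulr_ge0// ltW.
  rewrite -(ler_pM2l g0).
  have : gamma ^+ 3 * (2 * K1 * L ^+ 2 * kappa ^+ 6 * b ^+ 4 * s2) <= gamma * X.
    by rewrite -XE; apply: le_trans h2 _; rewrite ler_piMr.
  clear; lra.
have e4 : L * gamma * (K1 * (s2 / nn)) <= 2 * X.
  rewrite -(ler_pM2l g0) -(ler_pM2l n0).
  have -> : nn * (gamma * (L * gamma * (K1 * (s2 / nn)))) =
      gamma ^+ 2 * (K1 * L * s2) by field; rewrite gt_eqF.
  have -> : nn * (gamma * (2 * X)) = 2 * nn * Delta by rewrite XE; ring.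
  exact: h1.
have {}hS : 3 / 4 * S <= 2 * X
    + 144 * (kappa ^+ 2 * (gamma * L * b) ^+ 2 * (Y0 / nn))
    + 1800 * (kappa ^+ 2 * (gamma * L * b) ^+ 2 * b ^+ 2 * (K1 * s2))
    + 2 * (L * gamma * (K1 * (s2 / nn))).
  by rewrite /X !mulrA in hS *.
(* The total is 2 + 144/4 + 1800/2 + 4 = 942, and 942 * 4/3 = 1256. *)
rewrite -/X; move: e2 e3 e4 hS.
move: (_ * (Y0 / nn)) (_ * (K1 * s2)) (_ * (K1 * (s2 / nn))) => t1 t2 t3.
clear; lra.
Qed.

(** An inverse is infinite only if its numerator vanishes; as n > 0 and b < 1, this forces Delta =
    0. Otherwise the sum is finite, and positive thanks to 2 L. The second case can also occur with
    Delta = 0, when there is no noise. *)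
Lemma step_size_cases (R : realType) (n K : nat) (L Delta s2 kappa b Y0 : R) :
  (0 < n)%N -> 0 < L -> 0 <= Delta -> 0 <= s2 -> 0 <= kappa -> 0 <= b ->
  b < 1 -> 0 <= Y0 ->
  let g := step_size n K L Delta s2 kappa b Y0 in
  (g = 0 /\ Delta = 0) \/
  (0 < g /\ exists r1 r2 r3 r4 r5 r6 : R,
    [/\ 0 <= r1 /\ r1 ^+ 2 * (2 * n%:R * Delta) = K.+1%:R * L * s2,
        0 <= r2 /\ r2 ^+ 3 * (Delta * (1 - b) ^+ 3) =
          2 * K.+1%:R * L ^+ 2 * kappa ^+ 6 * b ^+ 4 * s2,
        0 <= r3 /\ r3 ^+ 5 * (n%:R ^+ 2 * Delta * (1 - b) ^+ 4) =
          1200 * K.+1%:R * L ^+ 4 * kappa ^+ 8 * b ^+ 4 * s2 &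
        0 <= r4 /\ r4 ^+ 3 * ((1 - b) ^+ 2 * Delta) =
          4 * L ^+ 2 * kappa ^+ 4 * b ^+ 2 * Y0] /\
    [/\ 0 <= r5 /\ r5 ^+ 1 * (1 - b) ^+ 2 = 40 * L * kappa ^+ 7 * b,
        0 <= r6 /\ r6 ^+ 1 * 1 = 2 * L &
        g^-1 = r1 + r2 + r3 + r4 + r5 + r6]).
Proof.
move=> n0 L0 D0 s20 k0 b0 b1 Y00 g.
have n0' : 0 < n%:R :> R by rewrite ltr0n.
have c0 : 0 < 1 - b by rewrite subr_gt0.
have cm (m : nat) : 0 < (1 - b) ^+ m by rewrite exprn_gt0.
have lit (m : nat) : 0 <= m%:R :> R by exact: ler0n.
have L0' := ltW L0.
have den1 : 0 <= K.+1%:R * L * s2 by rewrite !mulr_ge0.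
have den2 : 0 <= 2 * K.+1%:R * L ^+ 2 * kappa ^+ 6 * b ^+ 4 * s2.
  by rewrite !mulr_ge0.
have den3 : 0 <= 1200 * K.+1%:R * L ^+ 4 * kappa ^+ 8 * b ^+ 4 * s2.
  apply: mulr_ge0; last exact: s20.
  apply: mulr_ge0; last exact: exprn_ge0.
  apply: mulr_ge0; last exact: exprn_ge0.
  apply: mulr_ge0; last exact: exprn_ge0.
  by apply: mulr_ge0; exact: lit.
have den4 : 0 <= 4 * L ^+ 2 * kappa ^+ 4 * b ^+ 2 * Y0.
  by rewrite !mulr_ge0.
have den5 : 0 <= 40 * L * kappa ^+ 7 * b.
  by rewrite !mulr_ge0.
have den6 : 0 <= 2 * L by rewrite mulr_ge0.
have num1 : 0 <= 2 * n%:R * Delta by rewrite !mulr_ge0.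
have num2 : 0 <= Delta * (1 - b) ^+ 3 by apply: mulr_ge0 => //; exact: ltW.
have num3 : 0 <= n%:R ^+ 2 * Delta * (1 - b) ^+ 4.
  by apply: mulr_ge0; [apply: mulr_ge0 => //; exact: exprn_ge0|exact: ltW].
have num4 : 0 <= (1 - b) ^+ 2 * Delta by apply: mulr_ge0 => //; exact: ltW.
pose i1 := inv_gamma (2 * n%:R * Delta) (K.+1%:R * L * s2) 2^-1.
pose i2 := inv_gamma (Delta * (1 - b) ^+ 3)
  (2 * K.+1%:R * L ^+ 2 * kappa ^+ 6 * b ^+ 4 * s2) 3^-1.
pose i3 := inv_gamma (n%:R ^+ 2 * Delta * (1 - b) ^+ 4)
  (1200 * K.+1%:R * L ^+ 4 * kappa ^+ 8 * b ^+ 4 * s2) 5^-1.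
pose i4 := inv_gamma ((1 - b) ^+ 2 * Delta)
  (4 * L ^+ 2 * kappa ^+ 4 * b ^+ 2 * Y0) 3^-1.
pose i5 := inv_gamma ((1 - b) ^+ 2) (40 * L * kappa ^+ 7 * b) 1.
pose i6 := inv_gamma 1 (2 * L) 1.
have gE : g = fine ((i1 + i2 + i3 + i4 + i5 + i6)^-1)%E by [].
have [|] := boolP (i1 + i2 + i3 + i4 + i5 + i6 \is a fin_num)%E; last first.
  move=> nfin; left.
  have s0 : (0 <= i1 + i2 + i3 + i4 + i5 + i6)%E.
    by rewrite !adde_ge0// inv_gamma_ge0.
  have sE : (i1 + i2 + i3 + i4 + i5 + i6)%E = +oo%E.
    apply/eqP; move: nfin; rewrite ge0_fin_numE// -leNgt leye_eq.
    by [].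
  split; first by rewrite gE sE.
  apply/eqP; apply: contraNT nfin => Dn.
  have Dp : 0 < Delta by rewrite lt_def Dn.
  have f1 : i1 \is a fin_num.
    by apply: inv_gamma_fin_num => //; rewrite !mulr_gt0.
  have f2 : i2 \is a fin_num.
    by apply: inv_gamma_fin_num => //; rewrite mulr_gt0.
  have f3 : i3 \is a fin_num.
    apply: inv_gamma_fin_num; last exact: den3.
    by rewrite mulr_gt0// mulr_gt0// exprn_gt0.
  have f4 : i4 \is a fin_num.
    by apply: inv_gamma_fin_num => //; rewrite mulr_gt0.
  have f5 : i5 \is a fin_num by exact: inv_gamma_fin_num.
  have f6 : i6 \is a fin_num by exact: inv_gamma_fin_num.
  by rewrite !fin_numD f1 f2 f3 f4 f5 f6.
rewrite !fin_numD => /andP[/andP[/andP[/andP[/andP[f1 f2] f3] f4] f5] f6].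
right.
have [p1 e1] := @inv_gamma_finite R _ _ (fine i1) 2 isT num1 den1 (esym (fineK f1)).
have [p2 e2] := @inv_gamma_finite R _ _ (fine i2) 3 isT num2 den2 (esym (fineK f2)).
have [p3 e3] := @inv_gamma_finite R _ _ (fine i3) 5 isT num3 den3 (esym (fineK f3)).
have [p4 e4] := @inv_gamma_finite R _ _ (fine i4) 3 isT num4 den4 (esym (fineK f4)).
have i5E : inv_gamma ((1 - b) ^+ 2) (40 * L * kappa ^+ 7 * b) 1%:R^-1 = (fine i5)%:E.
  by rewrite invr1 fineK.
have i6E : inv_gamma 1 (2 * L) 1%:R^-1 = (fine i6)%:E by rewrite invr1 fineK.
have [p5 e5] := @inv_gamma_finite R _ _ (fine i5) 1 isT (ltW (cm 2)) den5 i5E.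
have [p6 e6] := @inv_gamma_finite R _ _ (fine i6) 1 isT ler01 den6 i6E.
have r6 : 0 < fine i6.
  by rewrite -[fine i6]expr1 -[_ ^+ 1]mulr1 e6 mulr_gt0.
have sp : 0 < fine i1 + fine i2 + fine i3 + fine i4 + fine i5 + fine i6.
  by rewrite ltr_wpDl// !addr_ge0.
have {}gE : g = (fine i1 + fine i2 + fine i3 + fine i4 + fine i5 + fine i6)^-1.
  rewrite gE -(fineK f1) -(fineK f2) -(fineK f3) -(fineK f4) -(fineK f5) -(fineK f6).
  by rewrite -!EFinD inver gt_eqF.
split; first by rewrite gE invr_gt0.
exists (fine i1), (fine i2), (fine i3), (fine i4), (fine i5), (fine i6).
by split; split => //; rewrite gE invrK.
Qed.

Lemma push_diging_zero_step (R : realType) (n d : nat) (M : 'M[R]_n)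
    (x0 : 'rV[R]_d) (G : nat -> 'M[R]_(n, d) -> 'M[R]_(n, d)) k :
  (0 < n)%N -> column_stochastic M ->
  row_mean (pd_x (push_diging M 0 x0 G k)) = x0.
Proof.
move=> n0 cM; elim: k => [|k ih] /=; first exact: row_mean_const.
by rewrite row_mean_stochastic// scale0r subr0.
Qed.

Lemma gradient_minimum (R : realType) (d : nat) (L : R) (f : 'rV[R]_d -> R)
    (x : 'rV[R]_d) : 0 <= L -> lipschitz_gradient L f ->
  (forall y, f x <= f y) -> normF (gradient f x) ^+ 2 = 0.
Proof.
move=> L0 lf fx; apply/eqP; rewrite eq_le sqr_ge0 andbT.
have L1 : 0 < L + 1 by rewrite ltr_wpDl.
(* Taking L + 1 instead of L keeps the length meaningful when L = 0. *)
have t0 : 0 < (L + 1)^-1 by rewrite invr_gt0.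
have := gradient_gap x L0 lf fx (ltW t0); rewrite subrr.
have c0 : 0 < 1 - L * (L + 1)^-1 / 2.
  rewrite subr_gt0 -mulrA -invfM ltr_pdivrMr; last by rewrite mulr_gt0.
  by rewrite mul1r; lra.
by rewrite pmulr_rle0// mulr_gt0.
Qed.

Lemma gradient_affine (R : realType) (d : nat) (f : 'rV[R]_d -> R) (m : R)
    (x : 'rV[R]_d) : lipschitz_gradient 0 f -> (forall y, m <= f y) ->
  normF (gradient f x) ^+ 2 = 0.
Proof.
move=> lf mf; apply/eqP; rewrite eq_le sqr_ge0 andbT leNgt; apply/negP => g0.
have c0 : 0 <= f x - m by rewrite subr_ge0.
(* With L = 0 any length is allowed; this one would decrease f by one unit more than the lower bound
   permits. *)
have t0 : 0 <= (f x - m + 1) / normF (gradient f x) ^+ 2.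
  by apply: divr_ge0; [exact: addr_ge0|exact: ltW].
have := gradient_gap x (lexx 0) lf mf t0.
rewrite mul0r mul0r subr0 mulr1 divfK ?gt_eqF//; lra.
Qed.

Lemma le_sum6 (R : realType) (r1 r2 r3 r4 r5 r6 : R) :
  0 <= r1 -> 0 <= r2 -> 0 <= r3 -> 0 <= r4 -> 0 <= r5 -> 0 <= r6 ->
  forall r, r \in [:: r1; r2; r3; r4; r5; r6] -> r <= r1 + r2 + r3 + r4 + r5 + r6.
Proof.
move=> h1 h2 h3 h4 h5 h6 r; rewrite !inE.
by do 5?[case/orP]; move/eqP ->; lra.
Qed.

Theorem theorem3 (R : realType) :
  exists (q : nat) (C : R -> R),
  forall (n d : nat) (W : 'M[R]_n) (p : 'cV[R]_n) (L Delta sigma : R)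
    (dX dO : measure_display) (Xi : measurableType dX)
    (Omega : measurableType dO)
    (D : 'I_n -> probability Xi R) (P : probability Omega R)
    (F : 'rV[R]_d -> Xi -> R) (x0 : 'rV[R]_d) (K : nat)
    (f : 'I_n -> 'rV[R]_d -> R) (beta kappa : R) (rounds : nat)
    (xi : 'I_n -> nat -> 'I_rounds -> Omega -> Xi),
  nonnegative_mx W -> primitive_mx W -> column_stochastic W ->
  equilibrium W p ->
  beta = beta_pi W p -> kappa = kappa_pi p -> beta < 1 ->
  0 <= L -> 0 <= Delta -> 0 <= sigma ->
  (forall i x, (D i).-integrable setT (EFin \o F x)) ->
  (forall i, f i = local_cost (D i) F) ->
  (forall i, lipschitz_gradient L (f i)) ->
  ((mean_cost f x0)%:E - ereal_inf (range (EFin \o mean_cost f))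
     <= Delta%:E)%E ->
  measurable_oracle (oracle F) ->
  (forall i, unbiased (D i) (oracle F) (f i)) ->
  (forall i, variance_le (D i) (oracle F) (f i) (sigma ^+ 2)) ->
  rounds = gossip_rounds n beta kappa ->
  (forall i k r, measurable_fun setT (xi i k r)) ->
  (forall i k r A, measurable A -> P (xi i k r @^-1` A) = D i A) ->
  mutually_independent P
    (fun s : 'I_n * nat * 'I_rounds => xi s.1.1 s.1.2 s.2) ->
  let G (omega : Omega) (k : nat) : 'M[R]_(n, d) -> 'M[R]_(n, d) :=
    batch_gradient (oracle F) (fun i r => xi i k r omega) in
  let y0 (omega : Omega) : 'M[R]_(n, d) := G omega 0%N (\matrix_(i < n) x0) in
  let gamma : R :=
    step_size n K L Delta (sigma ^+ 2 / rounds%:R) kappa (beta ^+ rounds)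
      (fine ('E_P[fun omega => (normF (y0 omega) ^+ 2)%R])%E) in
  let T : R := (K.+1 * rounds)%:R in
  let xbar (k : nat) (omega : Omega) : 'rV[R]_d :=
    row_mean (pd_x (push_diging (W ^+ rounds) gamma x0 (G omega) k)) in
  ((K.+1%:R^-1)%:E *
     \sum_(k < K.+1)
       'E_P[fun omega => (normF (gradient (mean_cost f) (xbar k omega)) ^+ 2)%R]
   <= (C (initial_ratio L Delta f x0) * (1 + ln n%:R) ^+ q *
       (sigma * Num.sqrt (L * Delta) / Num.sqrt (n%:R * T)
        + (1 + ln kappa) * L * Delta / ((1 - beta) * T)))%:E)%E.
Proof.
(* The factor 1256 comes from [optimized_bound], 25 and 1 + rho from [inverse_steps_rate], 14 and
   the single logarithm of n from [gossip_rounds_bounds]. *)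
exists 1%N, (fun rho => 1256 * 25 * 14 * (1 + rho)).
move=> n d W p L Delta sigma dX dO Xi Omega D P F x0 K f beta kappa rounds xi.
move=> _ _ colW eqW betaE kappaE beta1 L0 D0 sig0 _ _ lip gap mF ub vle roundsE.
move=> mxi lxi ixi.
pose G (omega : Omega) (k : nat) : 'M[R]_(n, d) -> 'M[R]_(n, d) :=
  batch_gradient (oracle F) (fun i r => xi i k r omega).
pose y0 (omega : Omega) := G omega 0%N (\matrix_(i < n) x0).
pose gamma : R :=
  step_size n K L Delta (sigma ^+ 2 / rounds%:R) kappa (beta ^+ rounds)
    (fine ('E_P[fun omega => (normF (y0 omega) ^+ 2)%R])%E).
pose T : R := (K.+1 * rounds)%:R.
pose xbar (k : nat) (omega : Omega) : 'rV[R]_d :=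
  row_mean (pd_x (push_diging (W ^+ rounds) gamma x0 (G omega) k)).
have n0 := equilibrium_size_gt0 eqW.
have [p0 Wp sump] := eqW.
have beta0 : 0 <= beta by rewrite betaE; exact: beta_pi_ge0 eqW.
have [k1 pk] : 1 <= kappa /\ forall i, (p i 0)^-1 <= n%:R * kappa.
  by rewrite kappaE; exact: kappa_pi_bounds eqW.
have [R0 bk Rup] := gossip_rounds_bounds n0 beta0 beta1 k1.
rewrite -roundsE in R0 bk Rup.
set b := beta ^+ rounds in bk.
have b0 : 0 <= b by exact: exprn_ge0.
have colM : column_stochastic (W ^+ rounds).
  rewrite /column_stochastic; elim: (rounds) => [|r ih].
    by rewrite expr0 mulmx1.
  by rewrite exprS -mulmxE mulmxA colW.
have Mp : W ^+ rounds *m p = p.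
  elim: (rounds) => [|r ih]; first by rewrite expr0 mul1mx.
  by rewrite exprS -mulmxE -mulmxA ih Wp.
have contr d' (A : 'M[R]_(n, d')) : (const_mx 1 : 'rV[R]_n) *m A = 0 ->
    weighted_sqr p (W ^+ rounds *m A) <= b ^+ 2 * weighted_sqr p A.
  by move=> A0; rewrite /b betaE; exact: weighted_sqr_contraction.
have gap' z : mean_cost f x0 - mean_cost f z <= Delta.
  rewrite -lee_fin EFinB; apply: le_trans gap.
  by apply: leeB => //; apply: ereal_inf_lbound; exists z.
have lipf := lipschitz_mean_cost n0 L0 lip.
have n0' : 0 < n%:R :> R by rewrite ltr0n.
have n1 : 1 <= n%:R :> R by rewrite ler1n.
have lk : 0 <= ln kappa by exact: ln_ge0.
have lnn : 0 <= ln (n%:R : R) by exact: ln_ge0.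
have c0 : 0 < 1 - beta by rewrite subr_gt0.
have T0 : 0 < T by rewrite ltr0n muln_gt0.
have K0 : 0 < K.+1%:R :> R by rewrite ltr0n.
pose A := sigma * Num.sqrt (L * Delta) / Num.sqrt (n%:R * T).
pose Q := (1 + ln kappa) * L * Delta / ((1 - beta) * T).
have A0 : 0 <= A by rewrite divr_ge0 ?mulr_ge0 ?sqrtr_ge0.
have Q0 : 0 <= Q.
  apply: divr_ge0; first by rewrite !mulr_ge0// addr_ge0.
  by rewrite mulr_ge0 ?ltW.
have rho0 : 0 <= initial_ratio L Delta f x0.
  apply: divr_ge0; last exact: mulr_ge0.
  by rewrite mulr_ge0 ?invr_ge0 ?ler0n// sumr_ge0// => i _; exact: sqr_ge0.
set rho := initial_ratio L Delta f x0 in rho0 *.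
suff : ((K.+1%:R^-1)%:E * \sum_(k < K.+1)
      'E_P[fun omega => (normF (gradient (mean_cost f) (xbar k omega)) ^+ 2)%R]
    <= (1256 * 25 * 14 * (1 + rho) * (1 + ln n%:R) * (A + Q))%:E)%E.
  by rewrite -[1 + ln _]expr1.
have rhs0 : 0 <= 1256 * 25 * 14 * (1 + rho) * (1 + ln n%:R) * (A + Q).
  apply: mulr_ge0; last exact: addr_ge0.
  apply: mulr_ge0; last exact: addr_ge0.
  apply: mulr_ge0; last exact: addr_ge0.
  by apply: mulr_ge0; [apply: mulr_ge0; exact: ler0n|exact: ler0n].
have zero_case : (forall k omega,
    normF (gradient (mean_cost f) (xbar k omega)) ^+ 2 = 0) ->
    ((K.+1%:R^-1)%:E * \sum_(k < K.+1)
      'E_P[fun omega => (normF (gradient (mean_cost f) (xbar k omega)) ^+ 2)%R]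
    <= (1256 * 25 * 14 * (1 + rho) * (1 + ln n%:R) * (A + Q))%:E)%E.
  move=> z; rewrite big1 ?mule0 ?lee_fin// => k _.
  by under eq_fun do rewrite z; rewrite expectation_cst.
have [L00|Ln0] := eqVneq L 0.
  apply: zero_case => k omega.
  apply: (@gradient_affine _ _ _ (mean_cost f x0 - Delta)).
    by rewrite -L00.
  by move=> z; have := gap' z; lra.
have Lp : 0 < L by rewrite lt_def Ln0.
have s20 : 0 <= sigma ^+ 2 / rounds%:R by rewrite divr_ge0 ?sqr_ge0.
pose Y0 := \int[P]_t (normF (y0 t) ^+ 2).
have gamE : gamma = step_size n K L Delta (sigma ^+ 2 / rounds%:R) kappa b Y0.
  by rewrite /gamma /Y0 /Rintegral unlock.
have Y00 : 0 <= Y0 by apply: Rintegral_ge0 => t _; exact: sqr_ge0.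
have b4 : b <= 4^-1 by case: (tracking_gain_small n0 k1 b0 bk).
have b1 : b < 1 by apply: le_lt_trans b4 _; rewrite invf_lt1 ?ltr1n.
have k0 : 0 <= kappa by exact: le_trans ler01 k1.
have := step_size_cases K n0 Lp D0 s20 k0 b0 b1 Y00.
rewrite /= -gamE => -[[g0 D00]|[g0 [r1 [r2 [r3 [r4 [r5 [r6 [[h1 h2 h3 h4] [h5 h6 gV]]]]]]]]]].
  (* Here Delta = 0 makes the starting point a minimizer, and the mean iterate stays there. *)
  apply: zero_case => k omega.
  rewrite /xbar g0 push_diging_zero_step//.
  by apply: gradient_minimum L0 lipf _ => z; have := gap' z; lra.
have [p1 e1] := h1; have [p2 e2] := h2; have [p4 e4] := h4.
have [p5 e5] := h5; have [p6 e6] := h6.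
have gr r : r \in [:: r1; r2; r3; r4; r5; r6] -> gamma * r <= 1.
  move=> rin; rewrite mulrC -ler_pdivlMr// div1r gV.
  exact: le_sum6 p1 p2 (proj1 h3) p4 p5 p6 _ rin.
have cm (m : nat) : 0 <= (1 - b) ^+ m by rewrite exprn_ge0// subr_ge0 ltW.
have s1 : gamma ^+ 2 * (K.+1%:R * L * (sigma ^+ 2 / rounds%:R)) <= 2 * n%:R * Delta.
  apply: step_power_le e1 (gr _ _);
    [by rewrite !mulr_ge0|exact: p1|exact: ltW|by rewrite !inE eqxx ?orbT].
have s2 : gamma ^+ 3 * (2 * K.+1%:R * L ^+ 2 * kappa ^+ 6 * b ^+ 4 *
    (sigma ^+ 2 / rounds%:R)) <= Delta * (1 - b) ^+ 3.
  apply: step_power_le e2 (gr _ _);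
    [exact: mulr_ge0|exact: p2|exact: ltW|by rewrite !inE eqxx ?orbT].
have s4 : gamma ^+ 3 * (4 * L ^+ 2 * kappa ^+ 4 * b ^+ 2 * Y0) <=
    (1 - b) ^+ 2 * Delta.
  apply: step_power_le e4 (gr _ _);
    [exact: mulr_ge0|exact: p4|exact: ltW|by rewrite !inE eqxx ?orbT].
have s5 : gamma ^+ 1 * (40 * L * kappa ^+ 7 * b) <= (1 - b) ^+ 2.
  apply: step_power_le e5 (gr _ _);
    [exact: cm|exact: p5|exact: ltW|by rewrite !inE eqxx ?orbT].
have s6 : gamma ^+ 1 * (2 * L) <= 1.
  apply: step_power_le e6 (gr _ _);
    [exact: ler01|exact: p6|exact: ltW|by rewrite !inE eqxx ?orbT].
have gL : gamma * L <= 2^-1 by move: s6; rewrite expr1; clear; lra.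
have gLb : gamma * L * b * kappa ^+ 7 <= 40^-1.
  have : (1 - b) ^+ 2 <= 1 by rewrite exprn_ile1// ?gerBl// subr_ge0 ltW.
  by move: s5; rewrite expr1; clear; lra.
pose N k omega := normF (gradient (mean_cost f) (xbar k omega)) ^+ 2.
have iN k : P.-integrable setT (fun omega => (N k omega)%:E).
  exact: (mean_gradient_integrable gamma (W ^+ rounds) x0 L0 R0 lip mF ub vle
    mxi lxi ixi k).
have SE : (\sum_(k < K.+1) 'E_P[N k] = (\sum_(k < K.+1) \int[P]_t N k t)%:E)%E.
  rewrite -sumEFin; apply: eq_bigr => k _.
  by rewrite EFin_Rintegral// unlock.
rewrite [X in (_ * X <= _)%E]SE -EFinM lee_fin.
have eb := expected_bound L0 n0 R0 lip mF ub vle mxi lxi ixi colM p0 Mp sump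
  contr k1 pk b0 bk gap' g0 gL gLb K.
have hS := optimized_bound n1 (ltW K0) L0 g0 s20 k1 b0 b1 Y00 D0 s1 s2 s4 eb.
rewrite mulrC ler_pdivrMr//; apply: le_trans hS _.
(* With Delta = 0 and a positive step-size the bound Delta / gamma is already 0; the rate
   computation divides by Delta. *)
have [D00|Dn0] := eqVneq Delta 0.
  rewrite D00 mul0r mulr0; apply: mulr_ge0; last exact: ltW.
  exact: rhs0.
have Dp : 0 < Delta by rewrite lt_def Dn0.
have RR0 : 0 < rounds%:R :> R by rewrite ltr0n.
pose B := L * Delta / K.+1%:R.
have TE : T = K.+1%:R * rounds%:R by rewrite /T natrM.
have A2 : A ^+ 2 = sigma ^+ 2 / rounds%:R * L * Delta / (n%:R * K.+1%:R).
  have q1 : Num.sqrt (L * Delta) ^+ 2 = L * Delta.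
    by rewrite sqr_sqrtr// mulr_ge0.
  have q2 : Num.sqrt (n%:R * T) ^+ 2 = n%:R * T.
    by rewrite sqr_sqrtr// mulr_ge0// ltW.
  rewrite /A exprMn exprVn exprMn q1 q2 TE.
  by field; rewrite nat1r !gt_eqF.
have Y0le : Y0 <= 2 * n%:R * (sigma ^+ 2 / rounds%:R) +
    2 * n%:R * (rho * (L * Delta)).
  have [_] := initial_gradient_moment gamma (W ^+ rounds) x0 R0 mF ub vle mxi lxi ixi.
  move=> Yle; apply: le_trans Yle _.
  have -> : \sum_i normF (gradient (f i) x0) ^+ 2 = n%:R * (rho * (L * Delta)).
    by rewrite /rho /initial_ratio; field; rewrite !gt_eqF.
  by rewrite !mulrA.
have K1 : 1 <= K.+1%:R :> R by rewrite ler1n.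
have rate := inverse_steps_rate n1 K1 Lp Dp k1 b0 rho0 bk A0 A2 (erefl B) Y0le
  h1 h2 h3 h4 h5 h6.
(* Counting in samples instead of iterations multiplies B by the number of rounds over T; the upper
   bound on the rounds provides (1 + ln kappa) / (1 - beta) and the factor logarithmic in n. *)
have AB : A + B <= 14 * (1 + ln n%:R) * (A + Q).
  have BQ : B <= 14 * (1 + ln n%:R) * Q.
    have -> : 14 * (1 + ln n%:R) * Q = B / rounds%:R *
        (14 * ((1 + ln kappa) * (1 + ln n%:R)) / (1 - beta)).
      by rewrite /Q /B TE; field; rewrite nat1r !gt_eqF.
    rewrite mulrAC ler_pdivlMr// ler_wpM2l//.
    by rewrite divr_ge0 ?mulr_ge0 ?ltW.
  have : 0 <= ln n%:R * A by exact: mulr_ge0.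
  by move: BQ A0; clear; lra.
rewrite gV (_ : Delta * _ = K.+1%:R * (Delta / K.+1%:R *
  (r1 + r2 + r3 + r4 + r5 + r6))); last by field; rewrite nat1r gt_eqF.
rewrite mulrCA [leRHS]mulrC ler_pM2l//.
apply: (@le_trans _ _ (1256 * (25 * ((A + B) * (1 + rho))))).
  by apply: ler_wpM2l rate; exact: ler0n.
have -> : 1256 * 25 * 14 * (1 + rho) * (1 + ln n%:R) * (A + Q) =
  1256 * (25 * ((14 * (1 + ln n%:R) * (A + Q)) * (1 + rho))) by ring.
apply: ler_wpM2l; first exact: ler0n.
apply: ler_wpM2l; first exact: ler0n.
by apply: ler_wpM2r; first exact: addr_ge0.
Qed.
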